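(* For every $\epsilon>0$ there exists a high-probability Monte-Carlo $(1-\epsilon)$-approximation algorithm for $\textsc{ProductDesign}(2)$ with running time $O(\epsilon^{-3}n(\log n)^2)$, where $n$ is the number of customers.
   Context: $\textsc{ProductDesign}(d)$: given a Pareto-optimal market of customers $C_1,\ldots,C_n$, $C_i=(p_i,q_{i,1},\ldots,q_{i,d})\in\mathbb{R}^{d+1}$ (no two customers with $q_{i,k}>q_{j,k}$ for all $k$ and $p_i<p_j$), find a product $P=(p,q_1,\ldots,q_d)\in\mathbb{R}^{d+1}$ maximizing $\operatorname{profit}(P)=\bigl(p-\sum_{k=1}^d q_k\bigr)\cdot|\{i: p\le p_i \text{ and } q_k\ge q_{i,k}\ \forall k\}|$. A point $P$ is a $(1-\epsilon)$-approximate solution if $\operatorname{profit}(P)\ge(1-\epsilon)\operatorname{profit}(P^* )$ for all $P^*\in\mathbb{R}^{d+1}$. A (high-probability) Monte-Carlo $(1-\epsilon)$-approximation algorithm, given an instance of size $n$, outputs a $(1-\epsilon)$-approximate solution with probability at least $1-n^{-c}$ for some constant $c>0$.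
   Formalization: The formal theorem takes 0<ε<1: for ε>1 no (1-ε)-approximate solution exists, since profit(P* ) is unbounded below and (1-ε)<0; ε=1 follows from ε=1/2. It also takes n≥2, so that log n>0. *)

(* Defs.v *)
From Stdlib Require Import Reals ZArith List Lia Lra.
Import ListNotations.
Open Scope R_scope.

Definition point := (R * R * R)%type.
Definition pr (c : point) : R := fst (fst c).
Definition q1 (c : point) : R := snd (fst c).
Definition q2 (c : point) : R := snd c.

Definition market := list point.
Definition cust (M : market) (i : nat) : point := nth i M (0, 0, 0).

Definition pareto_optimal (M : market) : Prop :=
  forall i j, (i < length M)%nat -> (j < length M)%nat ->
    ~ (q1 (cust M i) > q1 (cust M j) /\ q2 (cust M i) > q2 (cust M j) /\
       pr (cust M i) < pr (cust M j)).

Definition buys (P C : point) : Prop :=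
  pr P <= pr C /\ q1 P >= q1 C /\ q2 P >= q2 C.

Definition buysb (P C : point) : bool :=
  if Rle_dec (pr P) (pr C) then
    if Rge_dec (q1 P) (q1 C) then
      if Rge_dec (q2 P) (q2 C) then true else false
    else false
  else false.

Definition num_buyers (M : market) (P : point) : nat :=
  length (filter (buysb P) M).

Definition profit (M : market) (P : point) : R :=
  (pr P - (q1 P + q2 P)) * INR (num_buyers M P).

Definition approx_solution (eps : R) (M : market) (P : point) : Prop :=
  forall Pstar : point, profit M P >= (1 - eps) * profit M Pstar.

(* Two unbounded memories: integer cells (Z -> Z) and real cells (Z -> R).
   Unit-cost instructions: integer +, -, halving; real +, -, *, /;
   direct and indirect (integer-addressed) loads/stores; comparisons and
   jumps; a fair coin flip; halt.  Arguments d, a, b, s are cell addresses. *)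
Inductive instr : Type :=
| IConst (d : Z) (z : Z)
| IAdd (d a b : Z)
| ISub (d a b : Z)
| IHalf (d a : Z)
| ILoad (d a : Z)
| IStore (a s : Z)
| RLoad (d a : Z)
| RStore (a s : Z)
| ROfInt (d a : Z)
| RAdd (d a b : Z)
| RSub (d a b : Z)
| RMul (d a b : Z)
| RDiv (d a b : Z)
| JLtI (a b : Z) (t : nat)
| JEqI (a b : Z) (t : nat)
| JLtR (a b : Z) (t : nat)
| JEqR (a b : Z) (t : nat)
| Jmp (t : nat)
| Coin (d : Z)
| Halt.

Definition program := list instr.

Record state : Type := mkState {
  pc : nat; imem : Z -> Z; rmem : Z -> R; ncoins : nat }.

Definition updZ (m : Z -> Z) (a : Z) (v : Z) : Z -> Z :=
  fun x => if Z.eqb x a then v else m x.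
Definition updR (m : Z -> R) (a : Z) (v : R) : Z -> R :=
  fun x => if Z.eqb x a then v else m x.

Definition setI (st : state) (a : Z) (v : Z) : state :=
  mkState (S (pc st)) (updZ (imem st) a v) (rmem st) (ncoins st).
Definition setR (st : state) (a : Z) (v : R) : state :=
  mkState (S (pc st)) (imem st) (updR (rmem st) a v) (ncoins st).
Definition jump (st : state) (b : bool) (t : nat) : state :=
  mkState (if b then t else S (pc st)) (imem st) (rmem st) (ncoins st).

Definition step (coins : nat -> bool) (i : instr) (st : state) : state :=
  let I := imem st in let Rm := rmem st in
  match i with
  | IConst d z => setI st d z
  | IAdd d a b => setI st d (I a + I b)%Z
  | ISub d a b => setI st d (I a - I b)%Z
  | IHalf d a => setI st d (Z.div (I a) 2)
  | ILoad d a => setI st d (I (I a))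
  | IStore a s => setI st (I a) (I s)
  | RLoad d a => setR st d (Rm (I a))
  | RStore a s => setR st (I a) (Rm s)
  | ROfInt d a => setR st d (IZR (I a))
  | RAdd d a b => setR st d (Rm a + Rm b)
  | RSub d a b => setR st d (Rm a - Rm b)
  | RMul d a b => setR st d (Rm a * Rm b)
  | RDiv d a b => setR st d (Rm a / Rm b)
  | JLtI a b t => jump st (Z.ltb (I a) (I b)) t
  | JEqI a b t => jump st (Z.eqb (I a) (I b)) t
  | JLtR a b t => jump st (if Rlt_dec (Rm a) (Rm b) then true else false) t
  | JEqR a b t => jump st (if Req_EM_T (Rm a) (Rm b) then true else false) t
  | Jmp t => jump st true t
  | Coin d =>
      mkState (S (pc st)) (updZ I d (if coins (ncoins st) then 1%Z else 0%Z))
              Rm (S (ncoins st))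
  | Halt => st
  end.

Fixpoint exec (prog : program) (coins : nat -> bool) (fuel : nat) (st : state)
  : option state :=
  match nth_error prog (pc st) with
  | None | Some Halt => Some st
  | Some i =>
      match fuel with
      | O => None
      | S f => exec prog coins f (step coins i st)
      end
  end.

(* Input encoding: I[0] = n; R[3i], R[3i+1], R[3i+2] = p_i, q_{i,1}, q_{i,2}
   (0-based i < n); every other cell is 0. *)
Definition comp (c : point) (k : nat) : R :=
  match k with O => pr c | 1%nat => q1 c | _ => q2 c end.

Definition init_state (M : market) : state :=
  mkState O
    (fun a => if Z.eqb a 0 then Z.of_nat (length M) else 0%Z)
    (fun a => if Z.leb 0 a
              then comp (cust M (Nat.div (Z.to_nat a) 3)) (Nat.modulo (Z.to_nat a) 3)
              else 0)
    O.

Definition output (st : state) : point := (rmem st 0%Z, rmem st 1%Z, rmem st 2%Z).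

Definition run (prog : program) (M : market) (coins : nat -> bool) (fuel : nat)
  : option point :=
  option_map output (exec prog coins fuel (init_state M)).

(* coin stream given by a finite bit string (irrelevant beyond its length) *)
Definition stream_of (b : list bool) : nat -> bool := fun k => nth k b false.

(* [prog] is, on input M, a Monte-Carlo (1-eps)-approximation algorithm with
   worst-case running time at most T and success probability at least q:
   there is a step budget L <= T such that the program halts within L steps
   for EVERY coin sequence (hence uses at most L coins), and among the 2^L
   equally likely coin strings of length L, at least a fraction q lead to an
   output that is a (1-eps)-approximate solution. *)
Definition monte_carlo_run (prog : program) (eps : R) (M : market)
  (T : R) (q : R) : Prop :=
  exists L : nat,
    INR L <= T /\
    (forall coins : nat -> bool, exists P, run prog M coins L = Some P) /\
    exists G : list (list bool),
      NoDup G /\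
      (forall b, In b G -> length b = L /\
         exists P, run prog M (stream_of b) L = Some P /\ approx_solution eps M P) /\
      INR (length G) >= q * 2 ^ L.

(* Main.v *)
(* The algorithm is deterministic. Put m(c) = p - q_1 - q_2 for a customer c, e = 1/N with
   N about 3/eps, and let P be a nearly optimal product with margin m and k buyers.

   If many buyers of P had m(c) > L for L much larger than m, then a third of them would leave
   slack (L - m)/3 in the same coordinate, and moving P there would beat the optimum: at most
   O(k m / L) buyers are that large. So for each margin r in a geometric progression of ratio
   1 + e, between the largest m(c) and a fraction 1/n of it, only the customers with
   m(c) <= 72 N r are needed. Lowering the margin by r e lets q_1 be rounded up to the next of
   a family of columns at least r e apart, each of which has a customer's q_1 just below it.
   Within a column a customer becomes an interval of values of q_2, and the deepest point is
   found by sorting both families of end points.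

   A customer meets at most N m(c) / r columns for margin r, and r >= m(c) / (72 N); the sum
   over the progression is geometric, hence O(N^3) customer-column incidences per customer,
   each costing O(log n) for sorting.

   The algorithm is written in a small structured language with integer and real registers and
   a memory of triples; a verified compiler maps it to the RAM. *)

Require Import Defs.
From Stdlib Require Import Reals ZArith List.
From Stdlib Require Import Lia Lra Permutation Sorted.
Import ListNotations.
Open Scope R_scope.

(* The unqualified [comp] is composition of real functions, from [Reals] *)
Local Notation comp := Defs.comp.

(** The obstacle is a customer whose margin far exceeds r: it meets about N m(c) / r columns, of
    order n N for the smallest r. The cut at 72 N r caps this at 72 N^2. The 72 arises as follows:
    three ways to shift P give 9, comparing with an offer within a factor 2 of the supremum gives 2,
    and m <= 4 r gives 4; then at most k / N buyers are cut.

    Three factors of about 1 - 1/N are lost: m is lowered to the progression, lowered once more to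
    pay for rounding q_1, and the cut buyers are dropped. Hence N >= 3/eps. Margins below a fraction
    1/n of the largest are irrelevant because offering the best customer to itself already earns
    that largest margin, while an offer has at most n buyers.

    The incidences cost only N^3 n log n. The second logarithm comes from the O(N log n) margins,
    each with a scan that costs O(n log n) however few customers survive the cut.

    Machine programs contain integer constants only, so eps enters as the literal N. *)

(** * A structured language and its big-step semantics with costs *)

Inductive aexp : Type :=
| AVar (v : nat) | ACst (z : Z) | AAdd (a b : aexp) | ASub (a b : aexp).

Inductive rexp : Type :=
| RVar (v : nat) | RInt (a : aexp) | RGet (k : nat) (a : aexp)
| RPls (a b : rexp) | RMns (a b : rexp) | RTms (a b : rexp) | RQuo (a b : rexp).

Inductive bexp : Type :=
| BLt (a b : aexp) | BRLt (a b : rexp) | BAnd (a b : bexp) | BNot (a : bexp).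

Inductive cmd : Type :=
| CSkip
| CSetI (v : nat) (a : aexp)
| CSetR (v : nat) (e : rexp)
| CPut (a : aexp) (e1 e2 e3 : rexp)
| CSeq (c1 c2 : cmd)
| CIf (b : bexp) (c1 c2 : cmd)
| CWhile (b : bexp) (c : cmd).

Record store : Type := mkStore { iv : nat -> Z; rv : nat -> R; tm : Z -> point }.

Definition upd {A : Type} (f : nat -> A) (v : nat) (x : A) : nat -> A :=
  fun w => if Nat.eqb w v then x else f w.
Definition updT (f : Z -> point) (k : Z) (x : point) : Z -> point :=
  fun w => if Z.eqb w k then x else f w.

Definition assignI (s : store) v z := mkStore (upd (iv s) v z) (rv s) (tm s).
Definition assignR (s : store) v x := mkStore (iv s) (upd (rv s) v x) (tm s).
Definition putT (s : store) k c := mkStore (iv s) (rv s) (updT (tm s) k c).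

Fixpoint evalA (e : aexp) (s : store) : Z :=
  match e with
  | AVar v => iv s v
  | ACst z => z
  | AAdd a b => (evalA a s + evalA b s)%Z
  | ASub a b => (evalA a s - evalA b s)%Z
  end.

Fixpoint evalR (e : rexp) (s : store) : R :=
  match e with
  | RVar v => rv s v
  | RInt a => IZR (evalA a s)
  | RGet k a => comp (tm s (evalA a s)) k
  | RPls a b => evalR a s + evalR b s
  | RMns a b => evalR a s - evalR b s
  | RTms a b => evalR a s * evalR b s
  | RQuo a b => evalR a s / evalR b s
  end.

(** Negative real cells hold the real registers, so triples may only be read at nonnegative
    addresses. Division carries no condition because the machine has the same total division. *)
Fixpoint safeR (e : rexp) (s : store) : Prop :=
  match e with
  | RVar _ | RInt _ => True
  | RGet _ a => (0 <= evalA a s)%Z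
  | RPls a b | RMns a b | RTms a b | RQuo a b => safeR a s /\ safeR b s
  end.

Fixpoint holds (b : bexp) (s : store) : Prop :=
  match b with
  | BLt a b => (evalA a s < evalA b s)%Z
  | BRLt a b => evalR a s < evalR b s
  | BAnd a b => holds a s /\ holds b s
  | BNot a => ~ holds a s
  end.

(** Compiled conjunctions evaluate both operands, so neither can guard the other. *)
Fixpoint safeB (b : bexp) (s : store) : Prop :=
  match b with
  | BLt _ _ => True
  | BRLt a b => safeR a s /\ safeR b s
  | BAnd a b => safeB a s /\ safeB b s
  | BNot a => safeB a s
  end.

Lemma holds_dec (b : bexp) (s : store) : {holds b s} + {~ holds b s}.
Proof.
  induction b; simpl.
  - apply Z_lt_dec.
  - apply Rlt_dec.
  - destruct IHb1, IHb2; tauto.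
  - destruct IHb; tauto.
Qed.

Fixpoint costA (e : aexp) : Z :=
  match e with
  | AVar _ => 2 | ACst _ => 1
  | AAdd a b | ASub a b => costA a + costA b + 1
  end%Z.

Fixpoint costR (e : rexp) : Z :=
  match e with
  | RVar _ => 3
  | RInt a => costA a + 1
  | RGet _ a => costA a + 5
  | RPls a b | RMns a b | RTms a b | RQuo a b => costR a + costR b + 1
  end%Z.

Fixpoint costB (b : bexp) : Z :=
  match b with
  | BLt a b => costA a + costA b + 4
  | BRLt a b => costR a + costR b + 4
  | BAnd a b => costB a + costB b + 2
  | BNot a => costB a + 2
  end%Z.

(** The integer is an upper bound for the number of machine steps of the compiled code; the second
    branch of a conditional, for instance, is charged for a jump that only the first one takes. *)
Inductive ev : cmd -> store -> Z -> store -> Prop :=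
| ev_skip s : ev CSkip s 0 s
| ev_seti v a s : ev (CSetI v a) s (costA a + 2) (assignI s v (evalA a s))
| ev_setr v e s : safeR e s -> ev (CSetR v e) s (costR e + 2) (assignR s v (evalR e s))
| ev_put a e1 e2 e3 s :
    safeR e1 s -> safeR e2 s -> safeR e3 s -> (0 <= evalA a s)%Z ->
    ev (CPut a e1 e2 e3) s (costR e1 + costR e2 + costR e3 + costA a + 8)
       (putT s (evalA a s) (evalR e1 s, evalR e2 s, evalR e3 s))
| ev_seq c1 c2 s1 s2 s3 t1 t2 :
    ev c1 s1 t1 s2 -> ev c2 s2 t2 s3 -> ev (CSeq c1 c2) s1 (t1 + t2) s3
| ev_if_true b c1 c2 s s' t :
    safeB b s -> holds b s -> ev c1 s t s' -> ev (CIf b c1 c2) s (costB b + 3 + t) s'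
| ev_if_false b c1 c2 s s' t :
    safeB b s -> ~ holds b s -> ev c2 s t s' -> ev (CIf b c1 c2) s (costB b + 3 + t) s'
| ev_while_false b c s :
    safeB b s -> ~ holds b s -> ev (CWhile b c) s (costB b + 2) s
| ev_while_true b c s1 s2 s3 t1 t2 :
    safeB b s1 -> holds b s1 -> ev c s1 t1 s2 -> ev (CWhile b c) s2 t2 s3 ->
    ev (CWhile b c) s1 (costB b + 3 + t1 + t2) s3.

(** * Compilation to the RAM *)

(* Registers [0..39] hold variables and those from [40] on hold temporaries.
   Integer register [v] is integer cell [v], real register [v] is real cell
   [-1 - v], and triple [k] occupies real cells [3k], [3k+1], [3k+2]. *)
Definition nvars : nat := 40.
Definition ir (v : nat) : Z := Z.of_nat v.
Definition rr (v : nat) : Z := (-1 - Z.of_nat v)%Z.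

(** The machine cannot move a register to another, so a copy is an addition of zero. The right
    operand is computed one temporary higher, which keeps the left value intact. *)
Fixpoint compA (e : aexp) (t : nat) : list instr :=
  match e with
  | AVar v => [IConst (ir t) 0; IAdd (ir t) (ir t) (ir v)]
  | ACst z => [IConst (ir t) z]
  | AAdd a b => compA a t ++ compA b (S t) ++ [IAdd (ir t) (ir t) (ir (S t))]
  | ASub a b => compA a t ++ compA b (S t) ++ [ISub (ir t) (ir t) (ir (S t))]
  end.

(* [t] is the target real register, [u] the first free integer temporary *)
Fixpoint compR (e : rexp) (u t : nat) : list instr :=
  match e with
  | RVar v => [IConst (ir u) 0; ROfInt (rr t) (ir u); RAdd (rr t) (rr t) (rr v)]
  | RInt a => compA a u ++ [ROfInt (rr t) (ir u)]
  | RGet k a =>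
      compA a u ++
      [IAdd (ir (S u)) (ir u) (ir u); IAdd (ir u) (ir (S u)) (ir u);
       IConst (ir (S u)) (Z.of_nat (Nat.min k 2));
       IAdd (ir u) (ir u) (ir (S u)); RLoad (rr t) (ir u)]
  | RPls a b => compR a u t ++ compR b u (S t) ++ [RAdd (rr t) (rr t) (rr (S t))]
  | RMns a b => compR a u t ++ compR b u (S t) ++ [RSub (rr t) (rr t) (rr (S t))]
  | RTms a b => compR a u t ++ compR b u (S t) ++ [RMul (rr t) (rr t) (rr (S t))]
  | RQuo a b => compR a u t ++ compR b u (S t) ++ [RDiv (rr t) (rr t) (rr (S t))]
  end.

(** The machine compares only by jumping. With a jump [j] at address [p] and target [p + 3], this
    turns the outcome into a value 0 or 1. *)
Definition bool_tail (j : instr) (u p : nat) : list instr :=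
  [j; IConst (ir u) 0; Jmp (p + 4); IConst (ir u) 1].

(* [p] is the address of the first instruction; the truth value goes to integer register [u] *)
Fixpoint compB (b : bexp) (u p : nat) : list instr :=
  match b with
  | BLt a b =>
      let l := compA a u ++ compA b (S u) in
      let q := (p + length l)%nat in
      l ++ bool_tail (JLtI (ir u) (ir (S u)) (q + 3)) u q
  | BRLt a b =>
      let l := compR a u nvars ++ compR b u (S nvars) in
      let q := (p + length l)%nat in
      l ++ bool_tail (JLtR (rr nvars) (rr (S nvars)) (q + 3)) u q
  | BAnd a b =>
      let l := compB a u p in
      l ++ compB b (S u) (p + length l) ++
      [IAdd (ir u) (ir u) (ir (S u)); IHalf (ir u) (ir u)]
  | BNot a =>
      compB a u p ++ [IConst (ir (S u)) 1; ISub (ir u) (ir (S u)) (ir u)]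
  end.

Definition branch (u p : nat) : list instr :=
  [IConst (ir (S u)) 0; JEqI (ir u) (ir (S u)) p].

Fixpoint compC (c : cmd) (p : nat) : list instr :=
  match c with
  | CSkip => []
  | CSetI v a =>
      compA a nvars ++
      [IConst (ir (S nvars)) 0; IAdd (ir v) (ir nvars) (ir (S nvars))]
  | CSetR v e =>
      compR e nvars nvars ++
      [RSub (rr (S nvars)) (rr nvars) (rr nvars); RAdd (rr v) (rr nvars) (rr (S nvars))]
  | CPut a e1 e2 e3 =>
      compR e1 nvars nvars ++ compR e2 nvars (S nvars) ++ compR e3 nvars (S (S nvars)) ++
      compA a nvars ++
      [IAdd (ir (S nvars)) (ir nvars) (ir nvars);
       IAdd (ir nvars) (ir (S nvars)) (ir nvars);
       IConst (ir (S nvars)) 1;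
       RStore (ir nvars) (rr nvars);
       IAdd (ir nvars) (ir nvars) (ir (S nvars));
       RStore (ir nvars) (rr (S nvars));
       IAdd (ir nvars) (ir nvars) (ir (S nvars));
       RStore (ir nvars) (rr (S (S nvars)))]
  | CSeq c1 c2 =>
      let l := compC c1 p in l ++ compC c2 (p + length l)
  | CIf b c1 c2 =>
      let lb := compB b nvars p in
      let q := (p + length lb + 2)%nat in
      let l1 := compC c1 q in
      let l2 := compC c2 (q + length l1 + 1) in
      lb ++ branch nvars (q + length l1 + 1) ++
      l1 ++ [Jmp (q + length l1 + 1 + length l2)] ++ l2
  | CWhile b c =>
      let lb := compB b nvars p in
      let q := (p + length lb + 2)%nat in
      let l := compC c q in
      lb ++ branch nvars (q + length l + 1) ++ l ++ [Jmp p]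
  end.

Fixpoint wfA (e : aexp) : Prop :=
  match e with
  | AVar v => (v < nvars)%nat
  | ACst _ => True
  | AAdd a b | ASub a b => wfA a /\ wfA b
  end.
Fixpoint wfR (e : rexp) : Prop :=
  match e with
  | RVar v => (v < nvars)%nat
  | RInt a | RGet _ a => wfA a
  | RPls a b | RMns a b | RTms a b | RQuo a b => wfR a /\ wfR b
  end.
Fixpoint wfB (b : bexp) : Prop :=
  match b with
  | BLt a b => wfA a /\ wfA b
  | BRLt a b => wfR a /\ wfR b
  | BAnd a b => wfB a /\ wfB b
  | BNot a => wfB a
  end.
Fixpoint wfC (c : cmd) : Prop :=
  match c with
  | CSkip => True
  | CSetI v a => (v < nvars)%nat /\ wfA a
  | CSetR v e => (v < nvars)%nat /\ wfR e
  | CPut a e1 e2 e3 => wfA a /\ wfR e1 /\ wfR e2 /\ wfR e3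
  | CSeq c1 c2 => wfC c1 /\ wfC c2
  | CIf b c1 c2 => wfB b /\ wfC c1 /\ wfC c2
  | CWhile b c => wfB b /\ wfC c
  end.

(** * Simulation of the language by the machine *)

(** Quantifying over the remaining fuel makes runs compose, and over the coins records that compiled
    code never flips one. *)
Definition reach (prog : program) (k : nat) (st st' : state) : Prop :=
  forall coins f, exec prog coins (k + f) st = exec prog coins f st'.

Definition code_at (prog : program) (p : nat) (l : list instr) : Prop :=
  exists pre post, prog = pre ++ l ++ post /\ length pre = p.

Lemma code_at_app_l prog p l1 l2 : code_at prog p (l1 ++ l2) -> code_at prog p l1.
Proof.
  intros (pre & post & -> & H). exists pre, (l2 ++ post). rewrite <- app_assoc. auto.
Qed.

Lemma code_at_app_r prog p l1 l2 :
  code_at prog p (l1 ++ l2) -> code_at prog (p + length l1) l2.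
Proof.
  intros (pre & post & -> & H). exists (pre ++ l1), post.
  rewrite !length_app, <- !app_assoc. auto.
Qed.

Lemma code_at_cons prog p i l :
  code_at prog p (i :: l) -> nth_error prog p = Some i /\ code_at prog (S p) l.
Proof.
  intros (pre & post & -> & H). split.
  - rewrite nth_error_app2, H, Nat.sub_diag by lia. reflexivity.
  - exists (pre ++ [i]), post. rewrite length_app, <- app_assoc. simpl. split; [easy | lia].
Qed.

Lemma reach_refl prog st : reach prog 0 st st.
Proof. intros coins f. reflexivity. Qed.

Lemma reach_trans prog k1 k2 st1 st2 st3 :
  reach prog k1 st1 st2 -> reach prog k2 st2 st3 -> reach prog (k1 + k2) st1 st3.
Proof.
  intros H1 H2 coins f. rewrite <- Nat.add_assoc, H1. apply H2.
Qed.

Definition deterministic (i : instr) : bool :=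
  match i with Halt | Coin _ => false | _ => true end.

Lemma reach_step prog st i :
  nth_error prog (pc st) = Some i -> deterministic i = true ->
  reach prog 1 st (step (fun _ => false) i st).
Proof.
  intros H Hi coins f. simpl. rewrite H. destruct i; try discriminate; reflexivity.
Qed.

(** The frame condition of expression code: temporaries from the two bounds on may be overwritten,
    while variables, earlier temporaries and triples survive. *)
Definition agree (gi gr : nat) (st st' : state) : Prop :=
  (forall v, (v < gi)%nat -> imem st' (ir v) = imem st (ir v)) /\
  (forall v, (v < gr)%nat -> rmem st' (rr v) = rmem st (rr v)) /\
  (forall a, (0 <= a)%Z -> rmem st' a = rmem st a).

Definition rel (s : store) (st : state) : Prop :=
  (forall v, (v < nvars)%nat -> imem st (ir v) = iv s v) /\
  (forall v, (v < nvars)%nat -> rmem st (rr v) = rv s v) /\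
  (forall k j, (0 <= k)%Z -> (j < 3)%nat ->
     rmem st (3 * k + Z.of_nat j)%Z = comp (tm s k) j).

Lemma agree_refl gi gr st : agree gi gr st st.
Proof. repeat split; auto. Qed.

Lemma agree_trans gi gr st1 st2 st3 :
  agree gi gr st1 st2 -> agree gi gr st2 st3 -> agree gi gr st1 st3.
Proof.
  intros (A1 & A2 & A3) (B1 & B2 & B3). repeat split; intros.
  - rewrite B1, A1; auto.
  - rewrite B2, A2; auto.
  - rewrite B3, A3; auto.
Qed.

Lemma agree_weaken gi gr gi' gr' st st' :
  (gi' <= gi)%nat -> (gr' <= gr)%nat -> agree gi gr st st' -> agree gi' gr' st st'.
Proof.
  intros ? ? (A1 & A2 & A3). repeat split; intros; auto.
  - apply A1; lia.
  - apply A2; lia.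
Qed.

Lemma rel_agree s gi gr st st' :
  (nvars <= gi)%nat -> (nvars <= gr)%nat -> rel s st -> agree gi gr st st' -> rel s st'.
Proof.
  intros Hi Hr (R1 & R2 & R3) (A1 & A2 & A3). repeat split; intros.
  - rewrite A1 by lia; auto.
  - rewrite A2 by lia; auto.
  - rewrite A3 by lia; auto.
Qed.

Lemma updZ_same m a v : updZ m a v a = v.
Proof. unfold updZ. now rewrite Z.eqb_refl. Qed.
Lemma updZ_other m a v b : b <> a -> updZ m a v b = m b.
Proof. intros H. unfold updZ. destruct (Z.eqb_spec b a); congruence. Qed.
Lemma updR_same m a v : updR m a v a = v.
Proof. unfold updR. now rewrite Z.eqb_refl. Qed.
Lemma updR_other m a v b : b <> a -> updR m a v b = m b.
Proof. intros H. unfold updR. destruct (Z.eqb_spec b a); congruence. Qed.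

Ltac cells :=
  repeat first
    [ rewrite updZ_same | rewrite updR_same
    | rewrite updZ_other by (unfold ir, rr in *; lia)
    | rewrite updR_other by (unfold ir, rr in *; lia) ].

Ltac agree_tac :=
  repeat split; cbn [imem rmem setI setR jump step]; intros; cells; reflexivity.

Definition done_at (prog : program) (st : state) (p gi gr : nat) (c : Z)
  (P : state -> Prop) : Prop :=
  exists k st', reach prog k st st' /\ pc st' = p /\ agree gi gr st st' /\
    (Z.of_nat k <= c)%Z /\ P st'.

Lemma done_trans prog st p1 p2 gi1 gr1 gi gr c1 c2 P1 P2 c :
  done_at prog st p1 gi1 gr1 c1 P1 ->
  (gi <= gi1)%nat -> (gr <= gr1)%nat ->
  (forall st1, pc st1 = p1 -> agree gi1 gr1 st st1 -> P1 st1 ->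
     done_at prog st1 p2 gi gr c2 P2) ->
  (c1 + c2 <= c)%Z ->
  done_at prog st p2 gi gr c P2.
Proof.
  intros (k1 & st1 & R1 & E1 & A1 & C1 & Q1) Hi Hr H Hc.
  destruct (H st1 E1 A1 Q1) as (k2 & st2 & R2 & E2 & A2 & C2 & Q2).
  exists (k1 + k2)%nat, st2. split; [ | split; [ | split; [ | split ] ] ]; auto.
  - eapply reach_trans; eauto.
  - eapply agree_trans; [ | exact A2 ]. eapply agree_weaken; eauto.
  - lia.
Qed.

Lemma done_step prog st i l p gi gr c P :
  code_at prog (pc st) (i :: l) -> deterministic i = true ->
  agree gi gr st (step (fun _ => false) i st) ->
  (code_at prog (S (pc st)) l ->
   done_at prog (step (fun _ => false) i st) p gi gr (c - 1) P) ->
  done_at prog st p gi gr c P.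
Proof.
  intros H Hi A K. destruct (code_at_cons _ _ _ _ H) as [N C].
  destruct (K C) as (k & st' & R1 & E1 & A1 & C1 & Q1).
  exists (S k), st'. split; [ | split; [ | split; [ | split ] ] ]; auto.
  - apply (reach_trans prog 1 k _ _ _ (reach_step _ _ _ N Hi) R1).
  - eapply agree_trans; eauto.
  - lia.
Qed.

Lemma done_now prog st p gi gr c (P : state -> Prop) :
  pc st = p -> (0 <= c)%Z -> P st -> done_at prog st p gi gr c P.
Proof.
  intros. exists 0%nat, st. split; [ | split; [ | split; [ | split ] ] ]; auto using reach_refl, agree_refl.
Qed.

Ltac astep H :=
  eapply done_step; [ exact H | reflexivity | agree_tac | clear H; intros H ];
  cbn [step setI setR pc imem rmem jump] in *.


Ltac mred := cbn [step setI setR pc imem rmem jump ncoins].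
Ltac finish := apply done_now; [cbn; lia | lia |]; mred; cells.

Lemma compA_correct prog e s : forall t st gr,
  wfA e -> (nvars <= t)%nat -> (nvars <= gr)%nat -> rel s st ->
  code_at prog (pc st) (compA e t) ->
  done_at prog st (pc st + length (compA e t)) t gr (costA e)
    (fun st' => imem st' (ir t) = evalA e s).
Proof.
  induction e as [v | z | a IHa b IHb | a IHa b IHb]; intros t st gr W Ht Hgr Hrel C;
    cbn [compA wfA costA evalA] in *.
  1: { astep C. astep C. finish. destruct Hrel as (R1 & _). rewrite R1 by auto. lia. }
  1: { astep C. finish. reflexivity. }
  all: destruct W as [Wa Wb]; rewrite !length_app; cbn [length];
    (eapply done_trans with (gi1 := t) (gr1 := gr) (c2 := (costA b + 1)%Z);
      [ apply (IHa t st gr); eauto using code_at_app_l | lia | lia | | lia ]);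
    intros st1 E1 A1 V1; apply code_at_app_r in C; rewrite <- E1 in C;
    assert (Hrel1 : rel s st1) by (eapply rel_agree; [ | | exact Hrel | exact A1 ]; lia);
    (eapply done_trans with (gi1 := S t) (gr1 := gr) (c2 := 1%Z);
      [ apply (IHb (S t) st1 gr); eauto using code_at_app_l | lia | lia | | lia ]);
    intros st2 E2 A2 V2; apply code_at_app_r in C; rewrite <- E2 in C;
    assert (K : imem st2 (ir t) = evalA a s) by (rewrite (proj1 A2) by lia; exact V1);
    astep C; finish; congruence.
Qed.

(** [comp] reads the second quality for every index from 2 on, whereas addresses must stay within
    the triple. *)
Lemma comp_min c k : comp c (Nat.min k 2) = comp c k.
Proof. destruct k as [|[|[|k]]]; reflexivity. Qed.

Lemma compR_correct prog e s : forall u t st gi,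
  wfR e -> safeR e s -> (nvars <= u)%nat -> (nvars <= t)%nat ->
  (nvars <= gi <= u)%nat -> rel s st ->
  code_at prog (pc st) (compR e u t) ->
  done_at prog st (pc st + length (compR e u t)) gi t (costR e)
    (fun st' => rmem st' (rr t) = evalR e s).
Proof.
  induction e as [v | x | k x | a IHa b IHb | a IHa b IHb | a IHa b IHb | a IHa b IHb];
    intros u t st gi W Sf Hu Ht Hg Hrel C; cbn [compR wfR safeR costR evalR] in *.
  1: { astep C. astep C. astep C. finish.
       destruct Hrel as (_ & R2 & _). rewrite R2 by auto. ring. }
  1: { rewrite length_app; cbn [length].
       eapply done_trans with (gi1 := u) (gr1 := t) (c2 := 1%Z);
         [ apply (compA_correct prog x s u st t); eauto using code_at_app_l | lia | lia | | lia ].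
       intros st1 E1 A1 V1. apply code_at_app_r in C; rewrite <- E1 in C.
       astep C. finish. congruence. }
  1: { rewrite length_app; cbn [length].
       eapply done_trans with (gi1 := u) (gr1 := t) (c2 := 5%Z);
         [ apply (compA_correct prog x s u st t); eauto using code_at_app_l | lia | lia | | lia ].
       intros st1 E1 A1 V1. apply code_at_app_r in C; rewrite <- E1 in C.
       assert (Hrel1 : rel s st1) by (eapply rel_agree; [ | | exact Hrel | exact A1 ]; lia).
       do 5 astep C. finish. rewrite V1.
       destruct Hrel1 as (_ & _ & R3).
       rewrite <- comp_min. rewrite <- R3 by lia. f_equal. lia. }
  all: destruct W as [Wa Wb], Sf as [Sa Sb]; rewrite !length_app; cbn [length];
    (eapply done_trans with (gi1 := gi) (gr1 := t) (c2 := (costR b + 1)%Z);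
      [ apply (IHa u t st gi); eauto using code_at_app_l | lia | lia | | lia ]);
    intros st1 E1 A1 V1; apply code_at_app_r in C; rewrite <- E1 in C;
    assert (Hrel1 : rel s st1) by (eapply rel_agree; [ | | exact Hrel | exact A1 ]; lia);
    (eapply done_trans with (gi1 := gi) (gr1 := S t) (c2 := 1%Z);
      [ apply (IHb u (S t) st1 gi); eauto using code_at_app_l | lia | lia | | lia ]);
    intros st2 E2 A2 V2; apply code_at_app_r in C; rewrite <- E2 in C;
    assert (K : rmem st2 (rr t) = evalR a s) by (rewrite (proj1 (proj2 A2)) by lia; exact V1);
    astep C; finish; congruence.
Qed.

Definition is_truth (P : Prop) (z : Z) : Prop := (P /\ z = 1%Z) \/ (~ P /\ z = 0%Z).

Lemma bool_tail_correct prog st j u p gi gr (b : bool) :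
  (gi <= u)%nat -> code_at prog (pc st) (bool_tail j u p) -> p = pc st ->
  deterministic j = true ->
  step (fun _ => false) j st = jump st b (p + 3) ->
  done_at prog st (p + 4) gi gr 3
    (fun st' => imem st' (ir u) = if b then 1%Z else 0%Z).
Proof.
  intros Hu C -> Hj E. unfold bool_tail in C.
  eapply done_step; [ exact C | exact Hj | rewrite E; agree_tac | ]. intros C1. rewrite E.
  destruct b.
  - assert (C3 : code_at prog (pc st + 3) [IConst (ir u) 1]).
    { apply (code_at_app_r _ _ [j; IConst (ir u) 0; Jmp (pc st + 4)] _ C). }
    eapply done_step; [ exact C3 | reflexivity | agree_tac | intros _ ].
    finish. reflexivity.
  - cbn [jump pc] in C1.
    eapply done_step; [ exact C1 | reflexivity | agree_tac | clear C1; intros C1 ].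
    eapply done_step; [ exact C1 | reflexivity | agree_tac | intros _ ].
    finish. reflexivity.
Qed.

Lemma compB_correct prog b s : forall u st p,
  wfB b -> safeB b s -> (nvars <= u)%nat -> rel s st -> p = pc st ->
  code_at prog p (compB b u p) ->
  done_at prog st (p + length (compB b u p)) u nvars (costB b)
    (fun st' => is_truth (holds b s) (imem st' (ir u))).
Proof.
  induction b as [x y | x y | a IHa b IHb | a IHa]; intros u st p W Sf Hu Hrel Hp C;
    cbn [compB wfB safeB costB holds] in *.
  - destruct W as [Wx Wy]. rewrite !length_app in *. cbn [length bool_tail].
    rewrite <- app_assoc in C. rewrite Hp in C.
    eapply done_trans with (gi1 := u) (gr1 := nvars) (c2 := (costA y + 3)%Z);
      [ apply (compA_correct prog x s u st nvars); eauto using code_at_app_l | lia | lia | | lia ].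
    intros st1 E1 A1 V1. apply code_at_app_r in C; rewrite <- E1 in C.
    assert (Hrel1 : rel s st1) by (eapply rel_agree; [ | | exact Hrel | exact A1 ]; lia).
    eapply done_trans with (gi1 := S u) (gr1 := nvars) (c2 := 3%Z);
      [ apply (compA_correct prog y s (S u) st1 nvars); eauto using code_at_app_l | lia | lia | | lia ].
    intros st2 E2 A2 V2. apply code_at_app_r in C; rewrite <- E2 in C.
    assert (K : imem st2 (ir u) = evalA x s) by (rewrite (proj1 A2) by lia; exact V1).
    replace (p + _)%nat with (pc st2 + 4)%nat by (cbn; lia).
    replace (pc st + _)%nat with (pc st2) in C by lia.
    eapply done_trans with (c2 := 0%Z);
      [ eapply bool_tail_correct; [ | exact C | reflexivity | reflexivity | reflexivity ] | | | | ];
      [ apply le_n | apply le_n | apply le_n | | lia ].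
    intros st3 E3 A3 V3. apply done_now; [ auto | lia | ].
    rewrite V3, K, V2. unfold is_truth. destruct (Z.ltb_spec (evalA x s) (evalA y s)); lia.
  - destruct W as [Wx Wy], Sf as [Sx Sy]. rewrite !length_app in *. cbn [length bool_tail].
    rewrite <- app_assoc in C. rewrite Hp in C.
    eapply done_trans with (gi1 := u) (gr1 := nvars) (c2 := (costR y + 3)%Z);
      [ apply (compR_correct prog x s u nvars st u); eauto using code_at_app_l | lia | lia | | lia ].
    intros st1 E1 A1 V1. apply code_at_app_r in C; rewrite <- E1 in C.
    assert (Hrel1 : rel s st1) by (eapply rel_agree; [ | | exact Hrel | exact A1 ]; lia).
    eapply done_trans with (gi1 := u) (gr1 := S nvars) (c2 := 3%Z);
      [ apply (compR_correct prog y s u (S nvars) st1 u); eauto using code_at_app_l | lia | lia | | lia ].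
    intros st2 E2 A2 V2. apply code_at_app_r in C; rewrite <- E2 in C.
    assert (K : rmem st2 (rr nvars) = evalR x s) by (rewrite (proj1 (proj2 A2)) by lia; exact V1).
    replace (p + _)%nat with (pc st2 + 4)%nat by (cbn; lia).
    replace (pc st + _)%nat with (pc st2) in C by lia.
    eapply done_trans with (c2 := 0%Z);
      [ eapply bool_tail_correct; [ | exact C | reflexivity | reflexivity | reflexivity ] | | | | ];
      [ apply le_n | apply le_n | apply le_n | | lia ].
    intros st3 E3 A3 V3. apply done_now; [ auto | lia | ].
    rewrite V3, K, V2. unfold is_truth. destruct (Rlt_dec (evalR x s) (evalR y s)); tauto.
  - destruct W as [Wa Wb], Sf as [Sa Sb]. rewrite !length_app in *. cbn [length].
    eapply done_trans with (gi1 := u) (gr1 := nvars) (c2 := (costB b + 2)%Z);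
      [ apply (IHa u st p); eauto using code_at_app_l | lia | lia | | lia ].
    intros st1 E1 A1 V1. apply code_at_app_r in C.
    assert (Hrel1 : rel s st1) by (eapply rel_agree; [ | | exact Hrel | exact A1 ]; lia).
    eapply done_trans with (gi1 := S u) (gr1 := nvars) (c2 := 2%Z);
      [ apply (IHb (S u) st1 (p + length (compB a u p))%nat); eauto using code_at_app_l | lia | lia | | lia ].
    intros st2 E2 A2 V2. apply code_at_app_r in C; rewrite <- E2 in C.
    assert (K : imem st2 (ir u) = imem st1 (ir u)) by (rewrite (proj1 A2) by lia; auto).
    (* The conjunction of two values 0 or 1 is half their sum, rounded down. *)
    astep C. astep C. finish. rewrite K.
    destruct V1 as [[? ->] | [? ->]], V2 as [[? ->] | [? ->]]; cbv; tauto.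
  - rewrite !length_app in *. cbn [length].
    eapply done_trans with (gi1 := u) (gr1 := nvars) (c2 := 2%Z);
      [ apply (IHa u st p); eauto using code_at_app_l | lia | lia | | lia ].
    intros st1 E1 A1 V1. apply code_at_app_r in C. rewrite <- E1 in C.
    astep C. astep C. finish.
    destruct V1 as [[? ->] | [? ->]]; cbv; tauto.
Qed.

Definition runs_to (prog : program) (st : state) (p : nat) (s' : store) (c : Z) : Prop :=
  exists k st', reach prog k st st' /\ pc st' = p /\ (Z.of_nat k <= c)%Z /\ rel s' st'.

Lemma runs_of_done prog st st1 p k s' c1 c :
  reach prog k st st1 -> (Z.of_nat k <= c1)%Z ->
  runs_to prog st1 p s' (c - c1) -> runs_to prog st p s' c.
Proof.
  intros R1 C1 (k2 & st2 & R2 & E2 & C2 & Q2).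
  exists (k + k2)%nat, st2. split; [ | split; [ | split ] ]; auto.
  - eapply reach_trans; eauto.
  - lia.
Qed.

Lemma runs_step prog st i l p s' c :
  code_at prog (pc st) (i :: l) -> deterministic i = true ->
  (code_at prog (S (pc st)) l ->
   runs_to prog (step (fun _ => false) i st) p s' (c - 1)) ->
  runs_to prog st p s' c.
Proof.
  intros H Hi K. destruct (code_at_cons _ _ _ _ H) as [N C].
  apply (runs_of_done prog st _ p 1 s' 1 c (reach_step _ _ _ N Hi)); [lia | auto].
Qed.

Lemma runs_now prog st p s' c :
  pc st = p -> (0 <= c)%Z -> rel s' st -> runs_to prog st p s' c.
Proof. intros. exists 0%nat, st. auto using reach_refl. Qed.

Lemma branch_correct prog b s p q st s' e c :
  wfB b -> safeB b s -> rel s st -> pc st = p ->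
  code_at prog p (compB b nvars p ++ branch nvars q) ->
  (forall st', rel s st' ->
     (holds b s -> pc st' = (p + length (compB b nvars p) + 2)%nat) ->
     (~ holds b s -> pc st' = q) ->
     runs_to prog st' e s' (c - (costB b + 2))) ->
  runs_to prog st e s' c.
Proof.
  intros W Sf Hr Hp C K.
  destruct (compB_correct prog b s nvars st p W Sf (le_n _) Hr (eq_sym Hp)
              (code_at_app_l _ _ _ _ C)) as (k & st1 & R1 & E1 & A1 & C1 & V1).
  apply code_at_app_r in C. rewrite <- E1 in C. unfold branch in C.
  assert (Hr1 : rel s st1) by (eapply rel_agree; [ | | exact Hr | exact A1 ]; lia).
  apply (runs_of_done prog st st1 e k s' (costB b) c R1 C1).
  eapply runs_step; [ exact C | reflexivity | clear C; intros C ].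
  eapply runs_step; [ exact C | reflexivity | clear C; intros _ ].
  replace (c - costB b - 1 - 1)%Z with (c - (costB b + 2))%Z by lia.
  assert (A2 : agree nvars nvars st1
     (step (fun _ => false) (JEqI (ir nvars) (ir (S nvars)) q)
        (step (fun _ => false) (IConst (ir (S nvars)) 0) st1))) by agree_tac.
  apply K.
  - eapply rel_agree; [ | | exact Hr1 | exact A2 ]; lia.
  - intros Hb. destruct V1 as [[_ V] | [N _]]; [ | tauto ].
    mred. cells. rewrite V. cbn [Z.eqb]. lia.
  - intros Hb. destruct V1 as [[N _] | [_ V]]; [ tauto | ].
    mred. cells. rewrite V. reflexivity.
Qed.

Lemma updZ_rel s st v z :
  (v < nvars)%nat -> rel s st ->
  rel (assignI s v z) (mkState (S (pc st)) (updZ (imem st) (ir v) z) (rmem st) (ncoins st)).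
Proof.
  intros Hv (R1 & R2 & R3). repeat split; cbn [imem rmem assignI iv rv tm]; auto.
  intros w Hw. unfold upd, updZ, ir.
  destruct (Nat.eqb_spec w v), (Z.eqb_spec (Z.of_nat w) (Z.of_nat v)); auto; lia.
Qed.

Lemma updR_rel s st v x :
  (v < nvars)%nat -> rel s st ->
  rel (assignR s v x) (mkState (S (pc st)) (imem st) (updR (rmem st) (rr v) x) (ncoins st)).
Proof.
  intros Hv (R1 & R2 & R3). repeat split; cbn [imem rmem assignR iv rv tm]; auto.
  - intros w Hw. unfold upd, updR, rr.
    destruct (Nat.eqb_spec w v), (Z.eqb_spec (-1 - Z.of_nat w) (-1 - Z.of_nat v));
      first [ reflexivity | lia | apply (R2 w Hw) ].
  - intros k j Hk Hj. rewrite updR_other by (unfold rr; lia). auto.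
Qed.

Ltac eqb_cases :=
  repeat match goal with |- context [Z.eqb ?x ?y] => destruct (Z.eqb_spec x y); try lia end.

(** The induction is on the evaluation, not on the command: after one round of a loop, the second
    hypothesis speaks of the same loop entered again at [p]. *)
Lemma compC_correct prog c s t s' : ev c s t s' -> forall p st,
  wfC c -> rel s st -> pc st = p -> code_at prog p (compC c p) ->
  runs_to prog st (p + length (compC c p)) s' t.
Proof.
  induction 1 as [ s | v a s | v e s Hs | a e1 e2 e3 s S1 S2 S3 Ha
    | c1 c2 s1 s2 s3 t1 t2 E1 IH1 E2 IH2
    | b c1 c2 s s' t Sb Hb E1 IH1 | b c1 c2 s s' t Sb Hb E1 IH1
    | b c s Sb Hb | b c s1 s2 s3 t1 t2 Sb Hb E1 IH1 E2 IH2 ];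
    intros p st W Hr Hp C; cbn [compC wfC] in *.
  - apply runs_now; [ cbn; lia | lia | auto ].
  - destruct W as [Wv Wa]. rewrite length_app. cbn [length]. subst p.
    destruct (compA_correct prog a s nvars st nvars Wa (le_n _) (le_n _) Hr
                (code_at_app_l _ _ _ _ C)) as (k & st1 & R1 & E1 & A1 & C1 & V1).
    apply code_at_app_r in C. rewrite <- E1 in C.
    assert (Hr1 : rel s st1) by (eapply rel_agree; [ | | exact Hr | exact A1 ]; lia).
    apply (runs_of_done _ _ st1 _ k _ (costA a) _ R1 C1).
    assert (A2 : agree nvars nvars st1 (step (fun _ => false) (IConst (ir (S nvars)) 0) st1))
      by agree_tac.
    eapply runs_step; [ exact C | reflexivity | clear C; intros C ].
    eapply runs_step; [ exact C | reflexivity | clear C; intros _ ].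
    apply runs_now; [ mred; lia | lia | ].
    replace (evalA a s) with
      (imem (step (fun _ => false) (IConst (ir (S nvars)) 0) st1) (ir nvars) +
       imem (step (fun _ => false) (IConst (ir (S nvars)) 0) st1) (ir (S nvars)))%Z
      by (mred; cells; lia).
    apply updZ_rel; [ auto | ]. eapply rel_agree; [ | | exact Hr1 | exact A2 ]; lia.
  - destruct W as [Wv Wa]. rewrite length_app. cbn [length]. subst p.
    destruct (compR_correct prog e s nvars nvars st nvars Wa Hs (le_n _) (le_n _)
                (conj (le_n _) (le_n _)) Hr (code_at_app_l _ _ _ _ C))
      as (k & st1 & R1 & E1 & A1 & C1 & V1).
    apply code_at_app_r in C. rewrite <- E1 in C.
    assert (Hr1 : rel s st1) by (eapply rel_agree; [ | | exact Hr | exact A1 ]; lia).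
    apply (runs_of_done _ _ st1 _ k _ (costR e) _ R1 C1).
    set (st2 := step (fun _ => false) (RSub (rr (S nvars)) (rr nvars) (rr nvars)) st1) in *.
    assert (A2 : agree nvars nvars st1 st2) by (unfold st2; agree_tac).
    eapply runs_step; [ exact C | reflexivity | clear C; intros C ].
    eapply runs_step; [ exact C | reflexivity | clear C; intros _ ].
    fold st2. apply runs_now; [ unfold st2; mred; lia | lia | ].
    replace (evalR e s) with (rmem st2 (rr nvars) + rmem st2 (rr (S nvars)))
      by (unfold st2; mred; cells; rewrite V1; ring).
    apply updR_rel; [ auto | ]. eapply rel_agree; [ | | exact Hr1 | exact A2 ]; lia.
  - destruct W as (Wa & W1 & W2 & W3). rewrite !length_app. cbn [length]. subst p.
    destruct (compR_correct prog e1 s nvars nvars st nvars W1 S1 (le_n _) (le_n _)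
                (conj (le_n _) (le_n _)) Hr (code_at_app_l _ _ _ _ C))
      as (k1 & st1 & R1 & E1 & A1 & C1 & V1).
    apply code_at_app_r in C. rewrite <- E1 in C.
    assert (Hr1 : rel s st1) by (eapply rel_agree; [ | | exact Hr | exact A1 ]; lia).
    apply (runs_of_done _ _ st1 _ k1 _ (costR e1) _ R1 C1).
    destruct (compR_correct prog e2 s nvars (S nvars) st1 nvars W2 S2 (le_n _) (le_S _ _ (le_n _))
                (conj (le_n _) (le_n _)) Hr1 (code_at_app_l _ _ _ _ C))
      as (k2 & st2 & R2 & E2 & A2 & C2 & V2).
    apply code_at_app_r in C. rewrite <- E2 in C.
    assert (Hr2 : rel s st2) by (eapply rel_agree; [ | | exact Hr1 | exact A2 ]; lia).
    apply (runs_of_done _ _ st2 _ k2 _ (costR e2) _ R2 C2).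
    destruct (compR_correct prog e3 s nvars (S (S nvars)) st2 nvars W3 S3 (le_n _) (le_S _ _ (le_S _ _ (le_n _)))
                (conj (le_n _) (le_n _)) Hr2 (code_at_app_l _ _ _ _ C))
      as (k3 & st3 & R3 & E3 & A3 & C3 & V3).
    apply code_at_app_r in C. rewrite <- E3 in C.
    assert (Hr3 : rel s st3) by (eapply rel_agree; [ | | exact Hr2 | exact A3 ]; lia).
    apply (runs_of_done _ _ st3 _ k3 _ (costR e3) _ R3 C3).
    destruct (compA_correct prog a s nvars st3 (S (S (S nvars))) Wa (le_n _) (le_S _ _ (le_S _ _ (le_S _ _ (le_n _)))) Hr3
                (code_at_app_l _ _ _ _ C)) as (k4 & st4 & R4 & E4 & A4 & C4 & V4).
    apply code_at_app_r in C. rewrite <- E4 in C.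
    assert (Hr4 : rel s st4) by (eapply rel_agree; [ | | exact Hr3 | exact A4 ]; lia).
    apply (runs_of_done _ _ st4 _ k4 _ (costA a) _ R4 C4).
    assert (D1 : rmem st4 (rr nvars) = evalR e1 s).
    { rewrite (proj1 (proj2 A4)), (proj1 (proj2 A3)), (proj1 (proj2 A2)) by lia. auto. }
    assert (D2 : rmem st4 (rr (S nvars)) = evalR e2 s).
    { rewrite (proj1 (proj2 A4)), (proj1 (proj2 A3)) by lia. auto. }
    assert (D3 : rmem st4 (rr (S (S nvars))) = evalR e3 s).
    { rewrite (proj1 (proj2 A4)) by lia. auto. }
    do 8 (eapply runs_step; [ exact C | reflexivity | clear C; intros C ]).
    apply runs_now; [ mred; lia | lia | ].
    destruct Hr4 as (Q1 & Q2 & Q3).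
    repeat split; mred; intros.
    + cells. rewrite Q1; auto.
    + cells. rewrite Q2; auto.
    + cells. rewrite V4.
      set (m := evalA a s) in *.
      repeat rewrite (updR_other _ _ _ (rr (S (S nvars)))) by (unfold rr; lia).
      repeat rewrite (updR_other _ _ _ (rr (S nvars))) by (unfold rr; lia).
      rewrite D1, D2, D3.
      cbn [putT tm]. unfold updT. unfold updR at 1 2 3.
      destruct (Z.eqb_spec k m) as [-> | Hk].
      * destruct j as [|[|[|j]]]; [ | | | lia ];
          eqb_cases; reflexivity.
      * rewrite <- Q3 by auto. eqb_cases; reflexivity.
  - destruct W as [W1 W2]. rewrite length_app.
    destruct (IH1 p st W1 Hr Hp (code_at_app_l _ _ _ _ C)) as (k & st1 & R1 & P1 & C1 & Q1).
    apply (runs_of_done _ _ st1 _ k _ t1 _ R1 C1).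
    replace (t1 + t2 - t1)%Z with t2 by lia.
    rewrite Nat.add_assoc. apply IH2; auto. apply code_at_app_r in C. exact C.
  - destruct W as (Wb & W1 & W2).
    set (lb := compB b nvars p) in *.
    set (q := (p + length lb + 2)%nat) in *.
    set (l1 := compC c1 q) in *.
    set (l2 := compC c2 (q + length l1 + 1)) in *.
    rewrite app_assoc in C.
    eapply branch_correct; [ exact Wb | exact Sb | exact Hr | exact Hp
      | exact (code_at_app_l _ _ _ _ C) | ].
    intros st1 Hr1 P1 _. specialize (P1 Hb). fold lb in P1. fold q in P1.
    apply code_at_app_r in C. rewrite length_app in C. cbn [branch length] in C.
    rewrite Nat.add_assoc in C. fold q in C.
    destruct (IH1 q st1 W1 Hr1 P1 (code_at_app_l _ _ _ _ C)) as (k & st2 & R2 & P2 & C2 & Q2).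
    apply (runs_of_done _ _ st2 _ k _ t _ R2 C2).
    apply code_at_app_r in C. fold l1 in P2. rewrite <- P2 in C.
    eapply runs_step; [ exact C | reflexivity | intros _ ].
    apply runs_now; [ mred; rewrite !length_app; cbn [branch length]; unfold q; lia | lia | ].
    exact Q2.
  - destruct W as (Wb & W1 & W2).
    set (lb := compB b nvars p) in *.
    set (q := (p + length lb + 2)%nat) in *.
    set (l1 := compC c1 q) in *.
    set (l2 := compC c2 (q + length l1 + 1)) in *.
    rewrite app_assoc in C.
    eapply branch_correct; [ exact Wb | exact Sb | exact Hr | exact Hp
      | exact (code_at_app_l _ _ _ _ C) | ].
    intros st1 Hr1 _ P1. specialize (P1 Hb).
    apply code_at_app_r in C. rewrite length_app in C. cbn [branch length] in C.
    rewrite Nat.add_assoc in C. fold q in C.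
    apply code_at_app_r in C. fold l1 in C.
    apply (code_at_app_r _ _ [_]) in C. cbn [length] in C.
    destruct (IH1 _ st1 W2 Hr1 P1 C) as (k & st2 & R2 & P2 & C2 & Q2).
    apply (runs_of_done _ _ st2 _ k _ t _ R2 C2).
    apply runs_now; [ rewrite P2, !length_app; cbn [branch length]; fold l2; unfold q; lia
      | lia | exact Q2 ].
  - destruct W as [Wb W1].
    rewrite app_assoc in C.
    eapply branch_correct; [ exact Wb | exact Sb | exact Hr | exact Hp
      | exact (code_at_app_l _ _ _ _ C) | ].
    intros st1 Hr1 _ P1. specialize (P1 Hb).
    apply runs_now; [ rewrite P1, !length_app; cbn [branch length]; lia | lia | exact Hr1 ].
  - destruct W as [Wb W1].
    (* The whole code is kept, since the remaining rounds start from its first instruction. *)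
    pose proof C as C0.
    set (lb := compB b nvars p) in *.
    set (q := (p + length lb + 2)%nat) in *.
    set (l := compC c q) in *.
    rewrite app_assoc in C.
    eapply branch_correct; [ exact Wb | exact Sb | exact Hr | exact Hp
      | exact (code_at_app_l _ _ _ _ C) | ].
    intros st1 Hr1 P1 _. specialize (P1 Hb). fold lb in P1. fold q in P1.
    apply code_at_app_r in C. rewrite length_app in C. cbn [branch length] in C.
    rewrite Nat.add_assoc in C. fold q in C.
    destruct (IH1 q st1 W1 Hr1 P1 (code_at_app_l _ _ _ _ C)) as (k & st2 & R2 & P2 & C2 & Q2).
    apply (runs_of_done _ _ st2 _ k _ t1 _ R2 C2).
    apply code_at_app_r in C. fold l in P2. rewrite <- P2 in C.
    eapply runs_step; [ exact C | reflexivity | intros _ ].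
    replace (costB b + 3 + t1 + t2 - (costB b + 2) - t1 - 1)%Z with t2 by lia.
    apply IH2; [ cbn [wfC]; auto | exact Q2 | reflexivity | exact C0 ].
Qed.

(** Registers and triples are laid out so that the input encoding already represents a store: no
    prologue has to be run. *)
Definition init_store (M : market) : store :=
  mkStore (upd (fun _ => 0%Z) 0 (Z.of_nat (length M))) (fun _ => 0)
    (fun k => cust M (Z.to_nat k)).

Lemma rel_init M : rel (init_store M) (init_state M).
Proof.
  repeat split; cbn [init_store init_state iv rv tm imem rmem]; intros.
  - unfold upd, ir. destruct (Nat.eqb_spec v 0), (Z.eqb_spec (Z.of_nat v) 0); auto; lia.
  - unfold rr. destruct (Z.leb_spec 0 (-1 - Z.of_nat v)); auto; lia.
  - destruct (Z.leb_spec 0 (3 * k + Z.of_nat j)); [ | lia ].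
    replace (Z.to_nat (3 * k + Z.of_nat j)) with (j + Z.to_nat k * 3)%nat by lia.
    rewrite Nat.div_add, Nat.Div0.mod_add, Nat.div_small, Nat.mod_small by lia.
    reflexivity.
Qed.

(** Compiled code stops by running past its end, which [exec] accepts as halting, so surplus fuel is
    harmless. The output cells form triple 0. *)
Lemma run_compiled c M t s' L :
  wfC c -> ev c (init_store M) t s' -> (t <= Z.of_nat L)%Z ->
  forall coins, run (compC c 0) M coins L = Some (tm s' 0%Z).
Proof.
  intros W E HL coins.
  destruct (compC_correct (compC c 0) c _ _ _ E 0 (init_state M) W (rel_init M) eq_refl)
    as (k & st & R1 & P1 & C1 & Q1).
  { exists [], []. rewrite app_nil_r. auto. }
  unfold run. replace L with (k + (L - k))%nat by lia. rewrite R1.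
  assert (N : nth_error (compC c 0) (pc st) = None) by (apply nth_error_None; lia).
  replace (exec (compC c 0) coins (L - k) st) with (Some st)
    by (destruct (L - k)%nat; cbn [exec]; rewrite N; reflexivity).
  cbn [option_map]. unfold output. f_equal. destruct Q1 as (_ & _ & Q3).
  pose proof (Q3 0%Z 0%nat (Z.le_refl _) ltac:(lia)) as X0.
  pose proof (Q3 0%Z 1%nat (Z.le_refl _) ltac:(lia)) as X1.
  pose proof (Q3 0%Z 2%nat (Z.le_refl _) ltac:(lia)) as X2.
  cbn in X0, X1, X2. rewrite X0, X1, X2.
  destruct (tm s' 0%Z) as [[x y] z]. reflexivity.
Qed.

(** * Total correctness with running times *)

(** Asserting that an evaluation exists makes this total correctness; the postcondition also
    receives the cost. *)
Definition wp (c : cmd) (Q : Z -> store -> Prop) (s : store) : Prop :=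
  exists t s', ev c s t s' /\ Q t s'.

Lemma wp_mono c (Q Q' : Z -> store -> Prop) s :
  wp c Q s -> (forall t s', Q t s' -> Q' t s') -> wp c Q' s.
Proof. intros (t & s' & E & H) K. exists t, s'. auto. Qed.

Lemma wp_skip (Q : Z -> store -> Prop) s : Q 0%Z s -> wp CSkip Q s.
Proof. intros H. exists 0%Z, s. split; [constructor | auto]. Qed.

Lemma wp_seti v a (Q : Z -> store -> Prop) s :
  Q (costA a + 2)%Z (assignI s v (evalA a s)) -> wp (CSetI v a) Q s.
Proof. intros H. eexists _, _. split; [constructor | exact H]. Qed.

Lemma wp_setr v e (Q : Z -> store -> Prop) s :
  safeR e s -> Q (costR e + 2)%Z (assignR s v (evalR e s)) -> wp (CSetR v e) Q s.
Proof. intros ? H. eexists _, _. split; [constructor; auto | exact H]. Qed.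

Lemma wp_put a e1 e2 e3 (Q : Z -> store -> Prop) s :
  (safeR e1 s /\ safeR e2 s /\ safeR e3 s /\ (0 <= evalA a s)%Z) ->
  Q (costR e1 + costR e2 + costR e3 + costA a + 8)%Z
    (putT s (evalA a s) (evalR e1 s, evalR e2 s, evalR e3 s)) ->
  wp (CPut a e1 e2 e3) Q s.
Proof. intros (S1 & S2 & S3 & S4) H. eexists _, _. split; [constructor; auto | exact H]. Qed.

Lemma wp_seq c1 c2 (Q : Z -> store -> Prop) s :
  wp c1 (fun t1 s1 => wp c2 (fun t2 s2 => Q (t1 + t2)%Z s2) s1) s -> wp (CSeq c1 c2) Q s.
Proof.
  intros (t1 & s1 & E1 & t2 & s2 & E2 & H). eexists _, _. split; [econstructor; eauto | exact H].
Qed.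

Lemma wp_if b c1 c2 (Q : Z -> store -> Prop) s :
  safeB b s ->
  (holds b s -> wp c1 (fun t s' => Q (costB b + 3 + t)%Z s') s) ->
  (~ holds b s -> wp c2 (fun t s' => Q (costB b + 3 + t)%Z s') s) ->
  wp (CIf b c1 c2) Q s.
Proof.
  intros S H1 H2. destruct (holds_dec b s) as [D | D].
  - destruct (H1 D) as (t & s' & E & H). eexists _, _. split; [apply ev_if_true; eauto | exact H].
  - destruct (H2 D) as (t & s' & E & H). eexists _, _. split; [apply ev_if_false; eauto | exact H].
Qed.

Fixpoint imods (c : cmd) : list nat :=
  match c with
  | CSetI v _ => [v]
  | CSeq c1 c2 | CIf _ c1 c2 => imods c1 ++ imods c2
  | CWhile _ c => imods c
  | _ => []
  end.

Fixpoint rmods (c : cmd) : list nat :=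
  match c with
  | CSetR v _ => [v]
  | CSeq c1 c2 | CIf _ c1 c2 => rmods c1 ++ rmods c2
  | CWhile _ c => rmods c
  | _ => []
  end.

(** Boolean, so that the tactic [frame] settles it by computation with [eq_refl]. *)
Definition fresh (v : nat) (l : list nat) : bool := negb (existsb (Nat.eqb v) l).

Definition framed (c : cmd) (s s' : store) : Prop :=
  (forall v, fresh v (imods c) = true -> iv s' v = iv s v) /\
  (forall v, fresh v (rmods c) = true -> rv s' v = rv s v).

Lemma fresh_app v l1 l2 : fresh v (l1 ++ l2) = true <-> fresh v l1 = true /\ fresh v l2 = true.
Proof.
  unfold fresh. rewrite existsb_app, Bool.negb_orb, Bool.andb_true_iff. reflexivity.
Qed.

Lemma fresh_one v w : fresh v [w] = true -> v <> w.
Proof.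
  unfold fresh. cbn. rewrite Bool.orb_false_r. intros H ->. rewrite Nat.eqb_refl in H.
  discriminate.
Qed.

Lemma upd_other {A} (f : nat -> A) v x w : w <> v -> upd f v x w = f w.
Proof. intros H. unfold upd. destruct (Nat.eqb_spec w v); congruence. Qed.

Lemma framed_refl c s : framed c s s.
Proof. split; auto. Qed.

Lemma framed_trans c s1 s2 s3 : framed c s1 s2 -> framed c s2 s3 -> framed c s1 s3.
Proof. intros [A1 A2] [B1 B2]. split; intros; [rewrite B1 | rewrite B2]; auto. Qed.

Lemma ev_framed c s t s' : ev c s t s' -> framed c s s'.
Proof.
  induction 1 as [ s | v a s | v e s _ | a e1 e2 e3 s _ _ _ _
    | c1 c2 s1 s2 s3 t1 t2 _ [A1 B1] _ [A2 B2] | b c1 c2 s s' t _ _ _ [A1 B1]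
    | b c1 c2 s s' t _ _ _ [A1 B1] | b c s _ _ | b c s1 s2 s3 t1 t2 _ _ _ [A1 B1] _ [A2 B2] ];
    split; cbn [imods rmods assignI assignR putT iv rv] in *; auto;
    intros w F; try (apply fresh_app in F as [F1 F2]);
    try (apply upd_other, fresh_one, F);
    try rewrite A2 by auto; try rewrite B2 by auto; auto.
Qed.

Lemma wp_frame c (Q : Z -> store -> Prop) s :
  wp c Q s -> wp c (fun t s' => framed c s s' /\ Q t s') s.
Proof. intros (t & s' & E & H). exists t, s'. split; [ | split ]; eauto using ev_framed. Qed.

Lemma wp_call c (Q Q' : Z -> store -> Prop) s :
  wp c Q s -> (forall t s', framed c s s' -> Q t s' -> Q' t s') -> wp c Q' s.
Proof. intros H K. eapply wp_mono; [ apply wp_frame, H | ]. intros t s' [? ?]. auto. Qed.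

Lemma costA_pos a : (0 <= costA a)%Z.
Proof. induction a; cbn; lia. Qed.

Lemma costR_pos e : (0 <= costR e)%Z.
Proof. induction e; cbn; try pose proof (costA_pos a); lia. Qed.

Lemma costB_pos b : (0 <= costB b)%Z.
Proof.
  induction b; cbn; try pose proof (costA_pos a); try pose proof (costA_pos b);
    try pose proof (costR_pos a); try pose proof (costR_pos b); lia.
Qed.

Lemma cost_nonneg c s t s' : ev c s t s' -> (0 <= t)%Z.
Proof.
  induction 1; try pose proof (costB_pos b); try pose proof (costR_pos e);
    try pose proof (costA_pos a);
    try (pose proof (costR_pos e1); pose proof (costR_pos e2); pose proof (costR_pos e3)); lia.
Qed.

(** Each round is paid for by a drop of the potential [phi], which therefore bounds the time. It
    also gives termination: a round costs at least 3, so a nonnegative [phi] can fall only finitely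
    often. Real values are allowed because later potentials contain quotients and logarithms. *)
Lemma wp_while (Inv : store -> Prop) (phi : store -> R) b c (Q : Z -> store -> Prop) s0 :
  Inv s0 ->
  (forall s, Inv s -> framed c s0 s -> safeB b s /\ 0 <= phi s) ->
  (forall s, Inv s -> framed c s0 s -> holds b s ->
     wp c (fun t s' => Inv s' /\ IZR (t + costB b + 3) <= phi s - phi s') s) ->
  (forall t s, Inv s -> framed c s0 s -> ~ holds b s ->
     IZR t + phi s <= phi s0 + IZR (costB b + 2) -> Q t s) ->
  wp (CWhile b c) Q s0.
Proof.
  intros I0 Hs Hb HQ.
  assert (K : forall k s, Inv s -> framed c s0 s -> phi s <= INR k ->
    wp (CWhile b c) (fun t s' => Inv s' /\ framed c s0 s' /\ ~ holds b s' /\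
       IZR t + phi s' <= phi s + IZR (costB b + 2)) s).
  { induction k as [|k IH]; intros s I F Hk; destruct (Hs s I F) as [Sb P];
      destruct (holds_dec b s) as [D | D].
    2, 4: eexists _, s; split; [ apply ev_while_false; auto | ];
      split; [ | split; [ | split ] ]; auto; lra.
    all: destruct (Hb s I F D) as (t1 & s1 & E1 & I1 & T1);
      pose proof (ev_framed _ _ _ _ E1) as F1;
      pose proof (framed_trans _ _ _ _ F F1) as F2;
      destruct (Hs s1 I1 F2) as [_ P1];
      pose proof (IZR_le _ _ (cost_nonneg _ _ _ _ E1)); pose proof (IZR_le _ _ (costB_pos b));
      rewrite !plus_IZR in T1.
    - cbn in Hk. lra.
    - rewrite S_INR in Hk.
      destruct (IH s1 I1 F2) as (t2 & s2 & E2 & I2 & F3 & D2 & T2); [ lra | ].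
      exists (costB b + 3 + t1 + t2)%Z, s2. split; [ eapply ev_while_true; eauto | ].
      split; [ | split; [ | split ] ]; auto. rewrite !plus_IZR in *. lra. }
  destruct (INR_unbounded (phi s0)) as [k Hk].
  destruct (K k s0 I0 (framed_refl _ _)) as (t & s' & E & I & F & D & T); [ lra | ].
  exists t, s'. auto.
Qed.

Lemma wp_while_Z (Inv : store -> Prop) (phi : store -> Z) b c (Q : Z -> store -> Prop) s0 :
  Inv s0 ->
  (forall s, Inv s -> framed c s0 s -> safeB b s /\ (0 <= phi s)%Z) ->
  (forall s, Inv s -> framed c s0 s -> holds b s ->
     wp c (fun t s' => Inv s' /\ (t + costB b + 3 <= phi s - phi s')%Z) s) ->
  (forall t s, Inv s -> framed c s0 s -> ~ holds b s ->
     (t + phi s <= phi s0 + (costB b + 2))%Z -> Q t s) ->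
  wp (CWhile b c) Q s0.
Proof.
  intros I0 Hs Hb HQ. apply (wp_while Inv (fun s => IZR (phi s))); auto.
  - intros s I F. destruct (Hs s I F). split; auto. now apply IZR_le.
  - intros s I F D. apply (wp_mono _ _ _ _ (Hb s I F D)). intros t s' [I' T]. split; auto.
    rewrite <- minus_IZR. now apply IZR_le.
  - intros t s I F D T. apply HQ; auto. apply le_IZR. now rewrite plus_IZR, plus_IZR with (n := phi s0).
Qed.

(** * Segments of the triple memory *)

Definition rd (m : Z -> point) (b k : Z) : list point :=
  map (fun j => m (b + Z.of_nat j)%Z) (List.seq 0 (Z.to_nat k)).

Lemma rd_length m b k : (0 <= k)%Z -> Z.of_nat (length (rd m b k)) = k.
Proof. intros H. unfold rd. rewrite length_map, length_seq. lia. Qed.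

Lemma rd_nil m b k : (k <= 0)%Z -> rd m b k = [].
Proof. intros H. unfold rd. replace (Z.to_nat k) with 0%nat by lia. reflexivity. Qed.

Lemma rd_app m b j k :
  (0 <= j)%Z -> (0 <= k)%Z -> rd m b (j + k) = rd m b j ++ rd m (b + j) k.
Proof.
  intros Hj Hk. unfold rd. rewrite Z2Nat.inj_add, seq_app, map_app by lia. f_equal.
  rewrite Nat.add_0_l.
  generalize (Z.to_nat k). intros n. clear Hk k.
  replace (Z.to_nat j) with (0 + Z.to_nat j)%nat by lia.
  generalize 0%nat as a. induction n as [|n IH]; intros a; [reflexivity | ].
  cbn [List.seq map]. f_equal; [ f_equal; lia | ]. apply (IH (S a)).
Qed.

Lemma rd_one m b : rd m b 1 = [m b].
Proof. unfold rd. change (Z.to_nat 1) with 1%nat. cbn [List.seq map]. do 2 f_equal. lia. Qed.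

Lemma rd_snoc m b k : (0 <= k)%Z -> rd m b (k + 1) = rd m b k ++ [m (b + k)%Z].
Proof. intros H. now rewrite rd_app, rd_one by lia. Qed.

Lemma rd_cons m b k : (0 < k)%Z -> rd m b k = m b :: rd m (b + 1) (k - 1).
Proof.
  intros H. replace k with (1 + (k - 1))%Z at 1 by lia. now rewrite rd_app, rd_one by lia.
Qed.

Lemma rd_ext m m' b k :
  (forall i, (b <= i < b + k)%Z -> m i = m' i) -> rd m b k = rd m' b k.
Proof.
  intros H. unfold rd. apply map_ext_in. intros j Hj. apply in_seq in Hj. apply H. lia.
Qed.

Lemma rd_in m b k c : In c (rd m b k) <-> exists i, (0 <= i < k)%Z /\ c = m (b + i)%Z.
Proof.
  unfold rd. rewrite in_map_iff. split.
  - intros (j & <- & Hj). apply in_seq in Hj. exists (Z.of_nat j). split; [lia | reflexivity].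
  - intros (i & Hi & ->). exists (Z.to_nat i). rewrite in_seq. split; [ f_equal | ]; lia.
Qed.

Lemma rd_init M : rd (tm (init_store M)) 0 (Z.of_nat (length M)) = M.
Proof.
  cbn. unfold rd. rewrite Nat2Z.id.
  rewrite map_ext with (g := cust M) by (intros j; f_equal; lia).
  unfold cust.
  induction M as [|c M IH] using rev_ind; [reflexivity | ].
  rewrite length_app, seq_app, map_app. cbn [length List.seq map].
  rewrite app_nth2, Nat.sub_diag by lia. cbn [nth]. f_equal.
  rewrite <- IH at 2. apply map_ext_in. intros j Hj. apply in_seq in Hj.
  apply app_nth1. lia.
Qed.

Lemma updT_same m k c : updT m k c k = c.
Proof. unfold updT. now rewrite Z.eqb_refl. Qed.
Lemma updT_other m k c i : i <> k -> updT m k c i = m i.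
Proof. intros H. unfold updT. destruct (Z.eqb_spec i k); congruence. Qed.

Lemma rd_updT m k c b n :
  ~ (b <= k < b + n)%Z -> rd (updT m k c) b n = rd m b n.
Proof. intros H. apply rd_ext. intros i Hi. apply updT_other. lia. Qed.

Lemma rd_updT_snoc m b k c :
  (0 <= k)%Z -> rd (updT m (b + k) c) b (k + 1) = rd m b k ++ [c].
Proof. intros H. rewrite rd_snoc, updT_same, rd_updT by lia. reflexivity. Qed.

Lemma triple_eta (c : point) : (comp c 0, comp c 1, comp c 2) = c.
Proof. destruct c as [[x y] z]. reflexivity. Qed.

(** * Merge sort *)

Definition key_le (off : nat) (a b : point) : Prop := comp a off <= comp b off.

Fixpoint merge (off : nat) (l1 : list point) : list point -> list point :=
  match l1 with
  | [] => fun l2 => l2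
  | a :: l1' =>
      fix merge_aux (l2 : list point) : list point :=
        match l2 with
        | [] => l1
        | b :: l2' =>
            if Rlt_dec (comp b off) (comp a off) then b :: merge_aux l2'
            else a :: merge off l1' l2
        end
  end.

Lemma merge_nil_r off l : merge off l [] = l.
Proof. destruct l; reflexivity. Qed.

Lemma merge_take_r off a l1 b l2 :
  comp b off < comp a off ->
  merge off (a :: l1) (b :: l2) = b :: merge off (a :: l1) l2.
Proof. intros H. cbn. destruct (Rlt_dec (comp b off) (comp a off)); [reflexivity | lra]. Qed.

Lemma merge_take_l off a l1 b l2 :
  ~ comp b off < comp a off ->
  merge off (a :: l1) (b :: l2) = a :: merge off l1 (b :: l2).
Proof. intros H. cbn. destruct (Rlt_dec (comp b off) (comp a off)); [lra | reflexivity]. Qed.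

Lemma merge_perm off l1 : forall l2, Permutation (l1 ++ l2) (merge off l1 l2).
Proof.
  induction l1 as [|a l1 IH1]; intros l2; [reflexivity | ].
  induction l2 as [|b l2 IH2]; [ rewrite app_nil_r; reflexivity | ].
  destruct (Rlt_dec (comp b off) (comp a off)) as [H | H].
  - rewrite merge_take_r by auto. rewrite <- IH2. symmetry. apply (Permutation_middle (a :: l1)).
  - rewrite merge_take_l by auto. cbn. now rewrite IH1.
Qed.

Lemma merge_sorted off l1 : forall l2,
  StronglySorted (key_le off) l1 -> StronglySorted (key_le off) l2 ->
  StronglySorted (key_le off) (merge off l1 l2).
Proof.
  induction l1 as [|a l1 IH1]; intros l2 S1 S2; [exact S2 | ].
  induction l2 as [|b l2 IH2]; [exact S1 | ].
  inversion S1 as [|? ? S1' F1]; inversion S2 as [|? ? S2' F2]; subst.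
  destruct (Rlt_dec (comp b off) (comp a off)) as [H | H].
  - rewrite merge_take_r by auto. constructor; [auto | ].
    apply (Permutation_Forall (merge_perm off (a :: l1) l2)).
    apply Forall_app. split; auto. constructor; [ unfold key_le; lra | ].
    eapply Forall_impl; [ | exact F1 ]. unfold key_le. intros; lra.
  - rewrite merge_take_l by auto. constructor; [auto | ].
    apply (Permutation_Forall (merge_perm off l1 (b :: l2))).
    apply Forall_app. split; auto. constructor; [ unfold key_le; lra | ].
    eapply Forall_impl; [ | exact F2 ]. unfold key_le. intros; lra.
Qed.

(* Consecutive blocks of length [w], the last one possibly shorter, are sorted *)
Inductive blocks (off : nat) (w : Z) : list point -> Prop :=
| blocks_last l :
    (Z.of_nat (length l) <= w)%Z -> StronglySorted (key_le off) l -> blocks off w l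
| blocks_cons l l' :
    Z.of_nat (length l) = w -> StronglySorted (key_le off) l -> blocks off w l' ->
    blocks off w (l ++ l').

Lemma blocks_one off l : blocks off 1 l.
Proof.
  induction l as [|a l IH].
  - apply blocks_last; [cbn; lia | constructor].
  - apply (blocks_cons off 1 [a] l); auto. repeat constructor.
Qed.

Lemma blocks_sorted off w l :
  blocks off w l -> (0 < w)%Z -> (Z.of_nat (length l) <= w)%Z -> StronglySorted (key_le off) l.
Proof.
  intros [l1 H1 S1 | l1 l2 H1 S1 B] Hw H; auto. rewrite length_app in H.
  destruct l2; [ now rewrite app_nil_r | cbn in H; lia ].
Qed.

Lemma app_eq_len {A} (l1 l2 l3 l4 : list A) :
  l1 ++ l2 = l3 ++ l4 -> length l1 = length l3 -> l1 = l3 /\ l2 = l4.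
Proof.
  revert l3. induction l1 as [|a l1 IH]; intros [|b l3] E H; cbn in *; try discriminate; auto.
  injection E as -> E. destruct (IH l3 E) as [-> ->]; auto.
Qed.

Lemma blocks_split off w l1 l2 :
  (0 < w)%Z -> blocks off w (l1 ++ l2) -> Z.of_nat (length l1) = w ->
  StronglySorted (key_le off) l1 /\ blocks off w l2.
Proof.
  intros Hw B H. inversion B as [l H1 S1 E | l l' H1 S1 B' E].
  - rewrite length_app in H1. destruct l2; [ | cbn in H1; lia ].
    rewrite app_nil_r in S1. split; auto. apply blocks_last; [cbn; lia | constructor].
  - apply app_eq_len in E as [-> ->]; [auto | lia].
Qed.

(** * Merge sort as a program *)

Local Notation "c1 ;; c2" := (CSeq c1 c2) (at level 60, right associativity).
Local Notation "a +' b" := (AAdd a b) (at level 50, left associativity).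
Local Notation "$ v" := (AVar v) (at level 5).

Definition put_copy (d a : aexp) : cmd := CPut d (RGet 0 a) (RGet 1 a) (RGet 2 a).

Lemma wp_put_copy d a (Q : Z -> store -> Prop) s :
  (0 <= evalA a s)%Z -> (0 <= evalA d s)%Z ->
  Q (3 * costA a + costA d + 23)%Z (putT s (evalA d s) (tm s (evalA a s))) ->
  wp (put_copy d a) Q s.
Proof.
  intros Ha Hd H. apply wp_put; [ cbn [safeR]; auto | ].
  cbn [evalR costR]. rewrite triple_eta.
  replace (_ + _ + _ + _ + 8)%Z with (3 * costA a + costA d + 23)%Z by lia. exact H.
Qed.

Ltac simp :=
  cbn [assignI assignR putT iv rv tm upd Nat.eqb evalA evalR holds safeB safeR costA costR costB].
Ltac simp_in H :=
  cbn [assignI assignR putT iv rv tm upd Nat.eqb evalA evalR holds safeB safeR costA costR costB] in H.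

Ltac frame F :=
  match type of F with
  | framed _ _ ?s =>
      repeat match goal with
      | |- context [iv s ?v] => rewrite (proj1 F v eq_refl)
      | |- context [rv s ?v] => rewrite (proj2 F v eq_refl)
      | H : context [iv s ?v] |- _ => rewrite (proj1 F v eq_refl) in H
      | H : context [rv s ?v] |- _ => rewrite (proj2 F v eq_refl) in H
      end
  end.

Local Notation vN := 0%nat.
Local Notation vB := 1%nat.
Local Notation vK := 2%nat.
Local Notation vS := 3%nat.
Local Notation vW := 4%nat.
Local Notation vI := 5%nat.
Local Notation vM := 6%nat.
Local Notation vH := 7%nat.
Local Notation vL := 8%nat.
Local Notation vR := 9%nat.
Local Notation vO := 10%nat.

(** The comparison is evaluated even when one run is exhausted; it then reads a cell outside that
    run, which is safe, and the index tests make its result irrelevant. *)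
Definition merge_body (off : nat) : cmd :=
  CIf (BAnd (BLt $vL $vM)
        (BNot (BAnd (BLt $vR $vH)
                 (BRLt (RGet off ($vB +' $vR)) (RGet off ($vB +' $vL))))))
      (put_copy ($vS +' $vO) ($vB +' $vL) ;; CSetI vL ($vL +' ACst 1))
      (put_copy ($vS +' $vO) ($vB +' $vR) ;; CSetI vR ($vR +' ACst 1)) ;;
  CSetI vO ($vO +' ACst 1).

Definition merge_loop (off : nat) : cmd := CWhile (BLt $vO $vH) (merge_body off).

Lemma merge_loop_spec off s0 :
  (0 <= iv s0 vB)%Z -> (0 <= iv s0 vL <= iv s0 vM)%Z -> (iv s0 vM <= iv s0 vH)%Z ->
  iv s0 vR = iv s0 vM -> iv s0 vO = iv s0 vL ->
  (iv s0 vB + iv s0 vH <= iv s0 vS + iv s0 vL)%Z ->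
  wp (merge_loop off) (fun t s =>
    (t <= 150 * (iv s0 vH - iv s0 vL) + 10)%Z /\
    rd (tm s) (iv s0 vS + iv s0 vL) (iv s0 vH - iv s0 vL) =
      merge off (rd (tm s0) (iv s0 vB + iv s0 vL) (iv s0 vM - iv s0 vL))
        (rd (tm s0) (iv s0 vB + iv s0 vM) (iv s0 vH - iv s0 vM)) /\
    (forall k, ~ (iv s0 vS + iv s0 vL <= k < iv s0 vS + iv s0 vH)%Z -> tm s k = tm s0 k)) s0.
Proof.
  intros HB HL HM ER EO HS.
  set (target := merge off _ _).
  apply wp_while_Z with
    (Inv := fun s =>
       (iv s0 vL <= iv s vL <= iv s0 vM)%Z /\ (iv s0 vM <= iv s vR <= iv s0 vH)%Z /\
       (iv s vO + iv s0 vM = iv s vL + iv s vR)%Z /\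
       (* What has been written, followed by the merge of what is left, never changes. *)
       rd (tm s) (iv s0 vS + iv s0 vL) (iv s vO - iv s0 vL) ++
         merge off (rd (tm s0) (iv s0 vB + iv s vL) (iv s0 vM - iv s vL))
           (rd (tm s0) (iv s0 vB + iv s vR) (iv s0 vH - iv s vR)) = target /\
       (forall k, ~ (iv s0 vS + iv s0 vL <= k < iv s0 vS + iv s0 vH)%Z -> tm s k = tm s0 k))
    (phi := fun s => (150 * (iv s0 vH - iv s vO))%Z).
  - rewrite ER, EO. split; [lia | ]. split; [lia | ]. split; [lia | ]. split; [ | auto ].
    rewrite (rd_nil (tm s0) (iv s0 vS + iv s0 vL)) by lia. reflexivity.
  - intros s (I1 & I2 & I3 & I4 & I5) F. simp. split; [ auto | lia ].
  - intros s (I1 & I2 & I3 & I4 & I5) F D. simp_in D. frame F.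
    unfold merge_body. apply wp_seq, wp_if.
    + simp. frame F. repeat split; lia.
    + simp. frame F. intros [D1 D2].
      apply wp_seq, wp_put_copy; simp; frame F; [ lia | lia | ].
      apply wp_seti, wp_seti. simp. frame F.
      split; [ | lia ].
      rewrite (I5 (iv s0 vB + iv s vL)%Z) by lia.
      split; [lia | ]. split; [lia | ]. split; [lia | ]. split.
      * rewrite <- I4.
        replace (iv s0 vS + iv s vO)%Z with (iv s0 vS + iv s0 vL + (iv s vO - iv s0 vL))%Z by lia.
        replace (iv s vO + 1 - iv s0 vL)%Z with (iv s vO - iv s0 vL + 1)%Z by lia.
        rewrite rd_updT_snoc by lia. rewrite <- app_assoc. f_equal. cbn [app].
        rewrite (rd_cons (tm s0) (iv s0 vB + iv s vL)) by lia.
        rewrite Z.add_assoc. replace (iv s0 vM - (iv s vL + 1))%Z with (iv s0 vM - iv s vL - 1)%Z by lia.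
        destruct (Z_lt_dec (iv s vR) (iv s0 vH)) as [H | H].
        -- rewrite (rd_cons (tm s0) (iv s0 vB + iv s vR)) by lia.
           rewrite merge_take_l; [ reflexivity | ].
           intros H'. apply D2. split; [lia | ]. rewrite !I5 by lia. exact H'.
        -- rewrite (rd_nil (tm s0) (iv s0 vB + iv s vR)) by lia. now rewrite !merge_nil_r.
      * intros k Hk. rewrite updT_other by lia. auto.
    + simp. frame F. intros D1.
      apply wp_seq, wp_put_copy; simp; frame F; [ lia | lia | ].
      apply wp_seti, wp_seti. simp. frame F.
      assert (HR : (iv s vR < iv s0 vH)%Z).
      { destruct (Z_lt_dec (iv s vR) (iv s0 vH)) as [H | H]; [ auto | ].
        destruct D1. split; lia. }
      split; [ | lia ].
      rewrite (I5 (iv s0 vB + iv s vR)%Z) by lia.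
      split; [lia | ]. split; [lia | ]. split; [lia | ]. split.
      * rewrite <- I4.
        replace (iv s0 vS + iv s vO)%Z with (iv s0 vS + iv s0 vL + (iv s vO - iv s0 vL))%Z by lia.
        replace (iv s vO + 1 - iv s0 vL)%Z with (iv s vO - iv s0 vL + 1)%Z by lia.
        rewrite rd_updT_snoc by lia. rewrite <- app_assoc. f_equal. cbn [app].
        rewrite (rd_cons (tm s0) (iv s0 vB + iv s vR)) by lia.
        rewrite Z.add_assoc. replace (iv s0 vH - (iv s vR + 1))%Z with (iv s0 vH - iv s vR - 1)%Z by lia.
        destruct (Z_lt_dec (iv s vL) (iv s0 vM)) as [H | H].
        -- rewrite (rd_cons (tm s0) (iv s0 vB + iv s vL)) by lia.
           rewrite merge_take_r; [ reflexivity | ].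
           destruct (Rlt_dec (comp (tm s0 (iv s0 vB + iv s vR)) off)
                             (comp (tm s0 (iv s0 vB + iv s vL)) off)) as [H' | H']; [ auto | ].
           destruct D1. split; [ auto | ]. rewrite !I5 by lia. tauto.
        -- rewrite (rd_nil (tm s0) (iv s0 vB + iv s vL)) by lia. reflexivity.
      * intros k Hk. rewrite updT_other by lia. auto.
  - intros t s (I1 & I2 & I3 & I4 & I5) F D T. simp_in D. frame F. simp_in T.
    split; [ lia | ]. split; [ | exact I5 ].
    rewrite (rd_nil (tm s0) (iv s0 vB + iv s vL)), (rd_nil (tm s0) (iv s0 vB + iv s vR)) in I4 by lia.
    rewrite <- I4, app_nil_r. f_equal. lia.
Qed.

Definition copy_loop (d a : nat) : cmd :=
  CSetI vO (ACst 0) ;;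
  CWhile (BLt $vO $vK) (put_copy ($d +' $vO) ($a +' $vO) ;; CSetI vO ($vO +' ACst 1)).

(** The two directions are the copy back after a merge pass and the duplication of a column before
    it is sorted by price. *)
Lemma copy_loop_spec d a s0 :
  (d = vB /\ a = vS) \/ (d = vS /\ a = vB) ->
  (0 <= iv s0 vB)%Z -> (0 <= iv s0 vK)%Z -> (iv s0 vB + iv s0 vK <= iv s0 vS)%Z ->
  wp (copy_loop d a) (fun t s =>
    (t <= 100 * iv s0 vK + 20)%Z /\
    rd (tm s) (iv s0 d) (iv s0 vK) = rd (tm s0) (iv s0 a) (iv s0 vK) /\
    (forall k, ~ (iv s0 d <= k < iv s0 d + iv s0 vK)%Z -> tm s k = tm s0 k)) s0.
Proof.
  intros Hda HB HK HS. apply wp_seq, wp_seti.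
  apply wp_while_Z with
    (Inv := fun s => (0 <= iv s vO <= iv s0 vK)%Z /\
       rd (tm s) (iv s0 d) (iv s vO) = rd (tm s0) (iv s0 a) (iv s vO) /\
       (forall k, ~ (iv s0 d <= k < iv s0 d + iv s0 vK)%Z -> tm s k = tm s0 k))
    (phi := fun s => (100 * (iv s0 vK - iv s vO))%Z).
  - simp. split; [ lia | ]. split; [ now rewrite !rd_nil by lia | auto ].
  - intros s (I1 & I2 & I3) F. frame F. simp. split; [ auto | lia ].
  - intros s (I1 & I2 & I3) F D. simp_in D. frame F. simp_in D.
    destruct Hda as [[-> ->] | [-> ->]];
      apply wp_seq, wp_put_copy; simp; frame F; simp; [ lia | lia | | lia | lia | ];
      apply wp_seti; simp; frame F; simp;
      (split; [ | lia ]); (split; [ lia | ]); split;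
      [ rewrite rd_updT_snoc, rd_snoc by lia; rewrite I2, I3 by lia; reflexivity
      | intros k Hk; rewrite updT_other by lia; auto
      | rewrite rd_updT_snoc, rd_snoc by lia; rewrite I2, I3 by lia; reflexivity
      | intros k Hk; rewrite updT_other by lia; auto ].
  - intros t s (I1 & I2 & I3) F D T. simp_in D. simp_in T. frame F. simp_in D. simp.
    split; [ lia | ]. split; [ | exact I3 ].
    replace (iv s0 vK) with (iv s vO) by lia. exact I2.
Qed.

Definition merge_pass (off : nat) : cmd :=
  CSetI vI (ACst 0) ;;
  CWhile (BLt $vI $vK)
    (CIf (BLt $vK ($vI +' $vW)) (CSetI vM $vK) (CSetI vM ($vI +' $vW)) ;;
     CIf (BLt $vK ($vI +' ($vW +' $vW))) (CSetI vH $vK) (CSetI vH ($vI +' ($vW +' $vW))) ;;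
     CSetI vL $vI ;; CSetI vR $vM ;; CSetI vO $vI ;;
     merge_loop off ;;
     CSetI vI $vH).

(** The minima cover the end of the list, where the second block may be short or missing and the
    first may be short as well. *)
Lemma merge_blocks off w (m : Z -> point) b k j h :
  (0 < w)%Z -> (0 < k)%Z -> blocks off w (rd m b k) ->
  j = Z.min w k -> h = Z.min (w + w) k ->
  StronglySorted (key_le off) (merge off (rd m b j) (rd m (b + j) (h - j))) /\
  Permutation (rd m b h) (merge off (rd m b j) (rd m (b + j) (h - j))) /\
  blocks off w (rd m (b + h) (k - h)).
Proof.
  intros Hw Hk B Ej Eh.
  assert (P : Permutation (rd m b h) (merge off (rd m b j) (rd m (b + j) (h - j)))).
  { rewrite <- merge_perm. rewrite <- rd_app by lia.
    replace (j + (h - j))%Z with h by lia. reflexivity. }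
  destruct (Z_le_dec k w) as [H | H].
  - assert (j = k) as -> by lia. assert (h = k) as -> by lia. split; [ | split; [ exact P | ] ].
    + rewrite (rd_nil m (b + k)) by lia. rewrite merge_nil_r.
      apply blocks_sorted with w; [ exact B | lia | rewrite rd_length; lia ].
    + rewrite rd_nil by lia. apply blocks_last; [ cbn; lia | constructor ].
  - assert (j = w) as -> by lia.
    replace k with (w + (k - w))%Z in B by lia. rewrite rd_app in B by lia.
    apply blocks_split in B as [S1 B]; [ | lia | rewrite rd_length; lia ].
    destruct (Z_le_dec (k - w) w) as [H2 | H2].
    + assert (h = k) as -> by lia. split; [ | split; [ exact P | ] ].
      * apply merge_sorted; auto.
        apply blocks_sorted with w; [ exact B | lia | rewrite rd_length; lia ].
      * rewrite rd_nil by lia. apply blocks_last; [ cbn; lia | constructor ].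
    + assert (h = w + w)%Z as -> by lia.
      replace (k - w)%Z with (w + (k - (w + w)))%Z in B by lia. rewrite rd_app in B by lia.
      apply blocks_split in B as [S2 B]; [ | lia | rewrite rd_length; lia ].
      split; [ | split; [ exact P | ] ].
      * apply merge_sorted; auto. replace (w + w - w)%Z with w by lia. auto.
      * rewrite Z.add_assoc. exact B.
Qed.

Lemma merge_pass_spec off s0 :
  (0 <= iv s0 vB)%Z -> (0 <= iv s0 vK)%Z -> (iv s0 vB + iv s0 vK <= iv s0 vS)%Z ->
  (0 < iv s0 vW)%Z ->
  blocks off (iv s0 vW) (rd (tm s0) (iv s0 vB) (iv s0 vK)) ->
  wp (merge_pass off) (fun t s =>
    (t <= 300 * iv s0 vK + 20)%Z /\
    blocks off (iv s0 vW + iv s0 vW) (rd (tm s) (iv s0 vS) (iv s0 vK)) /\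
    Permutation (rd (tm s0) (iv s0 vB) (iv s0 vK)) (rd (tm s) (iv s0 vS) (iv s0 vK)) /\
    (forall k, ~ (iv s0 vS <= k < iv s0 vS + iv s0 vK)%Z -> tm s k = tm s0 k)) s0.
Proof.
  intros HB HK HS HW HBl. apply wp_seq, wp_seti.
  set (B := iv s0 vB) in *. set (K := iv s0 vK) in *. set (T := iv s0 vS) in *.
  set (w := iv s0 vW) in *.
  apply wp_while_Z with
    (Inv := fun s => (0 <= iv s vI <= K)%Z /\
       blocks off w (rd (tm s0) (B + iv s vI) (K - iv s vI)) /\
       Permutation (rd (tm s0) B (iv s vI)) (rd (tm s) T (iv s vI)) /\
       (* [blocks] grows at the front but the pass writes at the back, so the finished part is
          described by what may be appended to it. After a short final block nothing may be, hence
          the second case. *)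
       ((forall l, blocks off (w + w) l -> blocks off (w + w) (rd (tm s) T (iv s vI) ++ l)) \/
        (iv s vI = K /\ blocks off (w + w) (rd (tm s) T K))) /\
       (forall k, ~ (T <= k < T + K)%Z -> tm s k = tm s0 k))
    (phi := fun s => (300 * (K - iv s vI))%Z).
  - simp. split; [ lia | ]. rewrite Z.add_0_r, Z.sub_0_r. split; [ exact HBl | ].
    rewrite !rd_nil by lia. split; [ reflexivity | ]. split; [ left; auto | auto ].
  - intros s (I1 & I2 & I3 & I4 & I5) F. simp. split; [ auto | lia ].
  - intros s (I1 & I2 & I3 & I4 & I5) F D. simp_in D. frame F. simp_in D.
    fold K in D.
    destruct I4 as [I4 | [I4 _]]; [ | lia ].
    assert (HM : wp (CIf (BLt $vK ($vI +' $vW)) (CSetI vM $vK) (CSetI vM ($vI +' $vW)))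
      (fun t s' => (t <= 40)%Z /\ s' = assignI s vM (Z.min (iv s vI + w) K)) s).
    { apply wp_if; [ simp; auto | | ]; simp; frame F; simp; fold w K; intros C; apply wp_seti;
        simp; frame F; simp; fold w K; (split; [ lia | f_equal; lia ]). }
    apply wp_seq. apply (wp_mono _ _ _ _ HM). clear HM. intros t1 s1 [T1 ->].
    set (mid := Z.min (iv s vI + w) K).
    assert (HH : wp (CIf (BLt $vK ($vI +' ($vW +' $vW))) (CSetI vH $vK)
                       (CSetI vH ($vI +' ($vW +' $vW))))
      (fun t s' => (t <= 60)%Z /\
         s' = assignI (assignI s vM mid) vH (Z.min (iv s vI + (w + w)) K)) (assignI s vM mid)).
    { apply wp_if; [ simp; auto | | ]; simp; frame F; simp; fold w K; intros C; apply wp_seti;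
        simp; frame F; simp; fold w K; (split; [ lia | f_equal; lia ]). }
    apply wp_seq. apply (wp_mono _ _ _ _ HH). clear HH. intros t2 s2 [T2 ->].
    set (hi := Z.min (iv s vI + (w + w)) K).
    apply wp_seq, wp_seti, wp_seq, wp_seti, wp_seq, wp_seti, wp_seq.
    eapply wp_call; [ apply merge_loop_spec | ]; simp; frame F; simp;
      fold B K T; try lia.
    intros t3 s3 F3 (T3 & E3 & X3). apply wp_seti. simp. frame F3. simp_in F3. simp.
    destruct (merge_blocks off w (tm s0) (B + iv s vI) (K - iv s vI) (mid - iv s vI) (hi - iv s vI))
      as (S1 & P1 & B1); [ lia | lia | exact I2 | lia | lia | ].
    assert (Eq : rd (tm s3) (T + iv s vI) (hi - iv s vI) =
       merge off (rd (tm s0) (B + iv s vI) (mid - iv s vI))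
         (rd (tm s0) (B + iv s vI + (mid - iv s vI)) (hi - iv s vI - (mid - iv s vI)))).
    { rewrite E3. f_equal.
      - apply rd_ext. intros k Hk. apply I5. lia.
      - replace (B + iv s vI + (mid - iv s vI))%Z with (B + mid)%Z by lia.
        replace (hi - iv s vI - (mid - iv s vI))%Z with (hi - mid)%Z by lia.
        apply rd_ext. intros k Hk. apply I5. lia. }
    assert (E0 : rd (tm s3) T (iv s vI) = rd (tm s) T (iv s vI)).
    { apply rd_ext. intros k Hk. apply X3. lia. }
    assert (Esplit : rd (tm s3) T hi = rd (tm s) T (iv s vI) ++ rd (tm s3) (T + iv s vI) (hi - iv s vI)).
    { rewrite <- E0, <- rd_app by lia. f_equal. lia. }
    split; [ | lia ].
    split; [ lia | ]. split; [ | split; [ | split ] ].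
    + replace (B + hi)%Z with (B + iv s vI + (hi - iv s vI))%Z by lia.
      replace (K - hi)%Z with (K - iv s vI - (hi - iv s vI))%Z by lia. exact B1.
    + rewrite Esplit, Eq.
      replace hi with (iv s vI + (hi - iv s vI))%Z at 1 by lia.
      rewrite rd_app by lia. apply Permutation_app; auto.
    + destruct (Z.eq_dec hi (iv s vI + (w + w))) as [Hhi | Hhi].
      * left. intros l Hl. rewrite Esplit, <- app_assoc. apply I4.
        apply blocks_cons; auto; [ rewrite rd_length; lia | rewrite Eq; exact S1 ].
      * right. assert (EK : hi = K) by lia. split; [ exact EK | ]. rewrite <- EK at 1. rewrite Esplit.
        apply I4, blocks_last; [ rewrite rd_length; lia | rewrite Eq; exact S1 ].
    + intros k Hk. rewrite X3 by lia. apply I5. lia.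
  - intros t s (I1 & I2 & I3 & I4 & I5) F D Ht. simp_in D. simp_in Ht. frame F. simp_in D. fold K in D.
    simp. assert (E : iv s vI = K) by lia. rewrite E in *.
    split; [ lia | ]. split; [ | auto ].
    destruct I4 as [I4 | [_ I4]]; [ | exact I4 ].
    rewrite <- (app_nil_r (rd (tm s) T K)). apply I4, blocks_last; [ cbn; lia | constructor ].
Qed.

(** Bottom-up, because the language has no recursion. *)
Definition merge_sort (off : nat) : cmd :=
  CSetI vW (ACst 1) ;;
  CWhile (BLt $vW $vK)
    (merge_pass off ;; copy_loop vB vS ;; CSetI vW ($vW +' $vW)).

Lemma merge_sort_spec off lg s0 :
  (0 <= iv s0 vB)%Z -> (0 <= iv s0 vK)%Z -> (iv s0 vB + iv s0 vK <= iv s0 vS)%Z ->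
  (0 <= lg)%Z -> (iv s0 vK <= 2 ^ lg)%Z ->
  wp (merge_sort off) (fun t s =>
    (t <= 500 * (iv s0 vK + 1) * (lg + 1))%Z /\
    StronglySorted (key_le off) (rd (tm s) (iv s0 vB) (iv s0 vK)) /\
    Permutation (rd (tm s0) (iv s0 vB) (iv s0 vK)) (rd (tm s) (iv s0 vB) (iv s0 vK)) /\
    (forall k, ~ (iv s0 vB <= k < iv s0 vB + iv s0 vK)%Z ->
       ~ (iv s0 vS <= k < iv s0 vS + iv s0 vK)%Z -> tm s k = tm s0 k)) s0.
Proof.
  intros HB HK HS Hlg Hpow. apply wp_seq, wp_seti.
  set (B := iv s0 vB) in *. set (K := iv s0 vK) in *. set (T := iv s0 vS) in *.
  apply wp_while_Z with
    (Inv := fun s => (exists j, 0 <= j <= lg /\ iv s vW = 2 ^ j)%Z /\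
       blocks off (iv s vW) (rd (tm s) B K) /\
       Permutation (rd (tm s0) B K) (rd (tm s) B K) /\
       (forall k, ~ (B <= k < B + K)%Z -> ~ (T <= k < T + K)%Z -> tm s k = tm s0 k))
    (phi := fun s => (500 * (K + 1) * (lg - Z.log2 (iv s vW)))%Z).
  - simp. split; [ exists 0%Z; lia | ]. split; [ apply blocks_one | ]. auto.
  - intros s ((j & Hj & Ej) & I2 & I3 & I4) F. simp. split; [ auto | ].
    rewrite Ej, Z.log2_pow2 by lia. apply Z.mul_nonneg_nonneg; lia.
  - intros s ((j & Hj & Ej) & I2 & I3 & I4) F D. simp_in D. frame F. simp_in D. fold K in D.
    assert (Hj2 : (j + 1 <= lg)%Z).
    { destruct (Z_le_dec (j + 1) lg) as [H | H]; [ auto | ].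
      assert (j = lg) as -> by lia. lia. }
    assert (Hw : (0 < iv s vW)%Z) by (rewrite Ej; apply Z.pow_pos_nonneg; lia).
    apply wp_seq. eapply wp_call; [ apply (merge_pass_spec off) | ]; frame F; simp; fold B K T; auto.
    intros t1 s1 F1 (T1 & B1 & P1 & X1).
    apply wp_seq. eapply wp_call; [ apply copy_loop_spec; [ left; auto | .. ] | ]; frame F1; frame F; simp;
      fold B K T; auto.
    intros t2 s2 F2 (T2 & E2 & X2). apply wp_seti. simp. frame F2. frame F1.
    rewrite E2. split.
    + split; [ | split; [ exact B1 | split ] ].
      * exists (j + 1)%Z. split; [ lia | ]. rewrite Ej, Z.pow_add_r, Z.pow_1_r by lia. lia.
      * etransitivity; eauto.
      * intros k Hk1 Hk2. rewrite X2, X1, I4 by auto. reflexivity.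
    + replace (iv s vW + iv s vW)%Z with (2 * iv s vW)%Z by lia.
      rewrite Z.log2_double by lia.
      replace (500 * (K + 1) * (lg - Z.log2 (iv s vW)) - 500 * (K + 1) * (lg - Z.succ (Z.log2 (iv s vW))))%Z
        with (500 * (K + 1))%Z by ring.
      lia.
  - intros t s ((j & Hj & Ej) & I2 & I3 & I4) F D Ht. simp_in D. simp_in Ht. frame F. simp_in D.
    fold K in D. simp. split; [ | split; [ | auto ] ].
    + assert (0 <= 500 * (K + 1) * (lg - Z.log2 (iv s vW)))%Z.
      { rewrite Ej, Z.log2_pow2 by lia. apply Z.mul_nonneg_nonneg; lia. }
      change (Z.log2 1) with 0%Z in Ht. lia.
    + apply blocks_sorted with (iv s vW); [ exact I2 | | rewrite rd_length; lia ].
      rewrite Ej. apply Z.pow_pos_nonneg; lia.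
Qed.

(** * Loops over a column *)

Definition margin (c : point) : R := pr c - q1 c - q2 c.

Definition small (th : R) (c : point) : bool :=
  if Rlt_dec th (margin c) then false else true.

(** In column [x], a customer with [q1 c <= x] buys the offer of margin [r] and second quality y
    exactly when y lies between [q2 c] and [pr c - x - r]. This tests that the interval is
    nonempty. *)
Definition wide (r x : R) (c : point) : bool :=
  if Rlt_dec (pr c) (q2 c + x + r) then false else true.

(** The customer's interval ends strictly before [y]. *)
Definition low (r x y : R) (c : point) : bool :=
  if Rlt_dec (pr c) (y + x + r) then true else false.

Lemma sorted_app off l1 l2 a b :
  StronglySorted (key_le off) (l1 ++ l2) -> In a l1 -> In b l2 -> key_le off a b.
Proof.
  induction l1 as [|c l1 IH]; cbn; intros S Ha Hb; [ tauto | ].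
  inversion S as [|? ? S' F]; subst. destruct Ha as [-> | Ha]; auto.
  rewrite Forall_forall in F. apply F, in_or_app. auto.
Qed.

Lemma sorted_rd off m b k i j :
  StronglySorted (key_le off) (rd m b k) -> (0 <= i <= j)%Z -> (j < k)%Z ->
  comp (m (b + i)%Z) off <= comp (m (b + j)%Z) off.
Proof.
  intros S Hi Hj. destruct (Z.eq_dec i j) as [-> | Hne]; [ lra | ].
  replace k with (j + (k - j))%Z in S by lia. rewrite rd_app in S by lia.
  apply (sorted_app off _ _ _ _ S); apply rd_in; [ exists i | exists 0%Z ]; split; try lia; auto.
  f_equal. lia.
Qed.

Lemma filter_all {A} (f : A -> bool) l : (forall a, In a l -> f a = true) -> filter f l = l.
Proof.
  induction l as [|a l IH]; cbn; intros H; [ auto | ]. rewrite H by auto. f_equal. auto.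
Qed.

Lemma filter_none {A} (f : A -> bool) l : (forall a, In a l -> f a = false) -> filter f l = [].
Proof.
  induction l as [|a l IH]; cbn; intros H; [ auto | ]. rewrite H by auto. auto.
Qed.

Lemma filter_rd_prefix f m b k u :
  (0 <= u <= k)%Z -> (forall i, (0 <= i < u)%Z -> f (m (b + i)%Z) = true) ->
  (forall i, (u <= i < k)%Z -> f (m (b + i)%Z) = false) ->
  Z.of_nat (length (filter f (rd m b k))) = u.
Proof.
  intros Hu H1 H2. replace k with (u + (k - u))%Z by lia.
  rewrite rd_app, filter_app by lia.
  rewrite filter_all, filter_none; [ rewrite app_nil_r; apply rd_length; lia | | ];
    intros c Hc; apply rd_in in Hc as (i & Hi & ->).
  - rewrite <- Z.add_assoc. apply H2. lia.
  - apply H1. lia.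
Qed.

(* For the margin [rR], column [rX] and granularity [rD = rR / N], only customers of margin
   at most [rT] count. The offer [(rP, rA, rB)] is the best so far, with profit at least [rV].
   Triples [0, n) hold the input sorted by first quality, [n, n + vc) the customers alive in
   the current column, [2n, 2n + vc) a copy of these sorted by price; [3n, 4n) is scratch space. *)
Local Notation vi := 11%nat.
Local Notation vc := 12%nat.
Local Notation vj := 13%nat.
Local Notation vt := 14%nat.
Local Notation vu := 15%nat.
Local Notation rM := 0%nat.
Local Notation rR := 1%nat.
Local Notation rD := 2%nat.
Local Notation rT := 3%nat.
Local Notation rX := 4%nat.
Local Notation rV := 5%nat.
Local Notation rP := 6%nat.
Local Notation rA := 7%nat.
Local Notation rB := 8%nat.

Definition margin_at (a : aexp) : rexp := RMns (RMns (RGet 0 a) (RGet 1 a)) (RGet 2 a).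

Definition add_loop : cmd :=
  CWhile (BAnd (BLt $vi $vN) (BNot (BRLt (RVar rX) (RGet 1 $vi))))
    (CIf (BRLt (RVar rT) (margin_at $vi)) CSkip
       (put_copy ($vN +' $vc) $vi ;; CSetI vc ($vc +' ACst 1)) ;;
     CSetI vi ($vi +' ACst 1)).

Lemma add_loop_spec s0 :
  (0 <= iv s0 vi <= iv s0 vN)%Z -> (0 <= iv s0 vc <= iv s0 vi)%Z ->
  wp add_loop (fun t s =>
    (t <= 200 * (iv s vi - iv s0 vi) + 40)%Z /\
    (iv s0 vi <= iv s vi <= iv s0 vN)%Z /\
    (iv s0 vc <= iv s vc <= iv s0 vc + (iv s vi - iv s0 vi))%Z /\
    rd (tm s) (iv s0 vN) (iv s vc) =
      rd (tm s0) (iv s0 vN) (iv s0 vc) ++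
      filter (small (rv s0 rT)) (rd (tm s0) (iv s0 vi) (iv s vi - iv s0 vi)) /\
    (forall k, ~ (iv s0 vN <= k < iv s0 vN + iv s0 vN)%Z -> tm s k = tm s0 k) /\
    (forall c, In c (rd (tm s0) (iv s0 vi) (iv s vi - iv s0 vi)) -> q1 c <= rv s0 rX) /\
    ((iv s vi < iv s0 vN)%Z -> rv s0 rX < q1 (tm s0 (iv s vi)))) s0.
Proof.
  intros Hi Hc.
  apply wp_while_Z with
    (Inv := fun s =>
    (iv s0 vi <= iv s vi <= iv s0 vN)%Z /\
    (iv s0 vc <= iv s vc <= iv s0 vc + (iv s vi - iv s0 vi))%Z /\
    rd (tm s) (iv s0 vN) (iv s vc) =
      rd (tm s0) (iv s0 vN) (iv s0 vc) ++
      filter (small (rv s0 rT)) (rd (tm s0) (iv s0 vi) (iv s vi - iv s0 vi)) /\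
    (forall k, ~ (iv s0 vN <= k < iv s0 vN + iv s0 vN)%Z -> tm s k = tm s0 k) /\
    (forall c, In c (rd (tm s0) (iv s0 vi) (iv s vi - iv s0 vi)) -> q1 c <= rv s0 rX))
    (phi := fun s => (200 * (iv s0 vN - iv s vi))%Z).
  - split; [ lia | ]. split; [ lia | ]. rewrite (rd_nil _ (iv s0 vi)) by lia.
    cbn [filter]. rewrite app_nil_r. split; [ auto | ]. split; [ auto | ]. intros c [].
  - intros s (I1 & I2 & I3 & I4 & I5) F. simp. split; [ split; [ auto | split; [ auto | lia ] ] | lia ].
  - intros s (I1 & I2 & I3 & I4 & I5) F D. simp_in D. frame F. destruct D as [D1 D2].
    assert (Et : tm s (iv s vi) = tm s0 (iv s vi)) by (apply I4; lia).
    rewrite Et in D2. change (comp (tm s0 (iv s vi)) 1) with (q1 (tm s0 (iv s vi))) in D2.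
    assert (Erd : rd (tm s0) (iv s0 vi) (iv s vi + 1 - iv s0 vi) =
       rd (tm s0) (iv s0 vi) (iv s vi - iv s0 vi) ++ [tm s0 (iv s vi)]).
    { replace (iv s vi + 1 - iv s0 vi)%Z with (iv s vi - iv s0 vi + 1)%Z by lia.
      rewrite rd_snoc by lia. do 3 f_equal. lia. }
    assert (J5 : forall c, In c (rd (tm s0) (iv s0 vi) (iv s vi + 1 - iv s0 vi)) -> q1 c <= rv s0 rX).
    { intros c Hin. rewrite Erd in Hin. apply in_app_or in Hin as [Hin | [<- | []]]; [ auto | lra ]. }
    assert (Em : evalR (margin_at $vi) s = margin (tm s0 (iv s vi))).
    { unfold margin_at. simp. rewrite Et. reflexivity. }
    apply wp_seq, wp_if.
    + unfold margin_at. simp. repeat split; lia.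
    + cbn [holds]. rewrite Em. cbn [evalR]. frame F. intros D. apply wp_skip, wp_seti.
      unfold margin_at. simp. frame F. split; [ | lia ].
      split; [ lia | ]. split; [ lia | ]. split; [ | split; [ auto | exact J5 ] ].
      rewrite Erd, filter_app, I3. cbn [filter]. unfold small at 3.
      destruct (Rlt_dec (rv s0 rT) (margin (tm s0 (iv s vi)))); [ | tauto ].
      now rewrite app_nil_r.
    + cbn [holds]. rewrite Em. cbn [evalR]. frame F. intros D.
      apply wp_seq, wp_put_copy; simp; frame F; [ lia | lia | ]. apply wp_seti, wp_seti.
      unfold margin_at. simp. frame F. split; [ | lia ].
      split; [ lia | ]. split; [ lia | ]. split; [ | split; [ | exact J5 ] ].
      * rewrite rd_updT_snoc by lia. rewrite Et, Erd, filter_app, I3, <- app_assoc.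
        cbn [filter]. unfold small at 3.
        destruct (Rlt_dec (rv s0 rT) (margin (tm s0 (iv s vi)))); [ tauto | reflexivity ].
      * intros k Hk. rewrite updT_other by lia. auto.
  - intros t s (I1 & I2 & I3 & I4 & I5) F D T. simp_in D. simp_in T. frame F.
    split; [ lia | ]. do 5 (split; [ auto | ]).
    intros H. rewrite I4 in D by lia. apply Rnot_le_lt. intros H2. apply D. split; [ lia | ].
    apply Rle_not_lt. exact H2.
Qed.

(** Compaction in place: the write index [vt] never overtakes the read index [vj]. *)
Definition filter_loop : cmd :=
  CWhile (BLt $vj $vc)
    (CIf (BRLt (RGet 0 ($vN +' $vj))
            (RPls (RPls (RGet 2 ($vN +' $vj)) (RVar rX)) (RVar rR))) CSkip
       (put_copy ($vN +' $vt) ($vN +' $vj) ;; CSetI vt ($vt +' ACst 1)) ;;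
     CSetI vj ($vj +' ACst 1)).

Lemma filter_loop_spec s0 :
  (0 <= iv s0 vN)%Z -> (0 <= iv s0 vc)%Z -> iv s0 vj = 0%Z -> iv s0 vt = 0%Z ->
  wp filter_loop (fun t s =>
    (t <= 200 * iv s0 vc + 40)%Z /\
    (0 <= iv s vt <= iv s0 vc)%Z /\
    rd (tm s) (iv s0 vN) (iv s vt) =
      filter (wide (rv s0 rR) (rv s0 rX)) (rd (tm s0) (iv s0 vN) (iv s0 vc)) /\
    (forall k, ~ (iv s0 vN <= k < iv s0 vN + iv s0 vc)%Z -> tm s k = tm s0 k)) s0.
Proof.
  intros Hn Hc Ej Et.
  apply wp_while_Z with
    (Inv := fun s =>
    (0 <= iv s vt <= iv s vj)%Z /\ (iv s vj <= iv s0 vc)%Z /\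
    rd (tm s) (iv s0 vN) (iv s vt) =
      filter (wide (rv s0 rR) (rv s0 rX)) (rd (tm s0) (iv s0 vN) (iv s vj)) /\
    (forall k, ~ (iv s0 vN <= k < iv s0 vN + iv s vj)%Z -> tm s k = tm s0 k))
    (phi := fun s => (200 * (iv s0 vc - iv s vj))%Z).
  - rewrite Ej, Et, !(rd_nil _ _ 0) by lia. repeat split; auto; lia.
  - intros s (I1 & I2 & I3 & I4) F. simp. split; [ auto | lia ].
  - intros s (I1 & I2 & I3 & I4) F D. simp_in D. frame F.
    assert (Em : tm s (iv s0 vN + iv s vj)%Z = tm s0 (iv s0 vN + iv s vj)%Z) by (apply I4; lia).
    apply wp_seq, wp_if.
    + simp. frame F. repeat split; lia.
    + simp. frame F. rewrite Em. intros D1. apply wp_skip, wp_seti. simp. frame F. split; [ | lia ].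
      split; [ lia | ]. split; [ lia | ]. split; [ | intros k Hk; apply I4; lia ].
      rewrite rd_snoc, filter_app, I3 by lia. cbn [filter]. unfold wide at 3.
      destruct (Rlt_dec (pr _) _) as [D2 | D2]; [ now rewrite app_nil_r | ].
      destruct D2. exact D1.
    + simp. frame F. rewrite Em. intros D1.
      apply wp_seq, wp_put_copy; simp; frame F; [ lia | lia | ]. apply wp_seti, wp_seti.
      simp. frame F. split; [ | lia ].
      split; [ lia | ]. split; [ lia | ]. split.
      * rewrite rd_updT_snoc, rd_snoc, filter_app, I3, Em by lia. cbn [filter]. unfold wide at 3.
        destruct (Rlt_dec (pr _) _) as [D2 | D2]; [ | reflexivity ].
        destruct D1. exact D2.
      * intros k Hk. rewrite updT_other by lia. apply I4. lia.
  - intros t s (I1 & I2 & I3 & I4) F D T. simp_in D. simp_in T. frame F.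
    assert (E : iv s vj = iv s0 vc) by lia. rewrite E in *. auto with zarith.
Qed.

(* The offers at quality [y = q2 (W_j)] that satisfy all [j + 1] first quality bounds lose the
   customers with [pr < y + x + r]; both lists being sorted, [vu] counts these and only grows. *)
Definition sweep_loop : cmd :=
  CWhile (BLt $vj $vc)
    (CIf (BAnd (BLt $vu $vc)
           (BRLt (RGet 0 ($vN +' $vN +' $vu))
              (RPls (RPls (RGet 2 ($vN +' $vj)) (RVar rX)) (RVar rR))))
       (CSetI vu ($vu +' ACst 1))
       (CIf (BRLt (RVar rV) (RTms (RVar rR) (RInt (ASub ($vj +' ACst 1) $vu))))
          (CSetR rV (RTms (RVar rR) (RInt (ASub ($vj +' ACst 1) $vu))) ;;
           CSetR rB (RGet 2 ($vN +' $vj)) ;;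
           CSetR rA (RVar rX) ;;
           CSetR rP (RPls (RPls (RVar rB) (RVar rX)) (RVar rR)))
          CSkip ;;
        CSetI vj ($vj +' ACst 1))).

Definition sound (M : market) (s : store) : Prop :=
  0 <= rv s rV <= profit M (rv s rP, rv s rA, rv s rB).

(** Intervals opened up to index [j] minus those already closed, times the margin. With ties in
    [q2], later customers may open at the same [y], so this is in general only a lower bound for the
    profit. *)
Definition gain (r x : R) (l : list point) (j : Z) (y : R) : R :=
  r * (IZR (j + 1) - INR (length (filter (low r x y) l))).

Lemma sweep_loop_spec M s0 :
  let W := rd (tm s0) (iv s0 vN) (iv s0 vc) in
  let V := rd (tm s0) (iv s0 vN + iv s0 vN) (iv s0 vc) in
  let y j := q2 (tm s0 (iv s0 vN + j)%Z) in
  let r := rv s0 rR in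
  let x := rv s0 rX in
  (0 <= iv s0 vN)%Z -> (0 <= iv s0 vc)%Z -> iv s0 vj = 0%Z -> iv s0 vu = 0%Z ->
  StronglySorted (key_le 2) W -> StronglySorted (key_le 0) V ->
  (forall j, (0 <= j < iv s0 vc)%Z -> gain r x V j (y j) <= profit M (y j + x + r, x, y j)) ->
  sound M s0 ->
  wp sweep_loop (fun t s =>
    (t <= 500 * iv s0 vc + 40)%Z /\ tm s = tm s0 /\ sound M s /\ rv s0 rV <= rv s rV /\
    (forall j, (0 <= j < iv s0 vc)%Z -> gain r x V j (y j) <= rv s rV)) s0.
Proof.
  intros W V y r x Hn Hc Ej Eu SW SV Hprofit Hs0.
  apply wp_while_Z with
    (Inv := fun s =>
       (0 <= iv s vj <= iv s0 vc)%Z /\ (0 <= iv s vu <= iv s0 vc)%Z /\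
       tm s = tm s0 /\ sound M s /\ rv s0 rV <= rv s rV /\
       (* Since [y] is nondecreasing, an interval closed once stays closed; this is why [vu] is
          never reset and the sweep is linear. *)
       (forall k j, (0 <= k < iv s vu)%Z -> (iv s vj <= j < iv s0 vc)%Z ->
          pr (tm s0 (iv s0 vN + iv s0 vN + k)%Z) < y j + x + r) /\
       (forall j, (0 <= j < iv s vj)%Z -> gain r x V j (y j) <= rv s rV))
    (phi := fun s => (250 * (iv s0 vc + iv s0 vc - iv s vj - iv s vu))%Z).
  - rewrite Ej, Eu. do 3 (split; [ auto with zarith | ]). split; [ exact Hs0 | ].
    split; [ lra | ]. split; intros; lia.
  - intros s (I1 & I2 & I3 & I4 & I5 & I6 & I7) F. simp. split; [ auto | lia ].
  - intros s (I1 & I2 & I3 & I4 & I5 & I6 & I7) F D. simp_in D. frame F.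
    apply wp_if.
    + simp. frame F. repeat split; lia.
    + simp. frame F. rewrite I3. intros [D1 D2]. apply wp_seti. simp. frame F. split; [ | lia ].
      split; [ lia | ]. split; [ lia | ]. split; [ auto | ]. split; [ exact I4 | ].
      split; [ exact I5 | ]. split; [ | exact I7 ].
      intros k j Hk Hj. destruct (Z_lt_dec k (iv s vu)) as [H | H]; [ apply I6; lia | ].
      replace k with (iv s vu) by lia.
      pose proof (sorted_rd 2 _ _ _ (iv s vj) j SW ltac:(lia) ltac:(lia)) as Hle.
      change (q2 (tm s0 (iv s0 vN + iv s vj)%Z) <= y j) in Hle.
      apply Rlt_le_trans with (q2 (tm s0 (iv s0 vN + iv s vj)%Z) + x + r); [ exact D2 | lra ].
    + simp. frame F. rewrite I3. intros D1.
      assert (Ecount : Z.of_nat (length (filter (low r x (y (iv s vj))) V)) = iv s vu).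
      { apply filter_rd_prefix; [ lia | | ]; intros k Hk; unfold low;
          destruct (Rlt_dec _ _) as [H | H]; auto.
        - destruct H. apply I6; lia.
        - destruct D1. split; [ lia | ].
          pose proof (sorted_rd 0 _ _ _ (iv s vu) k SV ltac:(lia) ltac:(lia)) as Hle.
          eapply Rle_lt_trans; [ exact Hle | exact H ]. }
      assert (Egain : gain r x V (iv s vj) (y (iv s vj)) = r * IZR (iv s vj + 1 - iv s vu)).
      { unfold gain. rewrite INR_IZR_INZ, Ecount, <- minus_IZR. reflexivity. }
      assert (HI7 : forall v, rv s rV <= v -> r * IZR (iv s vj + 1 - iv s vu) <= v ->
         forall j, (0 <= j < iv s vj + 1)%Z -> gain r x V j (y j) <= v).
      { intros v Hv1 Hv2 j Hj. destruct (Z.eq_dec j (iv s vj)) as [-> | Hne]; [ lra | ].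
        apply Rle_trans with (rv s rV); [ apply I7; lia | exact Hv1 ]. }
      apply wp_seq, wp_if.
      * simp. auto.
      * simp. frame F. intros D2.
        apply wp_seq, wp_setr; [ simp; auto | ].
        apply wp_seq, wp_setr; [ simp; frame F; lia | ].
        apply wp_seq, wp_setr; [ simp; auto | ].
        apply wp_setr; [ simp; auto | ].
        apply wp_seti. simp. frame F. rewrite I3.
        fold r in D2 |- *. fold x.
        change (comp (tm s0 (iv s0 vN + iv s vj)%Z) 2) with (y (iv s vj)).
        split; [ | lia ].
        split; [ lia | ]. split; [ lia | ]. split; [ auto | ]. split; [ | split; [ lra | split ] ].
        -- unfold sound. simp. destruct I4 as [I4 _]. split; [ lra | ].
           rewrite <- Egain. apply Hprofit. lia.
        -- intros k j Hk Hj. apply I6; lia.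
        -- apply HI7; lra.
      * simp. frame F. intros D2. apply wp_skip, wp_seti. simp. frame F. fold r in D2.
        split; [ | lia ].
        split; [ lia | ]. split; [ lia | ]. split; [ auto | ]. split; [ exact I4 | ].
        split; [ exact I5 | ]. split; [ intros k j Hk Hj; apply I6; lia | ].
        apply HI7; lra.
  - intros t s (I1 & I2 & I3 & I4 & I5 & I6 & I7) F D T. simp_in D. simp_in T. frame F.
    assert (E : iv s vj = iv s0 vc) by lia. rewrite E in *.
    split; [ lia | ]. auto.
Qed.

(** * Counting *)

Definition cnt (f : point -> bool) (l : list point) : nat := length (filter f l).

Lemma cnt_perm f l l' : Permutation l l' -> cnt f l = cnt f l'.
Proof.
  unfold cnt. induction 1; cbn; repeat (destruct (f _); cbn); lia.
Qed.

Lemma cnt_app f l l' : cnt f (l ++ l') = (cnt f l + cnt f l')%nat.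
Proof. unfold cnt. now rewrite filter_app, length_app. Qed.

Lemma cnt_cons f a l : cnt f (a :: l) = ((if f a then 1 else 0) + cnt f l)%nat.
Proof. unfold cnt. cbn. now destruct (f a). Qed.

Lemma cnt_mono f g l :
  (forall c, In c l -> f c = true -> g c = true) -> (cnt f l <= cnt g l)%nat.
Proof.
  induction l as [|a l IH]; intros H; [ cbn; lia | ]. rewrite !cnt_cons.
  assert (H1 := H a (or_introl eq_refl)).
  assert (H2 : (cnt f l <= cnt g l)%nat) by (apply IH; intros; apply H; cbn; auto).
  destruct (f a); [ rewrite H1 by auto; lia | destruct (g a); lia ].
Qed.

Lemma cnt_filter f g l : cnt f (filter g l) = cnt (fun c => andb (g c) (f c)) l.
Proof.
  unfold cnt. induction l as [|a l IH]; cbn; [ auto | ].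
  destruct (g a); cbn; [ destruct (f a); cbn; auto | auto ].
Qed.

Lemma cnt_or f g h l :
  (forall c, In c l -> f c = true -> g c = true \/ h c = true) ->
  (cnt f l <= cnt g l + cnt h l)%nat.
Proof.
  induction l as [|a l IH]; intros H; [ cbn; lia | ]. rewrite !cnt_cons.
  assert (H2 : (cnt f l <= cnt g l + cnt h l)%nat) by (apply IH; intros; apply H; cbn; auto).
  destruct (f a) eqn:E; [ | lia ].
  destruct (H a (or_introl eq_refl) E) as [-> | ->]; lia.
Qed.

Lemma buysb_true P c : buysb P c = true <-> buys P c.
Proof.
  unfold buysb, buys.
  repeat match goal with |- context [if ?d then _ else _] => destruct d end;
    split; intros H; try discriminate; tauto.
Qed.

Lemma num_buyers_cnt M P : num_buyers M P = cnt (buysb P) M.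
Proof. reflexivity. Qed.

Definition alive (r th x : R) (c : point) : bool := andb (small th c) (wide r x c).

Definition offer (r x y : R) : point := (y + x + r, x, y).

Lemma profit_offer M r x y : profit M (offer r x y) = r * INR (cnt (buysb (offer r x y)) M).
Proof. unfold profit, offer. rewrite num_buyers_cnt. cbn. f_equal. unfold pr, q1, q2; cbn. ring. Qed.

Lemma small_true th c : small th c = true <-> margin c <= th.
Proof. unfold small. destruct (Rlt_dec _ _); split; intros; auto; try discriminate; lra. Qed.

Lemma wide_true r x c : wide r x c = true <-> q2 c + x + r <= pr c.
Proof. unfold wide. destruct (Rlt_dec _ _); split; intros; auto; try discriminate; lra. Qed.

Lemma low_true r x y c : low r x y c = true <-> pr c < y + x + r.
Proof. unfold low. destruct (Rlt_dec _ _); split; intros; auto; try discriminate; lra. Qed.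

Lemma alive_true r th x c :
  alive r th x c = true <-> margin c <= th /\ q2 c + x + r <= pr c.
Proof. unfold alive. now rewrite Bool.andb_true_iff, small_true, wide_true. Qed.

Lemma buys_offer r x y c :
  buysb (offer r x y) c = true <-> y + x + r <= pr c /\ q1 c <= x /\ q2 c <= y.
Proof.
  rewrite buysb_true. unfold buys, offer, pr, q1, q2; cbn.
  split; intros (? & ? & ?); repeat split; lra.
Qed.

(** What a processed column guarantees: restricted to small customers, no offer of margin [r] in it
    beats [v]. *)
Definition reached (M : market) (r th x v : R) : Prop :=
  forall y, r * INR (cnt (fun c => andb (buysb (offer r x y) c) (small th c)) M) <= v.

(** Each of the first [j + 1] customers has opened its interval, so it either has closed it or buys.
    Customers outside the column can only add buyers. *)
Lemma gain_sound M T1 T2 r th x m b k V j :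
  0 <= r -> Permutation M (T1 ++ T2) -> (forall c, In c T1 -> q1 c <= x) ->
  Permutation (rd m b k) (filter (alive r th x) T1) ->
  Permutation (rd m b k) V ->
  StronglySorted (key_le 2) (rd m b k) -> (0 <= j < k)%Z ->
  gain r x V j (q2 (m (b + j)%Z)) <= profit M (offer r x (q2 (m (b + j)%Z))).
Proof.
  intros Hr HM HT HW HV S Hj. rewrite profit_offer. unfold gain.
  apply Rmult_le_compat_l; [ auto | ].
  set (y := q2 (m (b + j)%Z)).
  fold (cnt (low r x y) V). rewrite <- (cnt_perm _ _ _ HV).
  set (le_y := fun c => if Rle_dec (q2 c) y then true else false).
  assert (H1 : (Z.to_nat (j + 1) <= cnt le_y (rd m b k))%nat).
  { replace k with (j + 1 + (k - (j + 1)))%Z by lia. rewrite rd_app, cnt_app by lia.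
    unfold cnt at 1. rewrite filter_all.
    - pose proof (rd_length m b (j + 1)). lia.
    - intros c Hc. apply rd_in in Hc as (i & Hi & ->). unfold le_y.
      destruct (Rle_dec _ _) as [H | H]; [ auto | destruct H ].
      apply (sorted_rd 2 m b k i j S); lia. }
  assert (H2 : (cnt le_y (rd m b k) <=
     cnt (low r x y) (rd m b k) + cnt (buysb (offer r x y)) (rd m b k))%nat).
  { apply cnt_or. intros c Hc Hle. unfold le_y in Hle. destruct (Rle_dec _ _) as [Hy | ]; [ | discriminate ].
    rewrite low_true, buys_offer.
    destruct (Rlt_dec (pr c) (y + x + r)); [ auto | right ].
    rewrite HW in Hc. apply filter_In in Hc as [Hc _]. specialize (HT c Hc). lra. }
  assert (H3 : (cnt (buysb (offer r x y)) (rd m b k) <= cnt (buysb (offer r x y)) M)%nat).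
  { rewrite (cnt_perm _ _ _ HW), (cnt_perm _ _ _ HM), cnt_app, cnt_filter.
    transitivity (cnt (buysb (offer r x y)) T1); [ | lia ].
    apply cnt_mono. intros c _ H. apply andb_prop in H. tauto. }
  replace (j + 1)%Z with (Z.of_nat (Z.to_nat (j + 1))) by lia. rewrite <- INR_IZR_INZ.
  pose proof (le_INR _ _ H1) as L1. pose proof (le_INR _ _ H2) as L2. pose proof (le_INR _ _ H3) as L3.
  rewrite plus_INR in L2. lra.
Qed.

Lemma first_false (f : Z -> bool) n : (0 <= n)%Z ->
  exists u, (0 <= u <= n)%Z /\ (forall i, (0 <= i < u)%Z -> f i = true) /\
    ((u < n)%Z -> f u = false).
Proof.
  intros Hn. pattern n. apply natlike_ind; [ | | exact Hn ].
  - exists 0%Z. repeat split; intros; lia.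
  - intros k Hk (u & H1 & H2 & H3). destruct (Z_lt_dec u k) as [H | H].
    + exists u. split; [ lia | ]. auto.
    + destruct (f k) eqn:E.
      * exists (k + 1)%Z. split; [ lia | ]. split; [ | lia ].
        intros i Hi. destruct (Z.eq_dec i k) as [-> | ]; [ auto | apply H2; lia ].
      * exists k. split; [ lia | ]. split; [ | auto ]. intros i Hi. apply H2. lia.
Qed.

(** An arbitrary [y] can be lowered to the last [q2] in the column not above it: no open interval is
    lost by this. Small buyers outside the column do not exist, because either [q1] is too large or
    the interval is empty. *)
Lemma gain_complete M T1 T2 r th x m b k V v :
  0 <= r -> 0 <= v -> (0 <= k)%Z ->
  Permutation M (T1 ++ T2) -> (forall c, In c T2 -> x < q1 c) ->
  Permutation (rd m b k) (filter (alive r th x) T1) ->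
  Permutation (rd m b k) V ->
  StronglySorted (key_le 2) (rd m b k) ->
  (forall j, (0 <= j < k)%Z -> gain r x V j (q2 (m (b + j)%Z)) <= v) ->
  reached M r th x v.
Proof.
  intros Hr Hv Hk HM HT HW HV S Hgain y.
  set (good := fun c => andb (buysb (offer r x y) c) (small th c)).
  set (le_y := fun c => if Rle_dec (q2 c) y then true else false).
  destruct (first_false (fun i => le_y (m (b + i)%Z)) k Hk) as (u & Hu & Ht & Hf).
  assert (Hcu : Z.of_nat (cnt le_y (rd m b k)) = u).
  { apply filter_rd_prefix; auto. intros i Hi. specialize (Hf ltac:(lia)). unfold le_y in *.
    destruct (Rle_dec (q2 (m (b + u)%Z)) y) as [? | H1]; [ discriminate | ].
    destruct (Rle_dec (q2 (m (b + i)%Z)) y) as [H2 | ?]; [ | auto ].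
    pose proof (sorted_rd 2 m b k u i S ltac:(lia) ltac:(lia)) as H3.
    change (q2 (m (b + u)%Z) <= q2 (m (b + i)%Z)) in H3. lra. }
  assert (Hgood : cnt good M = cnt good (rd m b k)).
  { rewrite (cnt_perm _ _ _ HM), cnt_app, (cnt_perm _ _ _ HW), cnt_filter.
    assert (E2 : cnt good T2 = 0%nat).
    { unfold cnt. rewrite filter_none; [ auto | ]. intros c Hc.
      destruct (good c) eqn:E; [ | auto ]. apply andb_prop in E as [E _].
      apply buys_offer in E. specialize (HT c Hc). lra. }
    rewrite E2, Nat.add_0_r. apply Nat.le_antisymm; apply cnt_mono; intros c _ H.
    - rewrite H. apply andb_prop in H as [H1 H2]. apply small_true in H2. apply buys_offer in H1.
      rewrite (proj2 (alive_true r th x c)); [ auto | ]. lra.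
    - apply andb_prop in H. tauto. }
  fold good. rewrite Hgood.
  (* Open and closed intervals are disjoint, and a nonempty closed one must have been opened. *)
  assert (Hsplit : (cnt good (rd m b k) + cnt (low r x y) (rd m b k) <= cnt le_y (rd m b k))%nat).
  { rewrite !(cnt_perm _ _ _ HW). clear. induction T1 as [|c l IH]; [ cbn; lia | ].
    cbn [filter]. destruct (alive r th x c) eqn:A; [ | exact IH ].
    apply alive_true in A. rewrite !cnt_cons.
    destruct (good c) eqn:G.
    - apply andb_prop in G as [G _]. apply buys_offer in G.
      assert (E1 : le_y c = true) by (unfold le_y; destruct (Rle_dec _ _); [ auto | lra ]).
      destruct (low r x y c) eqn:L; [ apply low_true in L; lra | ]. rewrite E1. lia.
    - destruct (low r x y c) eqn:L; [ apply low_true in L | lia ].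
      assert (E1 : le_y c = true) by (unfold le_y; destruct (Rle_dec _ _); [ auto | lra ]).
      rewrite E1. lia. }
  destruct (Z.eq_dec u 0) as [-> | Hu0].
  - replace (cnt good (rd m b k)) with 0%nat by lia. cbn. lra.
  - specialize (Hgain (u - 1)%Z ltac:(lia)). eapply Rle_trans; [ | exact Hgain ].
    unfold gain. apply Rmult_le_compat_l; [ auto | ].
    set (y' := q2 (m (b + (u - 1))%Z)).
    fold (cnt (low r x y') V). rewrite <- (cnt_perm _ _ _ HV).
    assert (Hy : y' <= y).
    { specialize (Ht (u - 1)%Z ltac:(lia)). unfold le_y in Ht.
      destruct (Rle_dec (q2 (m (b + (u - 1))%Z)) y); [ auto | discriminate ]. }
    assert (Hlow : (cnt (low r x y') (rd m b k) <= cnt (low r x y) (rd m b k))%nat).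
    { apply cnt_mono. intros c _. rewrite !low_true. lra. }
    replace (u - 1 + 1)%Z with (Z.of_nat (cnt le_y (rd m b k))) by lia. rewrite <- INR_IZR_INZ.
    pose proof (le_INR _ _ Hsplit) as L1. pose proof (le_INR _ _ Hlow) as L2.
    rewrite plus_INR in L1. lra.
Qed.

(** * Processing one column *)

(** Sorting by price sorts the upper interval ends, which differ from the prices by the constant
    [x + r]. *)
Definition column : cmd :=
  CSetR rX (RPls (RGet 1 $vi) (RVar rD)) ;;
  add_loop ;;
  CSetI vj (ACst 0) ;; CSetI vt (ACst 0) ;; filter_loop ;; CSetI vc $vt ;;
  CSetI vB $vN ;; CSetI vK $vc ;; CSetI vS ($vN +' $vN +' $vN) ;; merge_sort 2 ;;
  CSetI vS ($vN +' $vN) ;; copy_loop vS vB ;;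
  CSetI vB ($vN +' $vN) ;; CSetI vS ($vN +' $vN +' $vN) ;; merge_sort 0 ;;
  CSetI vj (ACst 0) ;; CSetI vu (ACst 0) ;; sweep_loop.

(** The bound of [vc] by [vi] keeps the list of alive customers inside its n cells. *)
Definition column_inv (M : market) (s : store) : Prop :=
  Permutation M (rd (tm s) 0 (iv s vN)) /\
  StronglySorted (key_le 1) (rd (tm s) 0 (iv s vN)) /\
  (0 <= iv s vi <= iv s vN)%Z /\ (0 <= iv s vc <= iv s vi)%Z /\
  Permutation (rd (tm s) (iv s vN) (iv s vc))
    (filter (alive (rv s rR) (rv s rT) (rv s rX)) (rd (tm s) 0 (iv s vi))) /\
  (forall c, In c (rd (tm s) 0 (iv s vi)) -> q1 c <= rv s rX) /\
  ((iv s vi < iv s vN)%Z -> rv s rX < q1 (tm s (iv s vi))) /\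
  sound M s.

Lemma filter_filter (f g : point -> bool) l :
  filter f (filter g l) = filter (fun c => andb (g c) (f c)) l.
Proof.
  induction l as [|a l IH]; cbn; [ auto | ]. destruct (g a); cbn; [ | auto ].
  destruct (f a); rewrite IH; auto.
Qed.

Lemma Permutation_filter' (f : point -> bool) l l' :
  Permutation l l' -> Permutation (filter f l) (filter f l').
Proof.
  induction 1; cbn; repeat match goal with |- context [f ?a] => destruct (f a) end; auto.
  - constructor.
  - etransitivity; eauto.
Qed.

(** Intervals shrink as the column moves right, so a customer once discarded need not be looked at
    again: the new list comes from the old one and the newcomers. *)
Lemma alive_advance r th x x' l1 l2 :
  x <= x' ->
  filter (alive r th x') (l1 ++ l2) =
  filter (wide r x') (filter (alive r th x) l1 ++ filter (small th) l2).
Proof.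
  intros H. rewrite !filter_app, !filter_filter. f_equal.
  apply filter_ext. intros c. destruct (alive r th x' c) eqn:E; symmetry.
  - apply alive_true in E. apply andb_true_intro. rewrite alive_true, wide_true. lra.
  - apply Bool.not_true_iff_false. intros K. apply andb_prop in K as [K1 K2].
    apply Bool.not_true_iff_false in E. apply E. apply alive_true in K1. apply wide_true in K2.
    apply alive_true. lra.
Qed.

Lemma column_spec M lg s0 :
  column_inv M s0 -> 0 < rv s0 rR -> 0 < rv s0 rD -> (iv s0 vi < iv s0 vN)%Z ->
  (0 <= lg)%Z -> (iv s0 vN <= 2 ^ lg)%Z ->
  wp column (fun t s =>
    column_inv M s /\
    (t <= 3000 * (iv s0 vc + (iv s vi - iv s0 vi) + 1) * (lg + 1))%Z /\
    (iv s0 vi < iv s vi)%Z /\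
    rd (tm s) 0 (iv s0 vN) = rd (tm s0) 0 (iv s0 vN) /\
    rv s rX = q1 (tm s0 (iv s0 vi)) + rv s0 rD /\
    rv s0 rV <= rv s rV /\
    reached M (rv s0 rR) (rv s0 rT) (rv s rX) (rv s rV)) s0.
Proof.
  intros (HM & HS & Hi & Hc & HW & HQ & HN & Hsnd) Hr HD Hlt Hlg Hpow.
  set (n := iv s0 vN) in *. set (m0 := tm s0) in *.
  set (r := rv s0 rR) in *. set (th := rv s0 rT) in *. set (i0 := iv s0 vi) in *.
  set (x := rv s0 rX) in *. set (c0 := iv s0 vc) in *.
  set (x' := q1 (m0 i0) + rv s0 rD).
  assert (Hxx : x <= x') by (specialize (HN Hlt); unfold x'; lra).
  apply wp_seq, wp_setr; [ simp; fold i0; lia | ].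
  simp. change (comp (tm s0 (iv s0 vi)) 1 + rv s0 rD) with x'.
  apply wp_seq. eapply wp_call; [ apply add_loop_spec; simp; fold n i0 c0; lia | ].
  simp. fold n m0 r th i0 x c0.
  intros t1 s1 F1 (T1 & I1 & C1 & W1 & X1 & Q1 & N1). simp_in F1.
  set (i1 := iv s1 vi) in *. set (c1 := iv s1 vc) in *.
  (* The column lies strictly to the right of the next customer, so at least that one is
     consumed. *)
  assert (Hprog : (i0 < i1)%Z).
  { destruct (Z_lt_dec i0 i1) as [H | H]; [ auto | ]. replace i1 with i0 in N1 by lia.
    specialize (N1 Hlt). unfold x' in N1. lra. }
  apply wp_seq, wp_seti, wp_seq, wp_seti, wp_seq.
  eapply wp_call; [ apply filter_loop_spec; simp; frame F1; simp; fold n c1; first [ lia | reflexivity ] | ].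
  simp. frame F1. simp. fold n r th c1.
  intros t2 s2 F2 (T2 & C2 & W2 & X2).
  set (c2 := iv s2 vt) in *.
  apply wp_seq, wp_seti, wp_seq, wp_seti, wp_seq, wp_seti, wp_seq, wp_seti, wp_seq. simp.
  eapply wp_call; [ apply (merge_sort_spec 2 lg); simp; frame F2; simp; frame F1; simp; fold n c2; lia | ].
  simp. frame F2. simp. frame F1. simp. fold n c2.
  intros t3 s3 F3 (T3 & S3 & P3 & X3).
  apply wp_seq, wp_seti, wp_seq. simp.
  eapply wp_call; [ apply (copy_loop_spec vS vB); simp; frame F3; simp; frame F2; simp; frame F1; simp;
     fold n c2; first [ lia | auto ] | ].
  simp. frame F3. simp. frame F2. simp. frame F1. simp. fold n c2.
  intros t4 s4 F4 (T4 & E4 & X4).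
  apply wp_seq, wp_seti, wp_seq, wp_seti, wp_seq. simp.
  eapply wp_call; [ apply (merge_sort_spec 0 lg); simp; frame F4; simp; frame F3; simp; frame F2; simp;
     frame F1; simp; fold n c2; lia | ].
  simp. frame F4. simp. frame F3. simp. frame F2. simp. frame F1. simp. fold n c2.
  intros t5 s5 F5 (T5 & S5 & P5 & X5).
  apply wp_seq, wp_seti, wp_seq, wp_seti. simp.
  assert (Esplit : rd m0 0 i1 = rd m0 0 i0 ++ rd m0 i0 (i1 - i0)).
  { replace i1 with (i0 + (i1 - i0))%Z at 1 by lia. now rewrite rd_app, Z.add_0_l by lia. }
  assert (EM : rd m0 0 n = rd m0 0 i1 ++ rd m0 i1 (n - i1)).
  { replace n with (i1 + (n - i1))%Z at 1 by lia. now rewrite rd_app, Z.add_0_l by lia. }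
  assert (HT1 : forall c, In c (rd m0 0 i1) -> q1 c <= x').
  { intros c Hin. rewrite Esplit in Hin. apply in_app_or in Hin as [Hin | Hin]; [ | auto ].
    specialize (HQ c Hin). lra. }
  assert (HT2 : forall c, In c (rd m0 i1 (n - i1)) -> x' < q1 c).
  { intros c Hin. apply rd_in in Hin as (k & Hk & ->). specialize (N1 ltac:(lia)).
    pose proof (sorted_rd 1 m0 0 n i1 (i1 + k) HS ltac:(lia) ltac:(lia)) as Hle.
    rewrite !Z.add_0_l in Hle. change (q1 (m0 i1) <= q1 (m0 (i1 + k)%Z)) in Hle. lra. }
  assert (EW : rd (tm s5) n c2 = rd (tm s3) n c2).
  { apply rd_ext. intros k Hk. rewrite X5, X4 by lia. reflexivity. }
  assert (PW : Permutation (rd (tm s5) n c2) (filter (alive r th x') (rd m0 0 i1))).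
  { rewrite EW, <- P3, W2, W1, Esplit, (alive_advance r th x x') by auto.
    apply Permutation_filter', Permutation_app_tail, HW. }
  assert (PV : Permutation (rd (tm s5) n c2) (rd (tm s5) (n + n) c2)).
  { now rewrite EW, <- E4. }
  assert (E0 : rd (tm s5) 0 n = rd m0 0 n).
  { apply rd_ext. intros k Hk. rewrite X5, X4, X3, X2, X1 by lia. reflexivity. }
  assert (Ei : forall k, (0 <= k < n)%Z -> tm s5 k = m0 k).
  { intros k Hk. rewrite X5, X4, X3, X2, X1 by lia. reflexivity. }
  rewrite <- EW in S3.
  assert (HM1 : Permutation M (rd m0 0 i1 ++ rd m0 i1 (n - i1))) by now rewrite <- EM.
  (* Instantiated before use, so that the registers in the specification can be traced back to [s0];
     13 and 15 are [vj] and [vu]. *)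
  pose proof (sweep_loop_spec M (assignI (assignI s5 13 0) 15 0)) as Sp. cbv zeta in Sp.
  simp_in Sp. frame F5. simp_in Sp. frame F4. simp_in Sp. frame F3. simp_in Sp.
  frame F2. simp_in Sp. frame F1. simp_in Sp.
  fold n c2 r in Sp.
  eapply wp_call; [ apply Sp; clear Sp; try lia; auto | clear Sp ].
  { intros j Hj. eapply gain_sound with (T1 := rd m0 0 i1); eauto. lra. }
  { unfold sound in *. simp. frame F5. simp. frame F4. simp. frame F3. simp.
    frame F2. simp. frame F1. simp. exact Hsnd. }
  intros t6 s6 F6 (T6 & E6 & Snd & V6 & G6). rewrite E6.
  frame F6. simp. frame F5. simp. frame F4. simp. frame F3. simp.
  frame F2. simp. frame F1. simp. fold n c2 r th i1.
  assert (V6' : rv s0 rV <= rv s6 rV) by exact V6.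
  split; [ | split; [ | split; [ exact Hprog | split; [ exact E0 | split; [ reflexivity |
    split; [ exact V6' | ] ] ] ] ] ].
  - unfold column_inv. rewrite E6. frame F6. simp. frame F5. simp. frame F4. simp. frame F3. simp.
    frame F2. simp. frame F1. simp. fold n c2 r th i1.
    rewrite E0. split; [ exact HM | ]. split; [ exact HS | ]. split; [ lia | ]. split; [ lia | ].
    replace (rd (tm s5) 0 i1) with (rd m0 0 i1) by (apply rd_ext; intros k Hk; symmetry; apply Ei; lia).
    split; [ exact PW | ]. split; [ exact HT1 | ]. split; [ | exact Snd ].
    intros H. rewrite Ei by lia. auto.
  - assert (Hmul : (500 * (c2 + 1) * (lg + 1) <= 500 * (c0 + (i1 - i0) + 1) * (lg + 1))%Z)
      by (apply Z.mul_le_mono_nonneg_r; lia).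
    assert (Hone : (c0 + (i1 - i0) + 1 <= (c0 + (i1 - i0) + 1) * (lg + 1))%Z) by nia.
    lia.
  - apply gain_complete with (T1 := rd m0 0 i1) (T2 := rd m0 i1 (n - i1)) (m := tm s5) (b := n)
      (k := c2) (V := rd (tm s5) (n + n) c2); auto; try lia; [ lra | ].
    destruct Snd as [? ?]. lra.
Qed.

(** * Amortised cost of the columns for one margin *)

Fixpoint sumf (f : point -> R) (l : list point) : R :=
  match l with [] => 0 | c :: l' => f c + sumf f l' end.

Lemma sumf_app f l l' : sumf f (l ++ l') = sumf f l + sumf f l'.
Proof. induction l as [|c l IH]; cbn; [ | rewrite IH ]; ring. Qed.

Lemma sumf_perm f l l' : Permutation l l' -> sumf f l = sumf f l'.
Proof. induction 1; cbn; lra. Qed.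

Lemma sumf_filter f p l : sumf f (filter p l) = sumf (fun c => if p c then f c else 0) l.
Proof. induction l as [|c l IH]; cbn; [ auto | ]. destruct (p c); cbn; rewrite IH; ring. Qed.

Lemma sumf_le f g l : (forall c, In c l -> f c <= g c) -> sumf f l <= sumf g l.
Proof.
  induction l as [|c l IH]; cbn; intros H; [ lra | ].
  pose proof (H c (or_introl eq_refl)). assert (sumf f l <= sumf g l) by auto. lra.
Qed.

Lemma sumf_plus f g l : sumf (fun c => f c + g c) l = sumf f l + sumf g l.
Proof. induction l as [|c l IH]; cbn; [ | rewrite IH ]; ring. Qed.

Lemma sumf_nonneg f l : (forall c, In c l -> 0 <= f c) -> 0 <= sumf f l.
Proof.
  induction l as [|c l IH]; cbn; intros H; [ lra | ].
  pose proof (H c (or_introl eq_refl)). assert (0 <= sumf f l) by auto. lra.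
Qed.

Lemma sumf_const a l : sumf (fun _ => a) l = a * INR (length l).
Proof. induction l as [|c l IH]; cbn [sumf length]; [ cbn | rewrite IH, S_INR ]; ring. Qed.

(* Upper bound on the number of columns, at least [r / N] apart, that an alive customer
   still meets, the current one included *)
Definition life (N r x : R) (c : point) : R := (pr c - q2 c - r - x) * N / r + 1.

(** The credit that a customer brings into a scan. Outside the range from [r] to [th] it never
    becomes alive, hence the zeros. *)
Definition weight (N r th : R) (c : point) : R :=
  if Rle_dec r (margin c) then if Rle_dec (margin c) th then N * margin c / r else 0 else 0.

Lemma weight_nonneg N r th c : 0 < r -> 0 <= N -> 0 <= weight N r th c.
Proof.
  intros Hr HN. unfold weight. destruct (Rle_dec _ _); [ | lra ]. destruct (Rle_dec _ _); [ | lra ].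
  apply Rmult_le_pos; [ apply Rmult_le_pos; lra | left; now apply Rinv_0_lt_compat ].
Qed.

Lemma life_alive N r th x c :
  0 < r -> 0 <= N -> alive r th x c = true -> 1 <= life N r x c.
Proof.
  intros Hr HN A. apply alive_true in A. unfold life.
  assert (0 <= (pr c - q2 c - r - x) * N / r); [ | lra ].
  apply Rmult_le_pos; [ apply Rmult_le_pos; lra | left; now apply Rinv_0_lt_compat ].
Qed.

(** Moving by [r / N] takes at least 1 from [life], and a customer that drops out had at least 1
    left: each alive customer pays for its column. *)
Lemma life_step N r th x x' c :
  0 < r -> 0 < N -> x + r / N <= x' ->
  (if alive r th x' c then life N r x' c else 0) + (if alive r th x c then 1 else 0) <=
  (if alive r th x c then life N r x c else 0).
Proof.
  intros Hr HN Hx.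
  assert (Hd : 0 < r / N) by (apply Rdiv_lt_0_compat; lra).
  destruct (alive r th x' c) eqn:A'.
  - assert (A : alive r th x c = true) by (apply alive_true in A'; apply alive_true; lra).
    rewrite A.
    assert (life N r x c - life N r x' c = (x' - x) * (N / r)) by (unfold life; field; lra).
    assert (1 <= (x' - x) * (N / r)); [ | lra ].
    replace 1 with (r / N * (N / r)) by (field; lra).
    apply Rmult_le_compat_r; [ left; apply Rdiv_lt_0_compat | ]; lra.
  - destruct (alive r th x c) eqn:A; [ | lra ].
    pose proof (life_alive N r th x c Hr ltac:(lra) A). lra.
Qed.

(** On entry [x] is at least [q1 c], so the interval is no longer than [margin c - r]; the
    subtracted [r] contributes N >= 1 and absorbs the final 1 of [life]. *)
Lemma life_new N r th x c :
  0 < r -> 1 <= N -> q1 c <= x ->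
  (if alive r th x c then life N r x c else 0) <= weight N r th c.
Proof.
  intros Hr HN Hq. destruct (alive r th x c) eqn:A; [ | apply weight_nonneg; lra ].
  apply alive_true in A. unfold weight, life, margin in *.
  destruct (Rle_dec _ _); [ | lra ]. destruct (Rle_dec _ _); [ | lra ].
  apply Rmult_le_reg_r with r; [ auto | ].
  replace (((pr c - q2 c - r - x) * N / r + 1) * r) with ((pr c - q2 c - r - x) * N + r) by (field; lra).
  replace (N * (pr c - q1 c - q2 c) / r * r) with (N * (pr c - q1 c - q2 c)) by (field; lra).
  nra.
Qed.

(** The amortised inequality of one column: old members pay from their [life], newcomers bring their
    [weight]. *)
Lemma life_column N r th x x' l1 l2 W W' :
  0 < r -> 1 <= N -> x + r / N <= x' ->
  Permutation W (filter (alive r th x) l1) ->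
  Permutation W' (filter (alive r th x') (l1 ++ l2)) ->
  (forall c, In c l2 -> q1 c <= x') ->
  sumf (life N r x') W' + INR (length W) <= sumf (life N r x) W + sumf (weight N r th) l2.
Proof.
  intros Hr HN Hx HW HW' H2.
  rewrite (sumf_perm _ _ _ HW), (sumf_perm _ _ _ HW'), (Permutation_length HW).
  rewrite filter_app, sumf_app, !sumf_filter.
  assert (E : INR (length (filter (alive r th x) l1)) =
    sumf (fun c => if alive r th x c then 1 else 0) l1).
  { rewrite <- sumf_filter, sumf_const. ring. }
  rewrite E.
  assert (A1 := sumf_le _ _ l1 (fun c _ => life_step N r th x x' c Hr ltac:(lra) Hx)).
  rewrite sumf_plus in A1.
  assert (A2 := sumf_le _ _ l2 (fun c Hc => life_new N r th x' c Hr HN (H2 c Hc))).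
  lra.
Qed.

Definition scan : cmd :=
  CSetI vi (ACst 0) ;; CSetI vc (ACst 0) ;;
  CSetR rX (RMns (RGet 1 $vi) (RInt (ACst 1))) ;;
  CWhile (BLt $vi $vN) column.

Lemma reached_mono M r th x v v' : v <= v' -> reached M r th x v -> reached M r th x v'.
Proof. intros H R1 y. specialize (R1 y). lra. Qed.

Definition covered (M : market) (N r th v : R) : Prop :=
  forall c, In c M -> exists x, q1 c <= x <= q1 c + r / N /\ reached M r th x v.

Lemma covered_mono M N r th v v' : v <= v' -> covered M N r th v -> covered M N r th v'.
Proof.
  intros H K c Hc. destruct (K c Hc) as (x & Hx & Rx). exists x. eauto using reached_mono.
Qed.

Lemma rd_Z_length m b k : (0 <= k)%Z -> INR (length (rd m b k)) = IZR k.
Proof. intros H. rewrite INR_IZR_INZ, rd_length by auto. reflexivity. Qed.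

Lemma rd_inj m m' b n : rd m b n = rd m' b n -> forall k, (b <= k < b + n)%Z -> m k = m' k.
Proof.
  intros E k Hk. unfold rd in E.
  apply (f_equal (fun l => nth_error l (Z.to_nat (k - b)))) in E.
  rewrite !nth_error_map, !nth_error_nth' with (d := 0%nat) in E by (rewrite length_seq; lia).
  cbn [option_map] in E. rewrite seq_nth in E by lia. injection E as E.
  replace (b + Z.of_nat (Z.to_nat (k - b)))%Z with k in E by lia. exact E.
Qed.

Lemma scan_spec M (N : R) lg s0 :
  Permutation M (rd (tm s0) 0 (iv s0 vN)) ->
  StronglySorted (key_le 1) (rd (tm s0) 0 (iv s0 vN)) ->
  sound M s0 -> 0 < rv s0 rR -> 1 <= N -> rv s0 rD = rv s0 rR / N ->
  (0 <= iv s0 vN)%Z -> (0 <= lg)%Z -> (iv s0 vN <= 2 ^ lg)%Z ->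
  wp scan (fun t s =>
    IZR t <= 4000 * IZR (lg + 1) *
      (sumf (weight N (rv s0 rR) (rv s0 rT)) (rd (tm s0) 0 (iv s0 vN)) + 2 * IZR (iv s0 vN)) + 100 /\
    rd (tm s) 0 (iv s0 vN) = rd (tm s0) 0 (iv s0 vN) /\
    sound M s /\ rv s0 rV <= rv s rV /\
    covered M N (rv s0 rR) (rv s0 rT) (rv s rV)) s0.
Proof.
  intros HM HS Hsnd Hr HN HD Hn Hlg Hpow.
  set (n := iv s0 vN) in *. set (T := rd (tm s0) 0 n) in *.
  set (r := rv s0 rR) in *. set (th := rv s0 rT) in *.
  assert (HD0 : 0 < r / N) by (apply Rdiv_lt_0_compat; lra).
  assert (HL : 1 <= IZR (lg + 1)) by (apply IZR_le; lia).
  apply wp_seq, wp_seti, wp_seq, wp_seti, wp_seq, wp_setr; [ simp; lia | ]. simp.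
  apply wp_while with
    (Inv := fun s => column_inv M s /\ rd (tm s) 0 n = T /\ rv s0 rV <= rv s rV /\
      (forall c, In c (rd (tm s) 0 (iv s vi)) -> exists x, q1 c <= x <= q1 c + r / N /\
          reached M r th x (rv s rV)))
    (* Alive customers carry their [life] and unread ones their [weight]. The extra 2 per unread
       customer pays for reading it and for the constant overhead of a column, which reads at least
       one. *)
    (phi := fun s => 4000 * IZR (lg + 1) *
      (sumf (life N r (rv s rX)) (rd (tm s) n (iv s vc)) +
       sumf (weight N r th) (rd (tm s) (iv s vi) (n - iv s vi)) + 2 * IZR (n - iv s vi))).
  - unfold column_inv. simp. fold n T. rewrite !(rd_nil _ _ 0) by lia.
    split; [ | split; [ reflexivity | split; [ apply Rle_refl | intros c [] ] ] ].
    do 4 (split; [ first [ assumption | lia ] | ]).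
    split; [ reflexivity | ]. split; [ intros c [] | ]. split; [ | exact Hsnd ].
    (* The initial column is placed 1 below the first customer so that the invariant holds before
       anything is read. *)
    intros _. change (q1 (tm s0 0%Z) - 1 < q1 (tm s0 0%Z)). lra.
  - intros s (I1 & I2 & I3 & I4) F. simp. split; [ auto | ]. frame F. simp_in F.
    destruct I1 as (J1 & J2 & J3 & J4 & J5 & J6 & J7 & J8). frame F. simp_in J3. simp_in J4. simp_in J5.
    fold n r th in J3, J4, J5.
    apply Rmult_le_pos; [ lra | ].
    assert (0 <= sumf (life N r (rv s rX)) (rd (tm s) n (iv s vc))).
    { rewrite (sumf_perm _ _ _ J5). apply sumf_nonneg. intros c Hc. apply filter_In in Hc as [_ Hc].
      pose proof (life_alive N r th _ c Hr ltac:(lra) Hc). lra. }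
    assert (0 <= sumf (weight N r th) (rd (tm s) (iv s vi) (n - iv s vi))).
    { apply sumf_nonneg. intros c _. apply weight_nonneg; lra. }
    assert (0 <= IZR (n - iv s vi)) by (apply IZR_le; lia). lra.
  - intros s (I1 & I2 & I3 & I4) F D. simp_in D. frame F. simp_in F. simp_in D.
    assert (I1' := I1).
    destruct I1' as (J1 & J2 & J3 & J4 & J5 & J6 & J7 & J8). frame F.
    simp_in J1. simp_in J2. simp_in J3. simp_in J4. simp_in J5. simp_in J7.
    fold n r th in J1, J2, J3, J4, J5, J7, D.
    eapply wp_call; [ apply (column_spec M lg s I1); frame F; simp; fold n r; auto; rewrite HD; auto | ].
    intros t s1 F1 (K1 & T1 & K2 & K3 & K4 & K5 & K6). frame F1. frame F. simp_in K3. simp_in K4. simp_in K6.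
    fold n r th in K3, K4, K6.
    assert (K1' := K1).
    destruct K1' as (L1 & L2 & L3 & L4 & L5 & L6 & L7 & L8). frame F1. frame F. simp_in L3. simp_in L4. simp_in L5.
    fold n r th in L3, L4, L5.
    assert (Em : forall k, (0 <= k < n)%Z -> tm s1 k = tm s k).
    { intros k Hk. apply (rd_inj _ _ 0 n K3 k). lia. }
    set (i := iv s vi) in *. set (i1 := iv s1 vi) in *.
    assert (Esplit : rd (tm s1) 0 i1 = rd (tm s) 0 i ++ rd (tm s) i (i1 - i)).
    { replace i1 with (i + (i1 - i))%Z at 1 by lia. rewrite rd_app, Z.add_0_l by lia.
      f_equal; apply rd_ext; intros k Hk; apply Em; lia. }
    split; [ split; [ exact K1 | split; [ | split; [ lra | ] ] ] | ].
    + rewrite K3. exact I2.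
    + intros c Hc. assert (Hcx := L6 c Hc). rewrite Esplit in Hc. apply in_app_or in Hc as [Hc | Hc].
      * destruct (I4 c Hc) as (x & Hx & Rx). exists x. split; [ exact Hx | ].
        apply reached_mono with (rv s rV); auto.
      * exists (rv s1 rX). split; [ split; [ exact Hcx | ] | exact K6 ].
        rewrite K4, HD. apply rd_in in Hc as (k & Hk & ->).
        pose proof (sorted_rd 1 (tm s) 0 n i (i + k) J2 ltac:(lia) ltac:(lia)) as Hle.
        rewrite !Z.add_0_l in Hle. change (q1 (tm s i) <= q1 (tm s (i + k)%Z)) in Hle. lra.
    + assert (Hx : rv s rX + r / N <= rv s1 rX).
      { rewrite K4, HD. specialize (J7 D). lra. }
      assert (Hlife := life_column N r th (rv s rX) (rv s1 rX) (rd (tm s) 0 i) (rd (tm s) i (i1 - i))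
        (rd (tm s) n (iv s vc)) (rd (tm s1) n (iv s1 vc)) Hr HN Hx J5).
      rewrite <- Esplit in Hlife. specialize (Hlife L5).
      rewrite rd_Z_length in Hlife by lia.
      assert (Hq : forall c, In c (rd (tm s) i (i1 - i)) -> q1 c <= rv s1 rX).
      { intros c Hc. apply L6. rewrite Esplit. apply in_or_app. auto. }
      specialize (Hlife Hq).
      assert (Erest : rd (tm s) i (n - i) = rd (tm s) i (i1 - i) ++ rd (tm s1) i1 (n - i1)).
      { replace (n - i)%Z with (i1 - i + (n - i1))%Z by lia. rewrite rd_app by lia. f_equal.
        replace (i + (i1 - i))%Z with i1 by lia.
        apply rd_ext; intros k Hk; symmetry; apply Em; lia. }
      rewrite Erest, sumf_app.
      assert (Hd : 1 <= IZR (i1 - i)) by (apply IZR_le; lia).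
      assert (Hc0 : 0 <= IZR (iv s vc)) by (apply IZR_le; lia).
      assert (Ht : IZR (t + costB (BLt $vi $vN) + 3) <=
        IZR (lg + 1) * (3000 * (IZR (iv s vc) + IZR (i1 - i) + 1)) + 11).
      { apply IZR_le in T1. rewrite !mult_IZR, !plus_IZR in T1. simp.
        rewrite !plus_IZR. replace (IZR lg + IZR 1) with (IZR lg + 1) in T1 by auto. lra. }
      set (Sw := sumf (life N r (rv s rX)) (rd (tm s) n (iv s vc))) in *.
      set (Sw1 := sumf (life N r (rv s1 rX)) (rd (tm s1) n (iv s1 vc))) in *.
      set (Sn := sumf (weight N r th) (rd (tm s) i (i1 - i))) in *.
      set (Sr := sumf (weight N r th) (rd (tm s1) i1 (n - i1))).
      assert (Hn' : IZR (n - i) = IZR (i1 - i) + IZR (n - i1)) by (rewrite <- plus_IZR; f_equal; lia).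
      assert (Hmul : 0 <= IZR (lg + 1) * (Sw + Sn - Sw1 - IZR (iv s vc))) by (apply Rmult_le_pos; lra).
      assert (Hmul2 : 0 <= (IZR (lg + 1) - 1) * (IZR (i1 - i) - 1)) by (apply Rmult_le_pos; lra).
      assert (Hmul3 : 0 <= IZR (lg + 1) * IZR (iv s vc)) by (apply Rmult_le_pos; lra).
      rewrite Hn'. nra.
  - intros t s (I1 & I2 & I3 & I4) F D Ht. simp_in D. simp_in Ht. frame F. simp_in F. simp_in D. fold n in D.
    destruct I1 as (J1 & J2 & J3 & J4 & J5 & J6 & J7 & J8). frame F. simp_in J1. simp_in J3.
    fold n in J1, J3. assert (E : iv s vi = n) by lia.
    simp. split; [ | split; [ exact I2 | split; [ exact J8 | split; [ exact I3 | ] ] ] ].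
    + assert (0 <= 4000 * IZR (lg + 1) *
       (sumf (life N r (rv s rX)) (rd (tm s) n (iv s vc)) +
        sumf (weight N r th) (rd (tm s) (iv s vi) (n - iv s vi)) + 2 * IZR (n - iv s vi))).
      { apply Rmult_le_pos; [ lra | ].
        assert (0 <= sumf (life N r (rv s rX)) (rd (tm s) n (iv s vc))).
        { simp_in J5. fold n r th in J5.
          rewrite (sumf_perm _ _ _ J5). apply sumf_nonneg. intros c Hc. apply filter_In in Hc as [_ Hc].
          pose proof (life_alive N r th _ c Hr ltac:(lra) Hc). lra. }
        assert (0 <= sumf (weight N r th) (rd (tm s) (iv s vi) (n - iv s vi))).
        { apply sumf_nonneg. intros c _. apply weight_nonneg; lra. }
        assert (0 <= IZR (n - iv s vi)) by (apply IZR_le; lia). lra. }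
      rewrite !(rd_nil _ _ 0), !Z.sub_0_r in Ht by lia. cbn [sumf] in Ht. fold T in Ht.
      rewrite !plus_IZR in *. lra.
    + intros c Hc. apply I4. rewrite E. apply (Permutation_in _ J1 Hc).
Qed.

(** * Geometric search over the margin *)

(* Cost, divided by the cost of one column per customer, of all the scans with margins below [r] *)
Definition future (N r : R) (c : point) : R :=
  if Rle_dec (margin c) 0 then 0
  else Rmax 0 (72 * N * N * (N + 1) - N * (N + 1) * margin c / r).

Lemma future_nonneg N r c : 0 <= future N r c.
Proof. unfold future. destruct (Rle_dec _ _); [ lra | apply Rmax_l ]. Qed.

Lemma future_le N r c : 0 < r -> 1 <= N -> future N r c <= 72 * N * N * (N + 1).
Proof.
  intros Hr HN. assert (0 <= 72 * N * N * (N + 1)) by (repeat apply Rmult_le_pos; lra).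
  unfold future. destruct (Rle_dec _ _); [ lra | ]. apply Rmax_lub; [ lra | ].
  assert (0 <= N * (N + 1) * margin c / r); [ | lra ].
  apply Rmult_le_pos; [ repeat apply Rmult_le_pos; lra | left; now apply Rinv_0_lt_compat ].
Qed.

(** The sum over the progression telescopes: dividing [r] by 1 + 1/N raises
    [N * (N + 1) * margin c / r] by exactly [N * margin c / r]. The offset [72 * N * N * (N + 1)] is
    the value at the cut, where the margin is [72 * N * r]. *)
Lemma future_step N r c :
  0 < r -> 1 <= N ->
  weight N r (72 * N * r) c + future N r c <= future N (r * (N + 1) / N) c.
Proof.
  intros Hr HN. unfold weight, future.
  destruct (Rle_dec (margin c) 0) as [H0 | H0].
  { destruct (Rle_dec _ _); lra. }
  assert (E : N * (N + 1) * margin c / (r * (N + 1) / N) =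
    N * (N + 1) * margin c / r - N * margin c / r) by (field; lra).
  rewrite E.
  assert (H1 : 0 <= N * margin c / r)
    by (apply Rmult_le_pos; [ apply Rmult_le_pos; lra | left; now apply Rinv_0_lt_compat ]).
  set (G := 72 * N * N * (N + 1)). set (A := N * (N + 1) * margin c / r) in *.
  set (B := N * margin c / r) in *.
  assert (Hmono : Rmax 0 (G - A) <= Rmax 0 (G - (A - B))).
  { apply Rmax_lub; [ apply Rmax_l | ]. eapply Rle_trans; [ | apply Rmax_r ]. lra. }
  destruct (Rle_dec _ _) as [H2 | ]; [ | lra ].
  destruct (Rle_dec _ _) as [H3 | ]; [ | lra ].
  (* Below the cut the maximum with 0 is inactive at [r], so the whole difference is available. *)
  assert (H4 : A <= G).
  { unfold A, G. apply Rmult_le_reg_r with r; [ auto | ].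
    replace (N * (N + 1) * margin c / r * r) with (N * (N + 1) * margin c) by (field; lra).
    replace (72 * N * N * (N + 1) * r) with (N * (N + 1) * (72 * N * r)) by ring.
    apply Rmult_le_compat_l; [ apply Rmult_le_pos; lra | auto ]. }
  rewrite Rmax_right by lra. eapply Rle_trans; [ | apply Rmax_r ]. lra.
Qed.

(** From 1 + z <= exp z at z = -1/(N+1). It makes [(N + 1) * ln] a counter for the steps of the
    progression, which pays the fixed cost of each scan. *)
Lemma ln_step N a : 0 < a -> 1 <= N -> (N + 1) * ln (a * N / (N + 1)) + 1 <= (N + 1) * ln a.
Proof.
  intros Ha HN.
  assert (H1 : N / (N + 1) <= exp (- / (N + 1))).
  { pose proof (exp_ineq1_le (- / (N + 1))). replace (N / (N + 1)) with (1 + - / (N + 1)) by (field; lra).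
    auto. }
  assert (Hp : 0 < N / (N + 1)) by (apply Rdiv_lt_0_compat; lra).
  replace (a * N / (N + 1)) with (a * (N / (N + 1))) by (field; lra).
  rewrite ln_mult by auto.
  assert (H2 : ln (N / (N + 1)) <= - / (N + 1)).
  { rewrite <- (ln_exp (- / (N + 1))). destruct H1 as [H1 | ->]; [ left; apply ln_increasing; auto | lra ]. }
  assert ((N + 1) * ln (N / (N + 1)) <= (N + 1) * (- / (N + 1))) by (apply Rmult_le_compat_l; lra).
  replace ((N + 1) * (- / (N + 1))) with (-1) in H by (field; lra). lra.
Qed.

Definition search (N : Z) : cmd :=
  CWhile (BNot (BRLt (RTms (RTms (RInt (ACst 8)) (RInt $vN)) (RVar rR)) (RVar rM)))
    (CSetR rR (RQuo (RTms (RVar rR) (RInt (ACst N))) (RInt (ACst (N + 1)))) ;;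
     CSetR rD (RQuo (RVar rR) (RInt (ACst N))) ;;
     CSetR rT (RTms (RInt (ACst (72 * N))) (RVar rR)) ;;
     scan).

(** The margin [r] found for [m] satisfies [r <= m N/(N+1)], which leaves [r / N] for rounding [q1],
    and is at least [m (N/(N+1))^2]. *)
Lemma search_spec M N lg s0 :
  Permutation M (rd (tm s0) 0 (iv s0 vN)) ->
  StronglySorted (key_le 1) (rd (tm s0) 0 (iv s0 vN)) ->
  sound M s0 -> 0 < rv s0 rM -> rv s0 rR = rv s0 rM -> (1 <= N)%Z ->
  (1 <= iv s0 vN)%Z -> (0 <= lg)%Z -> (iv s0 vN <= 2 ^ lg)%Z ->
  wp (search N) (fun t s =>
    IZR t <= 4000 * IZR (lg + 1) *
      (IZR (iv s0 vN) * (72 * IZR N * IZR N * (IZR N + 1)) +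
       (IZR N + 1) * ln (16 * IZR (iv s0 vN)) * (2 * IZR (iv s0 vN) + 1)) + 30 /\
    sound M s /\
    (forall m, rv s0 rM <= 4 * IZR (iv s0 vN) * m -> m <= rv s0 rM ->
       exists r, 0 < r /\ r * (IZR N + 1) <= m * IZR N /\
         m * IZR N * IZR N <= r * (IZR N + 1) * (IZR N + 1) /\
         covered M (IZR N) r (72 * IZR N * r) (rv s rV))) s0.
Proof.
  intros HM HS Hsnd HrM Er HN Hn Hlg Hpow.
  set (n := iv s0 vN) in *. set (T := rd (tm s0) 0 n) in *. set (m1 := rv s0 rM) in *.
  assert (HNr : 1 <= IZR N) by (apply IZR_le; lia).
  assert (Hnr : 1 <= IZR n) by (apply IZR_le; lia).
  assert (HL : 1 <= IZR (lg + 1)) by (apply IZR_le; lia).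
  assert (EN1 : IZR (N + 1) = IZR N + 1) by apply plus_IZR.
  assert (EN72 : IZR (72 * N) = 72 * IZR N) by apply mult_IZR.
  assert (Hph : forall r, 0 < r -> m1 <= 16 * IZR n * r ->
    0 <= 4000 * IZR (lg + 1) * (sumf (future (IZR N) r) T +
       (IZR N + 1) * ln (16 * IZR n * r / m1) * (2 * IZR n + 1))).
  { intros r Hr Hrm. apply Rmult_le_pos; [ lra | ].
    assert (0 <= sumf (future (IZR N) r) T) by (apply sumf_nonneg; intros; apply future_nonneg).
    assert (0 <= ln (16 * IZR n * r / m1)).
    { rewrite <- ln_1.
      assert (H1 : 1 <= 16 * IZR n * r / m1).
      { apply Rmult_le_reg_r with m1; [ auto | ].
        replace (16 * IZR n * r / m1 * m1) with (16 * IZR n * r) by (field; lra). lra. }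
      destruct H1 as [H1 | <-]; [ left; apply ln_increasing; lra | lra ]. }
    assert (0 <= (IZR N + 1) * ln (16 * IZR n * r / m1) * (2 * IZR n + 1))
      by (repeat apply Rmult_le_pos; lra). lra. }
  apply wp_while with
    (Inv := fun s => rd (tm s) 0 n = T /\ sound M s /\ 0 < rv s rR <= m1 /\
      (* A round starts with [m1 <= 8 n r] and at most halves [r]. The bound keeps the logarithm in
         the potential nonnegative. *)
      m1 <= 16 * IZR n * rv s rR /\
      (forall m, rv s rR * (IZR N + 1) <= m * IZR N -> m <= m1 ->
       exists r, 0 < r /\ r * (IZR N + 1) <= m * IZR N /\
         m * IZR N * IZR N <= r * (IZR N + 1) * (IZR N + 1) /\
         covered M (IZR N) r (72 * IZR N * r) (rv s rV)))
    (phi := fun s => 4000 * IZR (lg + 1) * (sumf (future (IZR N) (rv s rR)) T +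
       (IZR N + 1) * ln (16 * IZR n * rv s rR / m1) * (2 * IZR n + 1))).
  - rewrite Er. split; [ reflexivity | ]. split; [ exact Hsnd | ]. split; [ lra | ]. split; [ nra | ].
    (* Vacuous at the start: no [m] up to [m1] lies a factor 1 + 1/N above [r = m1]. *)
    intros m H1 H2. nra.
  - intros s (I1 & I2 & I3 & I4 & I5) F. simp. split; [ tauto | ]. apply Hph; tauto.
  - intros s (I1 & I2 & I3 & I4 & I5) F D. simp_in D. frame F. fold n m1 in D.
    set (r0 := rv s rR) in *. set (r := r0 * IZR N / (IZR N + 1)).
    assert (Hr : 0 < r) by (apply Rdiv_lt_0_compat; nra).
    assert (Hr0 : r * (IZR N + 1) = r0 * IZR N) by (unfold r; field; lra).
    assert (Hr1 : r0 = r * (IZR N + 1) / IZR N) by (unfold r; field; lra).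
    apply wp_seq, wp_setr; [ simp; tauto | ]. apply wp_seq, wp_setr; [ simp; tauto | ].
    apply wp_seq, wp_setr; [ simp; tauto | ]. simp. fold r0. rewrite EN1, EN72. fold r.
    eapply wp_call.
    { apply (scan_spec M (IZR N) lg); simp; frame F; fold n; rewrite ?I1; auto; lia. }
    simp. frame F. fold n. rewrite I1.
    intros t s1 F1 (T1 & E1 & S1 & V1 & C1).
    frame F1. simp. split.
    + split; [ rewrite E1; reflexivity | ]. split; [ exact S1 | ]. split; [ nra | ].
      split; [ nra | ].
      (* Either an earlier margin serves [m], or [r0] was too large for it, and then the new [r] is
         within two steps of the progression below [m]. *)
      intros m H1 H2. destruct (Rle_dec (r0 * (IZR N + 1)) (m * IZR N)) as [H3 | H3].
      * destruct (I5 m H3 H2) as (r2 & A1 & A2 & A3 & A4). exists r2. repeat split; auto.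
        eapply covered_mono; [ | exact A4 ]. exact V1.
      * exists r. split; [ exact Hr | ]. split; [ exact H1 | ]. split; [ | exact C1 ].
        rewrite Hr0. nra.
    + assert (Hsum : sumf (weight (IZR N) r (72 * IZR N * r)) T + sumf (future (IZR N) r) T <=
          sumf (future (IZR N) r0) T).
      { rewrite <- sumf_plus. apply sumf_le. intros c _. rewrite Hr1. apply future_step; lra. }
      assert (Hln := ln_step (IZR N) (16 * IZR n * r0 / m1)).
      replace (16 * IZR n * r0 / m1 * IZR N / (IZR N + 1)) with (16 * IZR n * r / m1) in Hln
        by (unfold r; field; lra).
      specialize (Hln ltac:(apply Rdiv_lt_0_compat; nra) HNr).
      rewrite !plus_IZR in *.
      set (A := sumf (weight (IZR N) r (72 * IZR N * r)) T) in *.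
      set (B := sumf (future (IZR N) r) T) in *. set (C := sumf (future (IZR N) r0) T) in *.
      set (X := ln (16 * IZR n * r / m1)) in *. set (Y := ln (16 * IZR n * r0 / m1)) in *.
      assert (H1 : 0 <= IZR lg + 1) by lra.
      assert (H2 : 0 <= (IZR lg + 1) * (C - A - B)) by (apply Rmult_le_pos; lra).
      assert (H3 : 0 <= (IZR lg + 1) * (((IZR N + 1) * Y - ((IZR N + 1) * X + 1)) * (2 * IZR n + 1))).
      { apply Rmult_le_pos; [ lra | ]. apply Rmult_le_pos; lra. }
      simp. nra.
  - intros t s (I1 & I2 & I3 & I4 & I5) F D Ht. simp_in D. simp_in Ht. frame F. fold n m1 in D.
    split; [ | split; [ exact I2 | ] ].
    + assert (H1 := Hph _ (proj1 I3) I4).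
      rewrite Er in Ht. fold m1 in Ht.
      replace (16 * IZR n * m1 / m1) with (16 * IZR n) in Ht by (field; lra).
      assert (H2 : sumf (future (IZR N) m1) T <= IZR n * (72 * IZR N * IZR N * (IZR N + 1))).
      { rewrite <- (rd_Z_length (tm s0) 0 n) by lia. fold T. rewrite Rmult_comm, <- sumf_const.
        apply sumf_le. intros c _. apply future_le; lra. }
      set (Y := (IZR N + 1) * ln (16 * IZR n) * (2 * IZR n + 1)) in *.
      assert (H3 : 4000 * IZR (lg + 1) * (sumf (future (IZR N) m1) T + Y) <=
        4000 * IZR (lg + 1) * (IZR n * (72 * IZR N * IZR N * (IZR N + 1)) + Y))
        by (apply Rmult_le_compat_l; lra).
      rewrite !plus_IZR in *. lra.
    + intros m H1 H2. apply I5; [ | exact H2 ].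
      (* Stopping at [8 n] instead of [4 n] gives [2 r < m], hence [r (N + 1) <= m N] for every N >=
         1, so all required [m] have been served. *)
      assert (H3 : 8 * IZR n * rv s rR < m1).
      { apply Rnot_le_lt. intros K. apply D. apply Rle_not_lt. exact K. }
      assert (H4 : 8 * IZR n * rv s rR < 4 * IZR n * m) by lra.
      assert (H5 : 2 * rv s rR < m) by nra. nra.
Qed.

(** * The largest margin and the complete program *)

Definition max_loop : cmd :=
  CWhile (BLt $vi $vN)
    (CIf (BRLt (RVar rM) (margin_at $vi)) (CSetR rM (margin_at $vi)) CSkip ;;
     CSetI vi ($vi +' ACst 1)).

Lemma max_loop_spec s0 :
  (0 <= iv s0 vN)%Z -> iv s0 vi = 0%Z -> rv s0 rM = 0 ->
  wp max_loop (fun t s =>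
    (t <= 200 * iv s0 vN + 40)%Z /\ tm s = tm s0 /\ 0 <= rv s rM /\
    (forall c, In c (rd (tm s0) 0 (iv s0 vN)) -> margin c <= rv s rM) /\
    (0 < rv s rM -> exists c, In c (rd (tm s0) 0 (iv s0 vN)) /\ margin c = rv s rM)) s0.
Proof.
  intros Hn Ei EM.
  apply wp_while_Z with
    (Inv := fun s => (0 <= iv s vi <= iv s0 vN)%Z /\ tm s = tm s0 /\ 0 <= rv s rM /\
    (forall c, In c (rd (tm s0) 0 (iv s vi)) -> margin c <= rv s rM) /\
    (0 < rv s rM -> exists c, In c (rd (tm s0) 0 (iv s vi)) /\ margin c = rv s rM))
    (phi := fun s => (200 * (iv s0 vN - iv s vi))%Z).
  - rewrite Ei, EM. split; [ lia | ]. split; [ auto | ]. split; [ lra | ].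
    rewrite rd_nil by lia. split; [ intros c [] | lra ].
  - intros s (I1 & I2 & I3 & I4 & I5) F. simp. split; [ auto | lia ].
  - intros s (I1 & I2 & I3 & I4 & I5) F D. simp_in D. frame F.
    assert (Em : evalR (margin_at $vi) s = margin (tm s0 (iv s vi))).
    { unfold margin_at. simp. rewrite I2. reflexivity. }
    assert (Erd : rd (tm s0) 0 (iv s vi + 1) = rd (tm s0) 0 (iv s vi) ++ [tm s0 (iv s vi)]).
    { rewrite rd_snoc by lia. now rewrite Z.add_0_l. }
    apply wp_seq, wp_if.
    + unfold margin_at. simp. repeat split; lia.
    + cbn [holds]. rewrite Em. cbn [evalR]. intros D1. apply wp_setr; [ unfold margin_at; simp; repeat split; lia | ].
      apply wp_seti. rewrite Em. unfold margin_at. simp. split; [ | lia ].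
      split; [ lia | ]. split; [ auto | ]. split; [ lra | ]. rewrite Erd. split.
      * intros c Hc. apply in_app_or in Hc as [Hc | [<- | []]]; [ | lra ]. specialize (I4 c Hc). lra.
      * intros _. exists (tm s0 (iv s vi)). split; [ apply in_or_app; cbn; auto | auto ].
    + cbn [holds]. rewrite Em. cbn [evalR]. intros D1. apply wp_skip, wp_seti. unfold margin_at. simp. split; [ | lia ].
      split; [ lia | ]. split; [ auto | ]. split; [ lra | ]. rewrite Erd. split.
      * intros c Hc. apply in_app_or in Hc as [Hc | [<- | []]]; [ auto | lra ].
      * intros H. destruct (I5 H) as (c & Hc & Ec). exists c. split; [ apply in_or_app; auto | auto ].
  - intros t s (I1 & I2 & I3 & I4 & I5) F D T. simp_in D. simp_in T. frame F.
    assert (E : iv s vi = iv s0 vN) by lia. rewrite E in *. split; [ lia | ]. auto.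
Qed.

(** If no margin is positive, [rM] is 0 and the loop of [search] would run forever; the initial
    offer, of profit 0, is then optimal and is returned directly. *)
Definition solver (N : Z) : cmd :=
  CSetI vB (ACst 0) ;; CSetI vK $vN ;; CSetI vS ($vN +' $vN +' $vN) ;; merge_sort 1 ;;
  CSetI vi (ACst 0) ;; CSetR rM (RInt (ACst 0)) ;; max_loop ;;
  CSetR rV (RInt (ACst 0)) ;; CSetR rP (RVar rV) ;; CSetR rA (RVar rV) ;; CSetR rB (RVar rV) ;;
  CIf (BRLt (RVar rV) (RVar rM)) (CSetR rR (RVar rM) ;; search N) CSkip ;;
  CPut (ACst 0) (RVar rP) (RVar rA) (RVar rB).

Lemma solver_wf N : wfC (solver N).
Proof. cbn. unfold nvars. repeat split; lia. Qed.

Definition best_margin (M : market) (m : R) : Prop :=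
  (forall c, In c M -> margin c <= m) /\ exists c, In c M /\ margin c = m.

Lemma solver_spec M N lg :
  (1 <= N)%Z -> (1 <= length M)%nat -> (0 <= lg)%Z -> (Z.of_nat (length M) <= 2 ^ lg)%Z ->
  wp (solver N) (fun t s => exists v,
    0 <= v <= profit M (tm s 0%Z) /\
    IZR t <= 4000 * IZR (lg + 1) *
      (INR (length M) * (72 * IZR N * IZR N * (IZR N + 1)) +
       (IZR N + 1) * ln (16 * INR (length M)) * (2 * INR (length M) + 1)) +
       1000 * (INR (length M) + 1) * IZR (lg + 1) /\
    ((forall c, In c M -> margin c <= 0) \/
     exists m1, 0 < m1 /\ best_margin M m1 /\
       forall m, m1 <= 4 * INR (length M) * m -> m <= m1 ->
       exists r, 0 < r /\ r * (IZR N + 1) <= m * IZR N /\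
         m * IZR N * IZR N <= r * (IZR N + 1) * (IZR N + 1) /\
         covered M (IZR N) r (72 * IZR N * r) v)) (init_store M).
Proof.
  intros HN Hn Hlg Hpow.
  rewrite INR_IZR_INZ. set (n := Z.of_nat (length M)) in *.
  assert (Hn1 : (1 <= n)%Z) by lia.
  assert (HNr : 1 <= IZR N) by (apply IZR_le; lia).
  assert (Hnr : 1 <= IZR n) by (apply IZR_le; lia).
  assert (HL : 1 <= IZR (lg + 1)) by (apply IZR_le; lia).
  set (s0 := init_store M).
  assert (En : iv s0 vN = n) by reflexivity.
  assert (EM : rd (tm s0) 0 n = M) by apply rd_init.
  apply wp_seq, wp_seti, wp_seq, wp_seti, wp_seq, wp_seti, wp_seq. simp.
  eapply wp_call; [ apply (merge_sort_spec 1 lg); simp; rewrite ?En; lia | ].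
  simp. rewrite En, EM. intros t1 s1 F1 (T1 & S1 & P1 & _).
  apply wp_seq, wp_seti, wp_seq, wp_setr; [ simp; auto | ]. apply wp_seq. simp.
  eapply wp_call; [ apply max_loop_spec; simp; frame F1; simp; rewrite ?En; first [ lia | reflexivity ] | ].
  simp. frame F1. simp. rewrite En. intros t2 s2 F2 (T2 & E2 & M0 & M1 & M2).
  apply wp_seq, wp_setr; [ simp; auto | ]. apply wp_seq, wp_setr; [ simp; auto | ].
  apply wp_seq, wp_setr; [ simp; auto | ]. apply wp_seq, wp_setr; [ simp; auto | ]. simp.
  match goal with |- wp _ _ ?s => set (s3 := s) end.
  assert (Hsnd : sound M s3).
  { unfold sound, s3. simp. split; [ lra | ]. unfold profit, pr, q1, q2. cbn [fst snd]. lra. }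
  assert (En3 : iv s3 vN = n).
  { unfold s3. simp. frame F2. simp. frame F1. simp. exact En. }
  assert (HT1 : IZR t1 <= 500 * (IZR n + 1) * IZR (lg + 1)).
  { apply IZR_le in T1. rewrite !mult_IZR in T1. rewrite plus_IZR in T1. exact T1. }
  assert (HT2 : IZR t2 <= 200 * IZR n + 40).
  { apply IZR_le in T2. rewrite plus_IZR, mult_IZR in T2. exact T2. }
  assert (Hln : 0 <= ln (16 * IZR n)).
  { rewrite <- ln_1. left. apply ln_increasing; lra. }
  assert (Hpos : 0 <= IZR n * (72 * IZR N * IZR N * (IZR N + 1)) +
       (IZR N + 1) * ln (16 * IZR n) * (2 * IZR n + 1)).
  { assert (0 <= IZR n * (72 * IZR N * IZR N * (IZR N + 1))) by (repeat apply Rmult_le_pos; lra).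
    assert (0 <= (IZR N + 1) * ln (16 * IZR n) * (2 * IZR n + 1)) by (repeat apply Rmult_le_pos; lra).
    lra. }
  set (X := IZR n * (72 * IZR N * IZR N * (IZR N + 1)) +
       (IZR N + 1) * ln (16 * IZR n) * (2 * IZR n + 1)) in *.
  assert (HLX : 0 <= IZR (lg + 1) * X) by (apply Rmult_le_pos; lra).
  assert (Hmul : 0 <= (IZR (lg + 1) - 1) * (IZR n + 1)) by (apply Rmult_le_pos; lra).
  apply wp_seq, wp_if; [ unfold s3; simp; auto | | ]; unfold s3 at 1; simp; intros D.
  - apply wp_seq, wp_setr; [ simp; auto | ].
    eapply wp_call.
    { apply (search_spec M N lg); unfold s3 in *; simp; simp_in En3; rewrite ?En3, ?E2; auto; try lia. }
    unfold s3 in *. simp. simp_in En3. rewrite En3. intros t4 s4 F4 (T4 & S4 & C4).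
    apply wp_put; [ simp; auto with zarith | ]. simp.
    exists (rv s4 rV). split; [ | split ].
    + rewrite updT_same. exact S4.
    + fold X in T4. rewrite !plus_IZR in *. lra.
    + right. exists (rv s2 rM). split; [ exact D | ]. split; [ | exact C4 ].
      split.
      * intros c Hc. apply M1, (Permutation_in _ P1 Hc).
      * destruct (M2 D) as (c & Hc & Ec). exists c. split; [ | exact Ec ].
        apply (Permutation_in _ (Permutation_sym P1) Hc).
  - apply wp_skip. apply wp_put; [ simp; auto with zarith | ]. simp.
    exists 0. split; [ | split ].
    + rewrite updT_same. unfold sound in Hsnd. destruct Hsnd as [H1 H2]. unfold s3 in *. simp_in H1. simp_in H2. simp. lra.
    + rewrite !plus_IZR in *. lra.
    + left. intros c Hc. apply Rle_trans with (rv s2 rM); [ apply M1, (Permutation_in _ P1 Hc) | lra ].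
Qed.

(** * Approximation guarantee *)

Lemma buyer_margin P c : buys P c -> pr P - (q1 P + q2 P) <= margin c.
Proof. unfold buys, margin. lra. Qed.

Lemma cnt_pos f l : (0 < cnt f l)%nat -> exists c, In c l /\ f c = true.
Proof.
  unfold cnt. destruct (filter f l) as [|c l'] eqn:E; cbn; [ lia | intros _ ].
  exists c. apply filter_In. rewrite E. cbn. auto.
Qed.

Lemma profit_le M m P :
  0 <= m -> (forall c, In c M -> margin c <= m) -> profit M P <= m * INR (num_buyers M P).
Proof.
  intros Hm HM. unfold profit. destruct (Nat.eq_dec (num_buyers M P) 0) as [E | E].
  - rewrite E. cbn. lra.
  - apply Rmult_le_compat_r; [ apply pos_INR | ].
    destruct (cnt_pos (buysb P) M) as (c & Hc & Hb); [ rewrite num_buyers_cnt in E; lia | ].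
    apply buysb_true in Hb. apply buyer_margin in Hb. specialize (HM c Hc). lra.
Qed.

Lemma cnt_le_length f l : (cnt f l <= length l)%nat.
Proof. apply filter_length_le. Qed.

Lemma argmax (f : point -> R) l : l <> [] -> exists c, In c l /\ forall c', In c' l -> f c' <= f c.
Proof.
  induction l as [|a l IH]; [ congruence | intros _ ]. destruct l as [|b l].
  - exists a. split; [ cbn; auto | ]. intros c' [<- | []]. lra.
  - destruct IH as (c & Hc & Hmax); [ congruence | ].
    destruct (Rle_dec (f a) (f c)) as [H | H].
    + exists c. split; [ cbn in *; auto | ]. intros c' [<- | Hc']; auto.
    + exists a. split; [ cbn; auto | ]. intros c' [<- | Hc']; [ lra | ].
      specialize (Hmax c' Hc'). lra.
Qed.

(** A customer, taken as an offer, is bought at least by itself. *)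
Lemma best_margin_profit M m : best_margin M m -> 0 < m -> exists P, m <= profit M P.
Proof.
  intros (_ & c & Hc & Em) Hm. exists c. unfold profit.
  replace (pr c - (q1 c + q2 c)) with m by (rewrite <- Em; unfold margin; ring).
  assert (H : (1 <= num_buyers M c)%nat).
  { rewrite num_buyers_cnt. unfold cnt.
    destruct (filter (buysb c) M) as [|c' l'] eqn:E; [ | cbn; lia ].
    assert (K : In c (filter (buysb c) M)).
    { apply filter_In. split; [ auto | ]. apply buysb_true. unfold buys. lra. }
    rewrite E in K. destruct K. }
  apply le_INR in H. cbn in H. nra.
Qed.

(* Replaces the maximum of the profit, so that its attainment need not be proved *)
Lemma near_optimal M m P :
  best_margin M m -> 0 < m ->
  exists P0, profit M P <= profit M P0 /\ forall P', profit M P' <= 2 * profit M P0.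
Proof.
  intros HB Hm.
  destruct (completeness (fun z => exists P', z = profit M P')) as (s & Hub & Hlub).
  - exists (m * INR (length M)). intros z (P' & ->).
    eapply Rle_trans; [ apply (profit_le M m); [ lra | apply HB ] | ].
    apply Rmult_le_compat_l; [ lra | ]. apply le_INR, cnt_le_length.
  - exists (profit M P), P. reflexivity.
  - destruct (best_margin_profit M m HB Hm) as (Q & HQ).
    assert (Hs : m <= s) by (eapply Rle_trans; [ exact HQ | apply Hub; eauto ]).
    assert (Hall : forall P', profit M P' <= s) by (intros P'; apply Hub; eauto).
    destruct (Rlt_dec (s / 2) (profit M P)) as [H | H].
    + exists P. split; [ lra | ]. intros P'. specialize (Hall P'). lra.
    + destruct (Classical_Prop.classic (exists P0, s / 2 < profit M P0)) as [(P0 & HP0) | Hno].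
      * exists P0. split; [ lra | ]. intros P'. specialize (Hall P'). lra.
      * assert (s <= s / 2); [ | lra ]. apply Hlub. intros z (P' & ->).
        apply Rnot_lt_le. intros K. apply Hno. eauto.
Qed.

(* If many buyers of [P] had a margin above [L], a constant fraction of them would
   leave slack in the same coordinate, and moving [P] there would raise the profit. *)
Lemma few_large_buyers M P L S :
  0 < L -> 0 <= pr P - (q1 P + q2 P) -> (forall P', profit M P' <= S) ->
  INR (cnt (fun c => andb (buysb P c) (negb (small L c))) M) * L <= 9 * S.
Proof.
  intros HL Hm HS. set (m := pr P - (q1 P + q2 P)) in *. set (d := (L - m) / 3).
  set (P1 := (pr P, q1 P - d, q2 P) : point).
  set (P2 := (pr P, q1 P, q2 P - d) : point).
  set (P3 := (pr P + d, q1 P, q2 P) : point).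
  assert (Hcnt : (cnt (fun c => andb (buysb P c) (negb (small L c))) M <=
    cnt (buysb P1) M + (cnt (buysb P2) M + cnt (buysb P3) M))%nat).
  { eapply Nat.le_trans.
    - apply cnt_or with (g := buysb P1) (h := fun c => orb (buysb P2 c) (buysb P3 c)).
      intros c _ Hc. apply andb_prop in Hc as [Hb Hl]. apply buysb_true in Hb.
      apply Bool.negb_true_iff in Hl. apply Bool.not_true_iff_false in Hl.
      rewrite small_true in Hl. rewrite Bool.orb_true_iff, !buysb_true.
      unfold buys in *.
      change (pr P1) with (pr P). change (q1 P1) with (q1 P - d). change (q2 P1) with (q2 P).
      change (pr P2) with (pr P). change (q1 P2) with (q1 P). change (q2 P2) with (q2 P - d).
      change (pr P3) with (pr P + d). change (q1 P3) with (q1 P). change (q2 P3) with (q2 P).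
      destruct (Rle_dec (q1 c) (q1 P - d)); [ left; lra | right ].
      destruct (Rle_dec (q2 c) (q2 P - d)); [ left; lra | right ].
      unfold margin in Hl. unfold d in *. unfold m in *. lra.
    - apply Nat.add_le_mono_l. apply cnt_or. intros c _ Hc. now apply Bool.orb_true_iff. }
  (* The shifted offers have margin [m + d = (L + 2 m) / 3], which is at least [L / 3]; adding up
     the three gives the 9. *)
  assert (HP : forall Q, pr Q - (q1 Q + q2 Q) = m + d -> INR (cnt (buysb Q) M) * L <= 3 * S).
  { intros Q HQ. specialize (HS Q). unfold profit in HS. rewrite HQ, num_buyers_cnt in HS.
    pose proof (pos_INR (cnt (buysb Q) M)) as Hpos. unfold d in HS. nra. }
  pose proof (HP P1 ltac:(unfold P1, m, pr, q1, q2; cbn; ring)).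
  pose proof (HP P2 ltac:(unfold P2, m, pr, q1, q2; cbn; ring)).
  pose proof (HP P3 ltac:(unfold P3, m, pr, q1, q2; cbn; ring)).
  apply le_INR in Hcnt. rewrite !plus_INR in Hcnt. nra.
Qed.

(** The column used is the one just above the largest [q1] among the buyers, so it satisfies all of
    them. It exceeds [q1 P] by at most [r / N], and since the margin of [P] is at least [r + r / N],
    the new price does not exceed the old one. *)
Lemma covered_profit M N r v P :
  0 < r -> 0 < N -> covered M N r (72 * N * r) v ->
  r * (N + 1) <= (pr P - (q1 P + q2 P)) * N ->
  (0 < num_buyers M P)%nat ->
  r * INR (cnt (fun c => andb (buysb P c) (small (72 * N * r) c)) M) <= v.
Proof.
  intros Hr HN Hcov Hm Hk.
  destruct (argmax q1 (filter (buysb P) M)) as (c0 & Hc0 & Hmax).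
  { intros E. unfold num_buyers in Hk. rewrite E in Hk. cbn in Hk. lia. }
  apply filter_In in Hc0 as [Hin Hb]. apply buysb_true in Hb.
  destruct (Hcov c0 Hin) as (x & Hx & Hreach).
  eapply Rle_trans; [ | apply (Hreach (q2 P)) ].
  apply Rmult_le_compat_l; [ lra | ]. apply le_INR, cnt_mono.
  intros c Hc Hbc. apply andb_prop in Hbc as [Hbc Hs].
  apply andb_true_intro. split; [ | exact Hs ].
  assert (Hq := Hmax c ltac:(apply filter_In; auto)).
  apply buysb_true in Hbc. apply buys_offer. unfold buys in *.
  assert (r + r / N <= pr P - (q1 P + q2 P)).
  { apply Rmult_le_reg_r with N; [ auto | ]. replace ((r + r / N) * N) with (r * (N + 1)) by (field; lra). auto. }
  lra.
Qed.

Lemma approximation M N eps v P :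
  0 < eps < 1 -> 1 <= N -> 3 <= eps * N ->
  0 <= v <= profit M P ->
  ((forall c, In c M -> margin c <= 0) \/
     exists m1, 0 < m1 /\ best_margin M m1 /\
       forall m, m1 <= 4 * INR (length M) * m -> m <= m1 ->
       exists r, 0 < r /\ r * (N + 1) <= m * N /\
         m * N * N <= r * (N + 1) * (N + 1) /\ covered M N r (72 * N * r) v) ->
  approx_solution eps M P.
Proof.
  intros Heps HN HepsN Hv H Ps. apply Rle_ge.
  destruct H as [Hneg | (m1 & Hm1 & HB & Hcov)].
  { pose proof (profit_le M 0 Ps (Rle_refl _) Hneg). nra. }
  eapply Rle_trans; [ | apply Hv ].
  (* The analysis is done for an offer at least as good as the competitor [Ps] and within a factor 2
     of every offer. *)
  destruct (near_optimal M m1 Ps HB Hm1) as (P0 & HPs & Hall).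
  destruct (best_margin_profit M m1 HB Hm1) as (Q & HQ).
  assert (Hpos := Hall Q).
  set (m := pr P0 - (q1 P0 + q2 P0)) in *.
  set (k := INR (num_buyers M P0)).
  assert (Ek : profit M P0 = m * k) by reflexivity.
  assert (Hk0 : (0 < num_buyers M P0)%nat).
  { apply Nat.neq_0_lt_0. intros E. unfold k in Ek. rewrite E in Ek. cbn in Ek. lra. }
  assert (Hk : 1 <= k) by (apply (le_INR 1); lia).
  assert (Hm : 0 < m) by nra.
  assert (Hmm1 : m <= m1).
  { destruct (cnt_pos (buysb P0) M Hk0) as (c & Hc & Hb). apply buysb_true in Hb.
    apply buyer_margin in Hb. pose proof (proj1 HB c Hc). unfold m. lra. }
  assert (Hkn : k <= INR (length M)) by (apply le_INR, cnt_le_length).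
  (* The margin is in the searched range: [m1 <= 2 m k] and [k] is at most n. *)
  destruct (Hcov m) as (r & Hr & Hr1 & Hr2 & HC); [ nra | exact Hmm1 | ].
  assert (Hkeep := covered_profit M N r v P0 Hr ltac:(lra) HC Hr1 Hk0).
  assert (HL : 0 < 72 * N * r) by nra.
  assert (Hfew := few_large_buyers M P0 (72 * N * r) (2 * (m * k)) HL ltac:(fold m; lra)
    ltac:(intros P'; rewrite <- Ek; apply Hall)).
  set (kS := INR (cnt (fun c => andb (buysb P0 c) (small (72 * N * r) c)) M)) in *.
  set (kL := INR (cnt (fun c => andb (buysb P0 c) (negb (small (72 * N * r) c))) M)) in *.
  assert (Hsum : k <= kS + kL).
  { unfold k, kS, kL. rewrite <- plus_INR. apply le_INR. rewrite num_buyers_cnt. apply cnt_or.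
    intros c _ Hc. rewrite Hc. destruct (small _ c); auto. }
  assert (Hm4 : m <= 4 * r).
  { apply Rmult_le_reg_r with (N * N); [ nra | ]. nra. }
  (* Here the 72 is used up: [72 N r kL <= 18 m k <= 72 r k]. *)
  assert (HkL : N * kL <= k).
  { apply Rmult_le_reg_r with (72 * r); [ lra | ].
    assert (m * k <= 4 * r * k) by (apply Rmult_le_compat_r; lra). nra. }
  assert (H1 : r * (k * (N - 1)) <= v * N).
  { assert (r * (k - kL) <= v).
    { eapply Rle_trans; [ | exact Hkeep ]. apply Rmult_le_compat_l; lra. }
    nra. }
  assert (H2 : m * N * N * (k * (N - 1)) <= v * N * ((N + 1) * (N + 1))).
  { apply Rle_trans with (r * (N + 1) * (N + 1) * (k * (N - 1))).
    - apply Rmult_le_compat_r; [ apply Rmult_le_pos; lra | exact Hr2 ].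
    - replace (r * (N + 1) * (N + 1) * (k * (N - 1))) with (r * (k * (N - 1)) * ((N + 1) * (N + 1))) by ring.
      apply Rmult_le_compat_r; [ nra | exact H1 ]. }
  (* The losses combine by [N^2 (N - 1) >= (N - 3) (N + 1)^2]. *)
  assert (H3 : m * k * (N - 3) <= v * N).
  { assert (Hmk : 0 <= m * k) by nra.
    apply Rmult_le_reg_r with ((N + 1) * (N + 1)); [ nra | ].
    eapply Rle_trans; [ | exact H2 ].
    replace (m * N * N * (k * (N - 1))) with (m * k * (N * N * (N - 1))) by ring.
    rewrite Rmult_assoc. apply Rmult_le_compat_l; [ exact Hmk | nra ]. }
  assert (H4 : m * k * (1 - eps) <= v).
  { apply Rmult_le_reg_r with N; [ lra | ]. eapply Rle_trans; [ | exact H3 ].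
    rewrite Rmult_assoc. apply Rmult_le_compat_l; nra. }
  assert ((1 - eps) * profit M Ps <= (1 - eps) * (m * k)) by (apply Rmult_le_compat_l; lra).
  lra.
Qed.

(** * Coin strings, the time bound and the conclusion *)

Fixpoint bits (n : nat) : list (list bool) :=
  match n with
  | O => [[]]
  | S n' => map (cons true) (bits n') ++ map (cons false) (bits n')
  end.

Lemma bits_length n : INR (length (bits n)) = 2 ^ n.
Proof.
  induction n as [|n IH]; cbn [bits pow]; [ reflexivity | ].
  rewrite length_app, !length_map, plus_INR, IH. ring.
Qed.

Lemma bits_in n b : In b (bits n) -> length b = n.
Proof.
  revert b. induction n as [|n IH]; cbn [bits]; intros b Hb.
  - destruct Hb as [<- | []]. reflexivity.
  - apply in_app_or in Hb as [Hb | Hb]; apply in_map_iff in Hb as (b' & <- & Hb');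
      cbn; f_equal; auto.
Qed.

Lemma bits_NoDup n : NoDup (bits n).
Proof.
  induction n as [|n IH]; cbn [bits]; [ repeat constructor; auto | ].
  apply NoDup_app.
  - apply FinFun.Injective_map_NoDup; [ | exact IH ]. intros x y E. congruence.
  - apply FinFun.Injective_map_NoDup; [ | exact IH ]. intros x y E. congruence.
  - intros b H1 H2. apply in_map_iff in H1 as (b1 & <- & _). apply in_map_iff in H2 as (b2 & E & _).
    congruence.
Qed.

(** If the output does not depend on the coins, all [2 ^ L] strings are good. *)
Lemma deterministic_monte_carlo prog eps M T q L P :
  INR L <= T -> q <= 1 -> (forall coins, run prog M coins L = Some P) ->
  approx_solution eps M P -> monte_carlo_run prog eps M T q.
Proof.
  intros HT Hq Hrun HP. exists L. split; [ exact HT | ]. split; [ eauto | ].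
  exists (bits L). split; [ apply bits_NoDup | ]. split.
  - intros b Hb. split; [ now apply bits_in | ]. exists P. auto.
  - rewrite bits_length. pose proof (pow_lt 2 L ltac:(lra)). nra.
Qed.

(** With [ln 2 > 1/2], the rounded-down logarithm is at most [2 ln n], and the remaining 2 is at
    most [4 ln n]. *)
Lemma log2_up_bound n : (2 <= n)%nat -> IZR (Z.log2_up (Z.of_nat n) + 1) <= 6 * ln (INR n).
Proof.
  intros Hn. set (lg := Z.log2_up (Z.of_nat n)).
  destruct (Z.log2_up_spec (Z.of_nat n) ltac:(lia)) as [H _]. fold lg in H.
  assert (Hlg : (0 < lg)%Z) by (apply Z.log2_up_pos; lia).
  assert (H2 : 2 ^ (Z.to_nat (Z.pred lg)) < INR n).
  { rewrite INR_IZR_INZ, pow_IZR. apply IZR_lt. rewrite Z2Nat.id by lia. exact H. }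
  apply ln_increasing in H2; [ | apply pow_lt; lra ].
  rewrite ln_pow in H2 by lra.
  rewrite INR_IZR_INZ, Z2Nat.id in H2 by lia.
  assert (Hln2 : ln 2 <= ln (INR n)).
  { assert (H3 : 2 <= INR n) by (apply (le_INR 2); lia).
    destruct H3 as [H3 | <-]; [ left; apply ln_increasing; lra | lra ]. }
  pose proof ln_lt_2.
  assert (0 <= IZR (Z.pred lg)) by (apply IZR_le; lia).
  replace (lg + 1)%Z with (Z.pred lg + 2)%Z by lia. rewrite plus_IZR. nra.
Qed.

(** The cubic term carries only the logarithm [L] of the sorting, while the linear term in N carries
    two; [l >= 1/2] lifts the former to the common bound. *)
Lemma time_bound (n l L N A : R) :
  2 <= n -> / 2 <= l -> 0 <= L <= 6 * l -> 1 <= N <= A ->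
  4000 * L * (n * (72 * N * N * (N + 1)) + (N + 1) * (5 * l) * (2 * n + 1)) +
    1000 * (n + 1) * L <= 10000000 * A ^ 3 * n * l ^ 2.
Proof.
  intros Hn Hl HL HN.
  assert (HA : N * N * N <= A ^ 3).
  { replace (N * N * N) with (N ^ 3) by ring. apply pow_incr. lra. }
  assert (HN2 : 1 <= N * N) by nra.
  assert (HNN : N <= N * N * N) by nra.
  set (B := A ^ 3) in *.
  assert (E1 : 72 * N * N * (N + 1) <= 144 * B) by nra.
  assert (E2 : (N + 1) * (2 * n + 1) <= 6 * (B * n)) by nra.
  assert (HBn : 2 <= B * n) by nra.
  assert (E3 : n * (72 * N * N * (N + 1)) <= 288 * (B * n * l)).
  { apply Rle_trans with (n * (144 * B)); [ apply Rmult_le_compat_l; lra | ]. nra. }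
  assert (E4 : (N + 1) * (5 * l) * (2 * n + 1) <= 30 * (B * n * l)).
  { replace ((N + 1) * (5 * l) * (2 * n + 1)) with (5 * l * ((N + 1) * (2 * n + 1))) by ring.
    replace (30 * (B * n * l)) with (5 * l * (6 * (B * n))) by ring.
    apply Rmult_le_compat_l; lra. }
  assert (E5 : 1000 * (n + 1) <= 4000 * (B * n * l)).
  { assert (n <= B * n) by nra. nra. }
  set (X := B * n * l) in *.
  assert (HX : 0 <= X) by (unfold X; nra).
  replace (10000000 * B * n * l ^ 2) with (10000000 * X * l) by (unfold X; ring).
  assert (E6 : 4000 * L * (n * (72 * N * N * (N + 1)) + (N + 1) * (5 * l) * (2 * n + 1)) <=
    4000 * L * (318 * X)) by (apply Rmult_le_compat_l; lra).
  assert (E7 : 1000 * (n + 1) * L <= 4000 * X * L) by (apply Rmult_le_compat_r; lra).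
  assert (E8 : X * L <= X * (6 * l)) by (apply Rmult_le_compat_l; lra).
  nra.
Qed.

Theorem theorem3 :
  exists C : R, 0 < C /\
  forall eps : R, 0 < eps < 1 ->
  exists (prog : program) (c : R), 0 < c /\
  forall M : market, (2 <= length M)%nat -> pareto_optimal M ->
    monte_carlo_run prog eps M
      (C * / eps ^ 3 * INR (length M) * (ln (INR (length M))) ^ 2)
      (1 - Rpower (INR (length M)) (- c)).
Proof.
  (* 64 is [4^3], since N is at most [3/eps + 1 <= 4/eps]. *)
  exists (64 * 10000000). split; [ lra | ]. intros eps Heps.
  destruct (archimed (3 / eps)) as [Hup1 Hup2].
  set (N := up (3 / eps)) in *.
  assert (He : eps * (3 / eps) = 3) by (field; lra).
  assert (HepsN : 3 <= eps * IZR N) by nra.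
  assert (HN1 : 1 <= IZR N) by nra.
  assert (HNA : IZR N <= 4 / eps).
  { assert (1 <= / eps) by (rewrite <- Rinv_1; apply Rinv_le_contravar; lra).
    unfold Rdiv in *. lra. }
  (* The run always succeeds, so any positive exponent would serve. *)
  exists (compC (solver N) 0), 1. split; [ lra | ]. intros M Hn _.
  set (n := length M) in *. set (lg := Z.log2_up (Z.of_nat n)).
  destruct (solver_spec M N lg) as (t & s & E & v & Hv & Ht & Hcov); fold n.
  - apply le_IZR. exact HN1.
  - lia.
  - apply Z.log2_up_nonneg.
  - apply Z.log2_up_spec. lia.
  - fold n in Ht, Hcov. pose proof (cost_nonneg _ _ _ _ E) as Ht0.
    apply (deterministic_monte_carlo _ _ _ _ _ (Z.to_nat t) (tm s 0%Z)).
    + rewrite INR_IZR_INZ, Z2Nat.id by exact Ht0. eapply Rle_trans; [ exact Ht | ].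
      assert (Hn2 : 2 <= INR n) by (apply (le_INR 2); exact Hn).
      assert (Hl2 : ln 2 <= ln (INR n)).
      { destruct Hn2 as [H | <-]; [ left; apply ln_increasing; lra | lra ]. }
      pose proof ln_lt_2.
      assert (H16 : ln (16 * INR n) <= 5 * ln (INR n)).
      { rewrite ln_mult by lra. replace 16 with (2 ^ 4) by ring. rewrite ln_pow by lra.
        replace (INR 4) with 4 by (cbn; ring). lra. }
      assert (HL0 : 0 <= IZR (lg + 1)).
      { apply IZR_le. pose proof (Z.log2_up_nonneg (Z.of_nat n)). fold lg in H0. lia. }
      replace (64 * 10000000 * / eps ^ 3 * INR n * ln (INR n) ^ 2)
        with (10000000 * (4 / eps) ^ 3 * INR n * ln (INR n) ^ 2) by (field; lra).
      eapply Rle_trans; [ | apply (time_bound (INR n) (ln (INR n)) (IZR (lg + 1)) (IZR N)); try lra ].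
      * apply Rplus_le_compat_r, Rmult_le_compat_l; [ lra | ].
        apply Rplus_le_compat_l, Rmult_le_compat_r; [ lra | ].
        apply Rmult_le_compat_l; lra.
      * split; [ exact HL0 | apply log2_up_bound; exact Hn ].
    + assert (0 < Rpower (INR n) (- (1))) by apply exp_pos. lra.
    + apply (run_compiled _ M t); [ apply solver_wf | exact E | lia ].
    + apply (approximation M (IZR N) eps v); auto.
Qed.
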